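(* Let $I$ and $J$ be $k$-subsets of $\{1,\dots,n\}$, let $L_I$ and $L_J$ be the corresponding rank $1$ modules, and let $m$ be a positive integer. Let $s$ be the number of $LR$ trapezia (boxes) for the rims of $\Omega^{2m}(L_I)$ and $L_J$. Then there exist positive integers $h_1,h_2,\dots,h_{s-1}$ with $h_i\le h_{i+1}$ such that, as modules over the centre $\mathbb F[t]$, $$\mathrm{Ext}^{2m+1}_B(L_I,L_J)\cong \mathbb F[t]/(t^{h_1})\times \mathbb F[t]/(t^{h_2})\times\cdots\times\mathbb F[t]/(t^{h_{s-1}})$$ (for $s\le 1$ the list of $h_i$ is empty and the right-hand side is the zero module).
   Context: Let $\mathbb F$ be an algebraically closed field, and let $n\ge 2$ and $1\le k\le n-1$ be integers. Elements of $\{1,\dots,n\}$ are read modulo $n$. Let $B$ be the quotient of the path algebra over $\mathbb F$ of the quiver with vertex set $\mathbb Z_n$ and arrows $x_i:i-1\to i$, $y_i:i\to i-1$ ($i\in\mathbb Z_n$) by the relations $xy=yx$ and $x^k=y^{n-k}$, one of each kind starting at every vertex (that is, $x_iy_i=y_{i+1}x_{i+1}$ at vertex $i$, paths composed as functions, and the length-$k$ path of $x$'s from $i$ to $i+k$ equals the length-$(n-k)$ path of $y$'s from $i$ to $i+k$). Its centre is $Z=\mathbb F[t]$, $t=\sum_i x_iy_i$. Modules are left modules, i.e. representations of the quiver. For a $k$-subset $I\subseteq\{1,\dots,n\}$, the rank $1$ module $L_I$ has a copy $U_i=\mathbb F[t]$ at each vertex $i$; $x_i:U_{i-1}\to U_i$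 is multiplication by $1$ if $i\in I$ and by $t$ if $i\notin I$; $y_i:U_i\to U_{i-1}$ is multiplication by $t$ if $i\in I$ and by $1$ if $i\notin I$. Every rank $1$ module that is free over $Z$ is isomorphic to $L_I$ for a unique $I$, called its rim (the rank of a $B$-module $M$ is the length of $M\otimes_Z K$ over $B\otimes_Z K\cong M_n(K)$, $K$ the fraction field of $Z$). Put $P_j=Be_j$, where $e_j$ is the idempotent at vertex $j$. Even syzygies. Let $U=\{u\notin I: u+1\in I\}$ and $V=\{v\in I: v+1\notin I\}$. The module $L_I$ has the projective presentation $\bigoplus_{v\in V}P_v\xrightarrow{D}\bigoplus_{u\in U}P_u\xrightarrow{\pi}L_I\to 0$, where $\pi$ sends $e_u$ to $1\in U_u$, and $D$ sends $e_v$ to $x^{v-u_-}-y^{u_+-v}$; here $u_-$ and $u_+$ are the elements of $U$ immediately preceding and following $v$ in cyclic order, $x^{v-u_-}\in P_{u_-}$ is the path of $x$'s from $u_-$ to $v$, and $y^{u_+-v}\in P_{u_+}$ is the path of $y$'s from $u_+$ to $v$. Put $\Omega^2(L_I)=\ker D$. It is again a rank $1$ module free over $Z$, with rim $I+k=\{a+k: a\in I\}$, so the construction is iterated: $\Omega^{2m+2}(L_I)=\Omega^2(\Omega^{2m}(L_I))$, and $\Omega^{2m}(L_I)$ has rim $I+mk$. Number of $LR$ trapezia (boxes) for two $k$-subsets $I',J$: read the elements of the symmetric difference of $I'$ and $J$ in cyclic order, writing the letter $L$ for each element of $J\setminus I'$ and the letter $R$ for each element of $I'\setminus J$. Collapse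 maximal (cyclic) runs of equal letters to a single letter; up to cyclic rotation the resulting word is $(LR)^s$, and $s$ is the number of $LR$ boxes (so $s=0$ if $I'=J$, and $s\ge1$ otherwise). *)

(* Defs.v *)
From HB Require Import structures.
From mathcomp Require Import all_boot all_order all_algebra generic_quotient ring_quotient.
From mathcomp Require Import boolp classical_sets functions cardinality fsbigop.
From mathcomp Require Import zify.

Set Implicit Arguments.
Unset Strict Implicit.
Unset Printing Implicit Defensive.

Import GRing.Theory.
Local Open Scope ring_scope.
Local Open Scope quotient_scope.

Record submodule (R : pzRingType) (V : lmodType R) := Submodule {
  smem :> V -> Prop;
  smem0 : smem 0;
  smemP : forall a u v, smem u -> smem v -> smem (a *: u + v) }.

Definition smemb (R : pzRingType) (V : lmodType R) (S : submodule V) : V -> bool :=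
  fun v => `[< S v >].

Lemma smemb_closed (R : pzRingType) (V : lmodType R) (S : submodule V) :
  subsemimod_closed (smemb S).
Proof.
split; first split; first by apply/asboolP; exact: smem0.
  move=> u v /asboolP Su /asboolP Sv; apply/asboolP.
  by rewrite -[u]scale1r; exact: smemP.
move=> a u /asboolP Su; apply/asboolP; rewrite -[a *: u]addr0.
by apply: smemP => //; exact: smem0.
Qed.

HB.instance Definition _ (R : pzRingType) (V : lmodType R) (S : submodule V) :=
  GRing.isSubmodClosed.Build R V (smemb S) (smemb_closed S).

Record submod (R : pzRingType) (V : lmodType R) (S : submodule V) :=
  Submod { subval :> V; subvalP : smemb S subval }.

HB.instance Definition _ (R : pzRingType) (V : lmodType R) (S : submodule V) :=
  [isSub for @subval R V S].
HB.instance Definition _ (R : pzRingType) (V : lmodType R) (S : submodule V) :=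
  [Choice of submod S by <:].
HB.instance Definition _ (R : pzRingType) (V : lmodType R) (S : submodule V) :=
  [SubChoice_isSubLmodule of submod S by <:].

Section QuotientModule.
Variables (R : pzRingType) (V : lmodType R) (S : submodule V).

Definition quotmod : Type := Quotient.quot (GRing.ZmodClosed.clone V (smemb S) _).

HB.instance Definition _ := Choice.on quotmod.
HB.instance Definition _ := EqQuotient.on quotmod.
HB.instance Definition _ := GRing.Zmodule.on quotmod.

Definition quot_scale (a : R) : quotmod -> quotmod := lift_op1 quotmod ( *:%R a).

Lemma pi_quot_scale a : {morph \pi_quotmod : v / a *: v >-> quot_scale a v}.
Proof.
move=> v; unlock quot_scale; apply/eqP; rewrite -Quotient.idealrBE -scalerBr.
by apply: rpredZ; rewrite Quotient.idealrBE reprK.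
Qed.
Canonical pi_quot_scale_morph a := PiMorph1 (pi_quot_scale a).

Lemma quot_scaleA a b v : quot_scale a (quot_scale b v) = quot_scale (a * b) v.
Proof. by rewrite -[v]reprK !piE scalerA. Qed.
Lemma quot_scale1 : left_id 1 quot_scale.
Proof. by move=> v; rewrite -[v]reprK !piE scale1r. Qed.
Lemma quot_scaleDr : right_distributive quot_scale +%R.
Proof. by move=> a u v; rewrite -[u]reprK -[v]reprK !piE scalerDr. Qed.
Lemma quot_scaleDl v : {morph quot_scale^~ v : a b / a + b}.
Proof. by move=> a b; rewrite -[v]reprK !piE scalerDl. Qed.

HB.instance Definition _ := GRing.Zmodule_isLmodule.Build R quotmod
  quot_scaleA quot_scale1 quot_scaleDr quot_scaleDl.

End QuotientModule.

Section FreeModule.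
Variables (R : pzRingType) (S : choiceType).

Definition finsupp_by (f : S -> R^o) (s : seq S) := forall x, x \notin s -> f x = 0.

Definition finsupp_submodule : submodule (S -> R^o).
Proof.
apply: (@Submodule R (S -> R^o) (fun f => exists s, finsupp_by f s)).
  by exists [::].
move=> a f g [s fs] [r gr]; exists (s ++ r) => x.
rewrite mem_cat negb_or => /andP[xs xr].
by rewrite addrfctE scalrfctE fs // gr // scaler0 addr0.
Defined.

Definition freemod : Type := submod finsupp_submodule.
HB.instance Definition _ := GRing.Lmodule.on freemod.

Definition fcoef (f : freemod) (x : S) : R := val f x.

Lemma freemod_supp (f : freemod) : exists2 s, uniq s & finsupp_by (val f) s.
Proof.
have /asboolP[s fs] := subvalP f.
by exists (undup s); rewrite ?undup_uniq // => x; rewrite mem_undup => /fs.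
Qed.

Lemma fbasis_subproof (x : S) :
  smemb finsupp_submodule (fun y => (y == x)%:R).
Proof. by apply/asboolP; exists [:: x] => y; rewrite inE => /negPf->. Qed.

Definition fbasis (x : S) : freemod := Submod (fbasis_subproof x).

(** The linear map [freemod -> V] with [fbasis x |-> h x]. *)
Definition lext (V : lmodType R) (h : S -> V) (f : freemod) : V :=
  \sum_(x \in [set: S]) fcoef f x *: h x.

Lemma lextE (V : lmodType R) (h : S -> V) (f : freemod) s :
  uniq s -> finsupp_by (val f) s -> lext h f = \sum_(x <- s) fcoef f x *: h x.
Proof.
move=> us fs; rewrite fsbig_seq //; apply/esym/fsbig_widen => //.
by move=> x [_ /= /negP xs]; rewrite /fcoef fs // scale0r.
Qed.

Lemma lext_is_linear (V : lmodType R) (h : S -> V) : linear (lext h).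
Proof.
move=> a f g; have [s us fs] := freemod_supp f; have [r ur gr] := freemod_supp g.
pose w := undup (s ++ r).
have fw : finsupp_by (val f) w.
  by move=> x; rewrite mem_undup mem_cat negb_or => /andP[/fs].
have gw : finsupp_by (val g) w.
  by move=> x; rewrite mem_undup mem_cat negb_or => /andP[_ /gr].
have fgw : finsupp_by (val (a *: f + g)) w.
  by move=> x xw; rewrite /= addrfctE scalrfctE fw // gw // scaler0 addr0.
rewrite !(@lextE _ _ _ w) ?undup_uniq // scaler_sumr -big_split /=.
by apply: eq_bigr => x _; rewrite /fcoef /= addrfctE scalrfctE scalerDl scalerA.
Qed.

HB.instance Definition _ (V : lmodType R) (h : S -> V) :=
  GRing.isLinear.Build R freemod V *:%R (lext h) (lext_is_linear h).

Lemma lext_basis (V : lmodType R) (h : S -> V) x : lext h (fbasis x) = h x.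
Proof.
rewrite (@lextE _ _ _ [:: x]) //= => [|y]; last by rewrite inE => /negPf->.
by rewrite big_seq1 /fcoef /= eqxx scale1r.
Qed.

Lemma freemod_ind (P : freemod -> Prop) :
  P 0 -> (forall a x f, P f -> P (a *: fbasis x + f)) -> forall f, P f.
Proof.
move=> P0 PD f; have [s us fs] := freemod_supp f.
suff -> : f = \sum_(x <- s) fcoef f x *: fbasis x.
  by elim: s {us fs} => [|x s IHs]; rewrite ?big_nil // big_cons; apply: PD.
apply/val_inj/funext => y; rewrite raddf_sum /= fct_sumE.
have [ys|ys] := boolP (y \in s).
  rewrite (bigD1_seq y) //= scalrfctE eqxx big1 ?addr0 => [|x /negPf xy].
    by rewrite /GRing.scale /= mulr1.
  by rewrite scalrfctE eq_sym xy scaler0.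
rewrite fs // big_seq big1 // => x xs; rewrite scalrfctE.
by case: eqP => [yx|_]; rewrite ?scaler0 //; rewrite yx xs in ys.
Qed.

End FreeModule.

Inductive ideal_gen (A : pzRingType) (S : A -> Prop) : A -> Prop :=
| ideal_gen0 : ideal_gen S 0
| ideal_genD a s b u : S s -> ideal_gen S u -> ideal_gen S (a * s * b + u).

Section QuotientRing.
Variables (A : pzRingType) (S : A -> Prop).

Lemma ideal_gen_add u v : ideal_gen S u -> ideal_gen S v -> ideal_gen S (u + v).
Proof.
move=> Iu Iv; elim: Iu => [|a s b w Ss _ IHw]; first by rewrite add0r.
by rewrite -addrA; apply: ideal_genD.
Qed.

Lemma ideal_gen_mul c d u : ideal_gen S u -> ideal_gen S (c * u * d).
Proof.
elim=> [|a s b w Ss _ IHw]; first by rewrite mulr0 mul0r; apply: ideal_gen0.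
by rewrite mulrDr mulrDl !mulrA -(mulrA (c * a * s)); apply: ideal_genD.
Qed.

Definition idealb : A -> bool := fun u => `[< ideal_gen S u >].

Lemma idealb_closed : zmod_closed idealb.
Proof.
split=> [|u v /asboolP Iu /asboolP Iv]; apply/asboolP; first exact: ideal_gen0.
by apply: ideal_gen_add => //; rewrite -[- v]mulr1 -mulN1r; exact: ideal_gen_mul.
Qed.

HB.instance Definition _ := GRing.isZmodClosed.Build A idealb idealb_closed.

Definition quotring : Type := Quotient.quot (GRing.ZmodClosed.clone A idealb _).

HB.instance Definition _ := Choice.on quotring.
HB.instance Definition _ := EqQuotient.on quotring.
HB.instance Definition _ := GRing.Zmodule.on quotring.

Definition quot_one : quotring := lift_cst quotring 1.
Definition quot_mul := lift_op2 quotring *%R.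

Canonical pi_quot_one_morph := PiConst quot_one.

Lemma quotring_eq (u v : A) : \pi_quotring u = \pi v <-> ideal_gen S (u - v).
Proof.
split=> [/eqP|Iuv]; first by rewrite -Quotient.idealrBE => /asboolP.
by apply/eqP; rewrite -Quotient.idealrBE; apply/asboolP.
Qed.

Lemma pi_quot_mul : {morph \pi_quotring : x y / x * y >-> quot_mul x y}.
Proof.
move=> x y; unlock quot_mul; apply/quotring_eq.
set x' := repr _; set y' := repr _.
have Ix : ideal_gen S (x - x') by apply/quotring_eq; rewrite reprK.
have Iy : ideal_gen S (y - y') by apply/quotring_eq; rewrite reprK.
have -> : x * y - x' * y' = 1 * (x - x') * y + x' * (y - y') * 1.
  by rewrite mul1r mulr1 mulrBl mulrBr addrA subrK.
by apply: ideal_gen_add; apply: ideal_gen_mul.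
Qed.
Canonical pi_quot_mul_morph := PiMorph2 pi_quot_mul.

Lemma quot_mulA : associative quot_mul.
Proof. by move=> x y z; rewrite -[x]reprK -[y]reprK -[z]reprK !piE mulrA. Qed.
Lemma quot_mul1r : left_id quot_one quot_mul.
Proof. by move=> x; rewrite -[x]reprK !piE mul1r. Qed.
Lemma quot_mulr1 : right_id quot_one quot_mul.
Proof. by move=> x; rewrite -[x]reprK !piE mulr1. Qed.
Lemma quot_mulDl : left_distributive quot_mul +%R.
Proof. by move=> x y z; rewrite -[x]reprK -[y]reprK -[z]reprK !piE mulrDl. Qed.
Lemma quot_mulDr : right_distributive quot_mul +%R.
Proof. by move=> x y z; rewrite -[x]reprK -[y]reprK -[z]reprK !piE mulrDr. Qed.

HB.instance Definition _ := GRing.Zmodule_isPzRing.Build quotring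
  quot_mulA quot_mul1r quot_mulr1 quot_mulDl quot_mulDr.

Definition qpi (x : A) : quotring := \pi_quotring x.

Lemma qpi_is_zmod_morphism : zmod_morphism qpi.
Proof. by move=> x y; rewrite /qpi !piE. Qed.
HB.instance Definition _ :=
  GRing.isZmodMorphism.Build A quotring qpi qpi_is_zmod_morphism.

Lemma qpi_is_monoid_morphism : monoid_morphism qpi.
Proof. by split=> [|x y]; rewrite /qpi !piE. Qed.
HB.instance Definition _ :=
  GRing.isMonoidMorphism.Build A quotring qpi qpi_is_monoid_morphism.

Lemma qpi_eq (u v : A) : qpi u = qpi v <-> ideal_gen S (u - v).
Proof. exact: quotring_eq. Qed.

Lemma qpi_repr (b : quotring) : qpi (repr b) = b.
Proof. exact: reprK. Qed.

End QuotientRing.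

(** An [A]-module killed by the relations [S], as a module over [quotring S]. *)
Section Descent.
Variables (A : pzRingType) (S : A -> Prop) (M : lmodType A).

Definition killed := forall s (v : M), S s -> s *: v = 0.

Definition descent of killed : Type := M.

Variable kill : killed.
HB.instance Definition _ := GRing.Zmodule.on (descent kill).

Definition descent_scale (b : quotring S) (v : descent kill) : descent kill :=
  repr b *: (v : M).

Lemma ideal_gen_kill u (v : M) : ideal_gen S u -> u *: v = 0.
Proof.
elim=> [|a s b w Ss _ IHw]; first by rewrite scale0r.
by rewrite scalerDl -!scalerA (kill _ Ss) scaler0 IHw addr0.
Qed.

Lemma descent_scaleE (a : A) (v : M) : descent_scale (qpi S a) v = a *: v.
Proof.
apply/eqP; rewrite /descent_scale -subr_eq0 -scalerBl.
by rewrite ideal_gen_kill //; apply/qpi_eq; rewrite qpi_repr.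
Qed.

Lemma descent_scaleA a b v : descent_scale a (descent_scale b v) = descent_scale (a * b) v.
Proof.
by rewrite -[a]qpi_repr -[b]qpi_repr -rmorphM !descent_scaleE scalerA.
Qed.
Lemma descent_scale1 : left_id 1 descent_scale.
Proof. by move=> v; rewrite -(rmorph1 (qpi S)) descent_scaleE scale1r. Qed.
Lemma descent_scaleDr : right_distributive descent_scale +%R.
Proof. by move=> a u v; rewrite /descent_scale scalerDr. Qed.
Lemma descent_scaleDl v : {morph descent_scale^~ v : a b / a + b}.
Proof.
by move=> a b; rewrite -[a]qpi_repr -[b]qpi_repr -rmorphD !descent_scaleE scalerDl.
Qed.

HB.instance Definition _ := GRing.Zmodule_isLmodule.Build (quotring S) (descent kill)
  descent_scaleA descent_scale1 descent_scaleDr descent_scaleDl.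

End Descent.

Record quiver := Quiver {
  vertex : finType;
  arrow : choiceType;
  asrc : arrow -> vertex;
  atgt : arrow -> vertex }.

Section PathAlgebra.
Variables (F : fieldType) (Q : quiver).

Fixpoint walk (v : vertex Q) (w : seq (arrow Q)) : bool :=
  if w is a :: w' then (asrc a == v) && walk (atgt a) w' else true.

(** A path is its source together with its arrows, listed in the order in which
    they are traversed. *)
Record qpath := QPath { pval : vertex Q * seq (arrow Q); pvalP : walk pval.1 pval.2 }.
HB.instance Definition _ := [isSub for pval].
HB.instance Definition _ := [Choice of qpath by <:].

Definition psrc (p : qpath) : vertex Q := (pval p).1.
Definition parr (p : qpath) : seq (arrow Q) := (pval p).2.
Definition ptgt (p : qpath) : vertex Q := last (psrc p) (map (@atgt Q) (parr p)).

Lemma walk_cat v w w' :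
  walk v (w ++ w') = walk v w && walk (last v (map (@atgt Q) w)) w'.
Proof. by elim: w v => //= a w IHw v; rewrite IHw andbA. Qed.

(** [pcomp p q] is "[p] after [q]", when [q] ends where [p] starts. *)
Definition pcomp (p q : qpath) : option qpath :=
  if ptgt q == psrc p then insub (psrc q, parr q ++ parr p) else None.

Lemma pcompP (p q : qpath) : ptgt q = psrc p ->
  exists2 r, pcomp p q = Some r & pval r = (psrc q, parr q ++ parr p).
Proof.
move=> pq; rewrite /pcomp pq eqxx; case: insubP => [r _ valr|]; first by exists r.
by rewrite /= walk_cat (pvalP q) -/(ptgt q) pq (pvalP p).
Qed.

Definition pathalg : Type := freemod F qpath.
HB.instance Definition _ := GRing.Lmodule.on pathalg.

Definition pbasis (o : option qpath) : pathalg := if o is Some p then fbasis F p else 0.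

Definition pathalg_mul (f g : pathalg) : pathalg :=
  lext (fun p => lext (fun q => pbasis (pcomp p q)) g : pathalg) f.

Definition vpath (v : vertex Q) : qpath := @QPath (v, [::]) isT.

Definition pathalg_one : pathalg := \sum_(v : vertex Q) fbasis F (vpath v).

Lemma pathalg_mul_linl a f g h :
  pathalg_mul (a *: f + g) h = a *: pathalg_mul f h + pathalg_mul g h.
Proof. exact: linearP. Qed.

Lemma pathalg_mul0l f : pathalg_mul 0 f = 0.
Proof. exact: linear0. Qed.

Lemma pathalg_mul_basis p g :
  pathalg_mul (fbasis F p) g = lext (fun q => pbasis (pcomp p q)) g.
Proof. exact: lext_basis. Qed.

Lemma pathalg_mul_linr a f g h :
  pathalg_mul f (a *: g + h) = a *: pathalg_mul f g + pathalg_mul f h.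
Proof.
elim/freemod_ind: f => [|b p f IHf]; first by rewrite !pathalg_mul0l scaler0 addr0.
rewrite !pathalg_mul_linl IHf !pathalg_mul_basis linearP.
by rewrite !scalerDr !scalerA (mulrC a) addrACA.
Qed.

Lemma pathalg_mul0r f : pathalg_mul f 0 = 0.
Proof.
elim/freemod_ind: f => [|b p f IHf]; first exact: pathalg_mul0l.
by rewrite pathalg_mul_linl IHf pathalg_mul_basis linear0 scaler0 addr0.
Qed.

Lemma pathalg_mul_bb p q :
  pathalg_mul (fbasis F p) (fbasis F q) = pbasis (pcomp p q).
Proof. by rewrite pathalg_mul_basis lext_basis. Qed.

Lemma ptgt_pcomp p q r : pcomp p q = Some r -> psrc r = psrc q /\ ptgt r = ptgt p.
Proof.
rewrite /pcomp; case: eqP => // pq; case: insubP => //= r' _ valr [<-].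
by rewrite /ptgt /psrc /parr valr /= map_cat last_cat -/(psrc q) -/(parr q) -/(ptgt q) pq.
Qed.

Lemma pathalg_mulA_basis p q r :
  pathalg_mul (fbasis F p) (pathalg_mul (fbasis F q) (fbasis F r)) =
  pathalg_mul (pathalg_mul (fbasis F p) (fbasis F q)) (fbasis F r).
Proof.
rewrite !pathalg_mul_bb.
have [qp|qp] := eqVneq (ptgt q) (psrc p); have [rq|rq] := eqVneq (ptgt r) (psrc q).
- have [pq Epq vpq] := pcompP qp; have [qr Eqr vqr] := pcompP rq.
  rewrite Epq Eqr /= !pathalg_mul_bb.
  have [s Es vs] := @pcompP p qr (etrans (proj2 (ptgt_pcomp Eqr)) qp).
  have [s' Es' vs'] := @pcompP pq r (etrans rq (esym (proj1 (ptgt_pcomp Epq)))).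
  rewrite Es Es' /=; congr fbasis; apply: val_inj => /=.
  by rewrite vs vs' /psrc /parr vqr vpq /= catA.
- have [pq Epq vpq] := pcompP qp.
  rewrite Epq /= pathalg_mul_bb /pcomp (proj1 (ptgt_pcomp Epq)) (negPf rq) /=.
  by rewrite pathalg_mul0r.
- have [qr Eqr vqr] := pcompP rq.
  rewrite Eqr /= pathalg_mul_bb /pcomp (proj2 (ptgt_pcomp Eqr)) (negPf qp) /=.
  by rewrite pathalg_mul0l.
- by rewrite /pcomp (negPf qp) (negPf rq) /= pathalg_mul0r pathalg_mul0l.
Qed.

Lemma pathalg_mulA_bb p q h :
  pathalg_mul (fbasis F p) (pathalg_mul (fbasis F q) h) =
  pathalg_mul (pathalg_mul (fbasis F p) (fbasis F q)) h.
Proof.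
elim/freemod_ind: h => [|c r h IHh]; first by rewrite !pathalg_mul0r.
rewrite (pathalg_mul_linr c (fbasis F q) (fbasis F r) h) pathalg_mul_linr IHh.
by rewrite (pathalg_mul_linr c _ (fbasis F r) h) pathalg_mulA_basis.
Qed.

Lemma pathalg_mulA_b p g h :
  pathalg_mul (fbasis F p) (pathalg_mul g h) =
  pathalg_mul (pathalg_mul (fbasis F p) g) h.
Proof.
elim/freemod_ind: g => [|b q g IHg].
  by rewrite pathalg_mul0l pathalg_mul0r pathalg_mul0l.
rewrite (pathalg_mul_linl b (fbasis F q) g h) pathalg_mul_linr IHg pathalg_mulA_bb.
by rewrite (pathalg_mul_linr b (fbasis F p) (fbasis F q) g) pathalg_mul_linl.
Qed.

Lemma pathalg_mulA : associative pathalg_mul.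
Proof.
move=> f g h; elim/freemod_ind: f => [|a p f IHf]; first by rewrite !pathalg_mul0l.
rewrite (pathalg_mul_linl a (fbasis F p) f (pathalg_mul g h)) IHf pathalg_mulA_b.
by rewrite (pathalg_mul_linl a (fbasis F p) f g) pathalg_mul_linl.
Qed.

Lemma pathalg_mulDl : left_distributive pathalg_mul +%R.
Proof. by move=> f g h; rewrite /pathalg_mul linearD. Qed.

Lemma pathalg_mulDr : right_distributive pathalg_mul +%R.
Proof. by move=> f g h; rewrite -[g]scale1r pathalg_mul_linr !scale1r. Qed.

Lemma pathalg_mul1E f :
  pathalg_mul pathalg_one f = \sum_v pathalg_mul (fbasis F (vpath v)) f.
Proof.
by rewrite /pathalg_mul /pathalg_one linear_sum.
Qed.

Lemma pathalg_mul1 : left_id pathalg_one pathalg_mul.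
Proof.
move=> f; rewrite pathalg_mul1E.
elim/freemod_ind: f => [|a p f IHf].
  by rewrite big1 // => v _; rewrite pathalg_mul0r.
transitivity (a *: (\sum_v pathalg_mul (fbasis F (vpath v)) (fbasis F p) : pathalg) + f).
  rewrite scaler_sumr -[in RHS]IHf -big_split /=; apply: eq_bigr => v _.
  by rewrite (pathalg_mul_linr a _ (fbasis F p)).
congr (_ *: _ + _); rewrite (bigD1 (ptgt p)) //= big1 => [|v vp]; last first.
  by rewrite pathalg_mul_bb /pcomp eq_sym (negPf vp).
have [r Er vr] := @pcompP (vpath (ptgt p)) p erefl.
rewrite pathalg_mul_bb Er addr0 /=; congr fbasis; apply: val_inj; rewrite /= vr /= cats0.
by rewrite /psrc /parr /= -surjective_pairing.
Qed.

Lemma pathalg_mulr1 : right_id pathalg_one pathalg_mul.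
Proof.
move=> f; elim/freemod_ind: f => [|a p f IHf]; first by rewrite pathalg_mul0l.
rewrite (pathalg_mul_linl a (fbasis F p)) IHf; congr (_ *: _ + _).
rewrite pathalg_mul_basis /pathalg_one linear_sum (bigD1 (psrc p)) //= big1 => [|v vp].
  have [r Er vr] := @pcompP p (vpath (psrc p)) erefl.
  rewrite lext_basis Er addr0 /=; congr fbasis; apply: val_inj; rewrite /= vr /=.
  by rewrite /psrc /parr /= -surjective_pairing.
by rewrite lext_basis /pcomp (negPf vp).
Qed.

HB.instance Definition _ := GRing.Zmodule_isPzRing.Build pathalg
  pathalg_mulA pathalg_mul1 pathalg_mulr1 pathalg_mulDl pathalg_mulDr.

Lemma pathalg_scaleAl a (f g : pathalg) : (a *: f) * g = a *: (f * g).
Proof. by rewrite /GRing.mul /= /pathalg_mul linearZ. Qed.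

Lemma pathalg_scaleAr a (f g : pathalg) : f * (a *: g) = a *: (f * g).
Proof.
by rewrite -[a *: g]addr0 [LHS]pathalg_mul_linr pathalg_mul0r addr0.
Qed.

Definition apath (a : arrow Q) : qpath := @QPath (asrc a, [:: a]) (introT andP (conj (eqxx _) isT)).

Definition pidem (v : vertex Q) : pathalg := fbasis F (vpath v).
Definition parrow (a : arrow Q) : pathalg := fbasis F (apath a).

End PathAlgebra.

(** A representation of [Q] with the space [F[t]] at every vertex, on which the
    arrow [a] acts as multiplication by [wt a], as a module over the path algebra. *)
Definition wrep (F : fieldType) (Q : quiver) (wt : arrow Q -> {poly F}) : Type :=
  vertex Q -> {poly F}.

Section WeightedRepresentation.
Variables (F : fieldType) (Q : quiver) (wt : arrow Q -> {poly F}).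

Definition path_act (p : qpath Q) (g : vertex Q -> {poly F}) : vertex Q -> {poly F} :=
  fun v => if v == ptgt p then (\prod_(a <- parr p) wt a) * g (psrc p) else 0.

Definition rep_act (f : pathalg F Q) (g : vertex Q -> {poly F}) : vertex Q -> {poly F} :=
  lext (fun p => path_act p g) f.

HB.instance Definition _ := GRing.Zmodule.on (wrep wt).

Definition wrep_scale (f : pathalg F Q) (g : wrep wt) : wrep wt := rep_act f g.

Lemma rep_act_lin a f f' g : rep_act (a *: f + f') g = a *: rep_act f g + rep_act f' g.
Proof. exact: linearP. Qed.

Lemma rep_act0 g : rep_act 0 g = 0.
Proof. exact: linear0. Qed.

Lemma rep_actB f f' g : rep_act (f - f') g = rep_act f g - rep_act f' g.
Proof. exact: linearB. Qed.

Lemma rep_act_basis p g : rep_act (fbasis F p) g = path_act p g.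
Proof. exact: lext_basis. Qed.

Lemma rep_act_linr a f g g' : rep_act f (a *: g + g') = a *: rep_act f g + rep_act f g'.
Proof.
elim/freemod_ind: f => [|b p f IHf]; first by rewrite !rep_act0 scaler0 addr0.
rewrite !rep_act_lin IHf !rep_act_basis.
have -> : path_act p (a *: g + g') = a *: path_act p g + path_act p g'.
  apply/funext => v; rewrite /path_act !fctE; case: eqP => _.
    by rewrite mulrDr scalerAr.
  by rewrite scaler0 addr0.
by rewrite !scalerDr !scalerA (mulrC a) addrACA.
Qed.

Lemma rep_act0r f : rep_act f 0 = 0.
Proof.
have := rep_act_linr (-1) f 0 0.
by rewrite scaler0 addr0 scaleN1r addNr.
Qed.

Lemma path_act_comp p q g :
  path_act p (path_act q g) = rep_act (pbasis F (pcomp p q)) g.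
Proof.
apply/funext => v; rewrite {1}/path_act.
have [qp|qp] := eqVneq (ptgt q) (psrc p).
  have [r Er vr] := pcompP qp; have [rq rp] := ptgt_pcomp Er.
  rewrite Er rep_act_basis /path_act rq rp /parr vr big_cat /= qp eqxx.
  by case: eqP => // _; rewrite mulrCA mulrA.
rewrite /pcomp (negPf qp) rep_act0 /path_act (eq_sym (psrc p)) (negPf qp).
by case: eqP; rewrite ?mulr0.
Qed.

Lemma rep_actA_bb p q g :
  rep_act (fbasis F p) (rep_act (fbasis F q) g) = rep_act ((fbasis F p : pathalg F Q) * fbasis F q) g.
Proof. by rewrite !rep_act_basis path_act_comp -pathalg_mul_bb. Qed.

Lemma rep_actA_b p f g :
  rep_act (fbasis F p) (rep_act f g) = rep_act ((fbasis F p : pathalg F Q) * f) g.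
Proof.
elim/freemod_ind: f => [|a q f IHf]; first by rewrite mulr0 rep_act0 rep_act0r.
rewrite rep_act_lin rep_act_linr IHf rep_actA_bb -rep_act_lin.
by rewrite -[_ *: _ + _](pathalg_mul_linr a).
Qed.

Lemma rep_actA f f' g : rep_act f (rep_act f' g) = rep_act (f * f') g.
Proof.
elim/freemod_ind: f => [|a p f IHf]; first by rewrite mul0r !rep_act0.
rewrite rep_act_lin IHf rep_actA_b -rep_act_lin.
by rewrite -[_ *: _ + _](pathalg_mul_linl a).
Qed.

Lemma rep_act_idem v g : rep_act (pidem F v) g = fun w => if w == v then g v else 0.
Proof.
rewrite rep_act_basis; apply/funext => w; rewrite /path_act /=.
by case: eqP => // _; rewrite big_nil mul1r.
Qed.

Lemma rep_act_arrow a g :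
  rep_act (parrow F a) g = fun w => if w == atgt a then wt a * g (asrc a) else 0.
Proof.
rewrite rep_act_basis; apply/funext => w; rewrite /path_act /=.
by case: eqP => // _; rewrite big_seq1.
Qed.

Lemma rep_act1 g : rep_act 1 g = g.
Proof.
rewrite /rep_act /1 /= /pathalg_one linear_sum; apply/funext => w.
rewrite fct_sumE (bigD1 w) //= big1 => [|v vw].
  by rewrite -/(rep_act _ g) (rep_act_idem w) eqxx addr0.
by rewrite -/(rep_act _ g) (rep_act_idem v) eq_sym (negPf vw).
Qed.

Lemma wrep_scaleA f f' g : wrep_scale f (wrep_scale f' g) = wrep_scale (f * f') g.
Proof. exact: rep_actA. Qed.
Lemma wrep_scale1 : left_id 1 wrep_scale.
Proof. exact: rep_act1. Qed.
Lemma wrep_scaleDr : right_distributive wrep_scale +%R.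
Proof. by move=> f g h; have := rep_act_linr 1 f g h; rewrite !scale1r. Qed.
Lemma wrep_scaleDl g : {morph wrep_scale^~ g : f f' / f + f'}.
Proof. by move=> f f'; have := rep_act_lin 1 f f' g; rewrite !scale1r. Qed.

HB.instance Definition _ := GRing.Zmodule_isLmodule.Build (pathalg F Q) (wrep wt)
  wrep_scaleA wrep_scale1 wrep_scaleDr wrep_scaleDl.

End WeightedRepresentation.

Definition lmod_iso (R : pzRingType) (M N : lmodType R) : Prop :=
  exists f : {linear M -> N}, bijective f.

Definition ker_submodule (R : pzRingType) (M N : lmodType R) (f : {linear M -> N}) :
  submodule M.
Proof.
apply: (@Submodule R M (fun x => f x = 0)); first exact: linear0.
by move=> a u v fu fv; rewrite linearP fu fv scaler0 addr0.
Defined.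

(** [S / (S :&: T)] is [quotmod (relative S T)]. *)
Definition relative (R : pzRingType) (V : lmodType R) (S T : submodule V) :
  submodule (submod S).
Proof.
apply: (@Submodule R (submod S) (fun x => T (val x))); first exact: smem0.
by move=> a u v Tu Tv; exact: smemP.
Defined.

Definition restrict (R A : pzRingType) (phi : {rmorphism R -> A}) (N : lmodType A) : Type := N.

Section Restrict.
Variables (R A : pzRingType) (phi : {rmorphism R -> A}) (N : lmodType A).

HB.instance Definition _ := GRing.Zmodule.on (restrict phi N).

Definition restrict_scale (r : R) (x : restrict phi N) : restrict phi N := phi r *: (x : N).

Lemma restrict_scaleA r s x :
  restrict_scale r (restrict_scale s x) = restrict_scale (r * s) x.
Proof. by rewrite /restrict_scale rmorphM scalerA. Qed.
Lemma restrict_scale1 : left_id 1 restrict_scale.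
Proof. by move=> x; rewrite /restrict_scale rmorph1 scale1r. Qed.
Lemma restrict_scaleDr : right_distributive restrict_scale +%R.
Proof. by move=> r x y; rewrite /restrict_scale scalerDr. Qed.
Lemma restrict_scaleDl x : {morph restrict_scale^~ x : r s / r + s}.
Proof. by move=> r s; rewrite /restrict_scale rmorphD scalerDl. Qed.

HB.instance Definition _ := GRing.Zmodule_isLmodule.Build R (restrict phi N)
  restrict_scaleA restrict_scale1 restrict_scaleDr restrict_scaleDl.
End Restrict.

(** [Ext] over an algebra [A], with its action of a ring [R] mapped into the centre
    of [A]: the cohomology of [Hom_A(P, N)], where [P] is the standard free
    resolution of [M], obtained by covering each successive syzygy with the free
    module on its set of elements. *)
Section Ext.
Variables (R A : pzRingType) (phi : {rmorphism R -> A}).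
Hypothesis phi_central : forall r a, GRing.comm (phi r) a.
Variables (M N : lmodType A).

Definition free_cover (L : lmodType A) : {linear freemod A L -> L} := lext id.

Fixpoint syzygy (i : nat) : lmodType A :=
  if i is j.+1 then submod (ker_submodule (free_cover (syzygy j))) else M.

Definition res_proj (i : nat) : lmodType A := freemod A (syzygy i).

Definition res_diff (i : nat) (x : res_proj i.+1) : res_proj i :=
  val (free_cover (syzygy i.+1) x).

Definition is_linear (P : lmodType A) (f : P -> restrict phi N) : Prop :=
  linear (f : P -> N).

Lemma is_linear_comb (P : lmodType A) r (f g : P -> restrict phi N) :
  is_linear f -> is_linear g -> is_linear (r *: f + g).
Proof.
move=> fl gl a u v; rewrite addrfctE scalrfctE fl gl.
change (phi r *: (a *: (f u : N) + f v) + (a *: (g u : N) + g v) =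
        a *: (phi r *: (f u : N) + g u) + (phi r *: (f v : N) + g v)).
by rewrite !scalerDr !scalerA phi_central addrACA.
Qed.

Definition is_cocycle (i : nat) (f : res_proj i -> restrict phi N) : Prop :=
  is_linear f /\ forall x, f (res_diff x) = 0.

Definition is_coboundary (i : nat) : (res_proj i -> restrict phi N) -> Prop :=
  match i with
  | 0 => fun f => f = 0
  | j.+1 => fun f => exists2 g : res_proj j -> restrict phi N,
      is_linear g & f = fun x => g (res_diff x)
  end.

Definition cocycle (i : nat) : submodule (res_proj i -> restrict phi N).
Proof.
apply: (@Submodule R _ (@is_cocycle i)).
  by split=> // a u v; rewrite [RHS]addr0 scaler0.
move=> r f g [fl f0] [gl g0]; split; first exact: is_linear_comb.
by move=> x; rewrite addrfctE scalrfctE f0 g0 scaler0 addr0.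
Defined.

Definition coboundary (i : nat) : submodule (res_proj i -> restrict phi N).
Proof.
apply: (@Submodule R _ (@is_coboundary i)); case: i => [|i] //=.
- by exists 0 => // a u v; rewrite [RHS]addr0 scaler0.
- by move=> r f g -> ->; rewrite scaler0 addr0.
- move=> r _ _ [f fl ->] [g gl ->]; exists (r *: f + g) => //.
  exact: is_linear_comb.
Defined.

Definition Ext (i : nat) : lmodType R := quotmod (relative (cocycle i) (coboundary i)).

End Ext.

Section PolyMorphism.
Variables (F : fieldType) (A : pzRingType) (iota : {rmorphism F -> A}) (t : A).
Hypothesis iota_t : forall c, GRing.comm (iota c) t.

Definition poly_eval of (forall c, GRing.comm (iota c) t) := fun p : {poly F} =>
  \sum_(i < size p) iota p`_i * t ^+ i.

Local Notation ev := (poly_eval iota_t).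

Lemma poly_evalE n (p : {poly F}) : (size p <= n)%N ->
  ev p = \sum_(i < n) iota p`_i * t ^+ i.
Proof.
move=> pn; rewrite /poly_eval (big_ord_widen _ (fun i => iota p`_i * t ^+ i) pn).
rewrite big_mkcond; apply: eq_bigr => i _; case: ltnP => // pi.
by rewrite nth_default // rmorph0 mul0r.
Qed.

Lemma poly_eval_is_zmod_morphism : zmod_morphism ev.
Proof.
move=> p q; pose n := maxn (size p) (size q).
rewrite !(@poly_evalE n) ?leq_maxl ?leq_maxr //; last first.
  by rewrite (leq_trans (size_polyD _ _)) // size_polyN.
by rewrite -sumrB; apply: eq_bigr => i _; rewrite coefB rmorphB mulrBl.
Qed.

HB.instance Definition _ :=
  GRing.isZmodMorphism.Build {poly F} A ev poly_eval_is_zmod_morphism.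

Lemma poly_evalZ c p : ev (c *: p) = iota c * ev p.
Proof.
rewrite (@poly_evalE (size p)) ?size_scale_leq // mulr_sumr.
by apply: eq_bigr => i _; rewrite coefZ rmorphM mulrA.
Qed.

Lemma poly_evalMX p : ev (p * 'X) = ev p * t.
Proof.
rewrite (@poly_evalE (size p).+1); last first.
  by have [->|p0] := eqVneq p 0; rewrite ?mul0r ?size_poly0 // size_mulX.
rewrite big_ord_recl coefMX rmorph0 mul0r add0r mulr_suml.
by apply: eq_bigr => i _; rewrite coefMX /= -mulrA exprSr.
Qed.

Lemma poly_evalC c : ev c%:P = iota c.
Proof.
rewrite (@poly_evalE 1) ?size_polyC_leq1 // big_ord1 coefC /= mulr1.
by [].
Qed.

Lemma poly_eval_is_monoid_morphism : monoid_morphism ev.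
Proof.
split=> [|p q]; first by rewrite poly_evalC rmorph1.
elim/poly_ind: q p => [|q c IHq] p; first by rewrite mulr0 !raddf0 mulr0.
rewrite mulrDr !raddfD /= mulrDr mulrA !poly_evalMX IHq mulrA.
congr (_ + _); rewrite -[p * _]mulrC mul_polyC poly_evalZ poly_evalC.
rewrite /poly_eval mulr_suml mulr_sumr; apply: eq_bigr => i _.
rewrite -[in RHS]mulrA -(commrX i (iota_t c)).
by rewrite !mulrA -!rmorphM (mulrC c).
Qed.

HB.instance Definition _ :=
  GRing.isMonoidMorphism.Build {poly F} A ev poly_eval_is_monoid_morphism.

Lemma poly_eval_central a :
  (forall c, GRing.comm (iota c) a) -> GRing.comm t a -> forall p, GRing.comm (ev p) a.
Proof.
move=> ia ta p; apply/commr_sym; rewrite /poly_eval; apply: commr_sum => i _.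
by apply: commrM; [exact/commr_sym|apply: commrX; exact/commr_sym].
Qed.

End PolyMorphism.

(** [inl i] is the arrow [x_i : i - 1 -> i] and [inr i] is [y_i : i -> i - 1]. *)
Definition circle (n : nat) : quiver := @Quiver 'Z_n ('Z_n + 'Z_n)%type
  (fun a => match a with inl i => i - 1 | inr i => i end)
  (fun a => match a with inl i => i | inr i => i - 1 end).

Section AlgebraB.
Variables (F : fieldType) (n k : nat).

Local Notation FQ := (pathalg F (circle n)).

Definition xarr (i : 'Z_n) : FQ := parrow F (inl i : arrow (circle n)).
Definition yarr (i : 'Z_n) : FQ := parrow F (inr i : arrow (circle n)).
Definition idem (i : 'Z_n) : FQ := pidem F (i : vertex (circle n)).

(** The path of [a] arrows [x] (resp. [y]) starting at [i]. *)
Fixpoint xpath (i : 'Z_n) (a : nat) : FQ :=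
  if a is b.+1 then xarr (i + b.+1%:R) * xpath i b else idem i.

Fixpoint ypath (i : 'Z_n) (a : nat) : FQ :=
  if a is b.+1 then yarr (i - b%:R) * ypath i b else idem i.

Definition relB (r : FQ) : Prop := exists i : 'Z_n,
  r = xarr i * yarr i - yarr (i + 1) * xarr (i + 1) \/
  r = xpath i k - ypath i (n - k).

Definition algB : pzRingType := quotring relB.

Local Notation toB := (qpi relB).

Definition scalB (c : F) : algB := toB (c *: (1 : FQ)).

Lemma scalB_is_zmod_morphism : zmod_morphism scalB.
Proof. by move=> c d; rewrite /scalB scalerBl rmorphB. Qed.
HB.instance Definition _ :=
  GRing.isZmodMorphism.Build F algB scalB scalB_is_zmod_morphism.

Lemma scalB_is_monoid_morphism : monoid_morphism scalB.
Proof.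
split=> [|c d]; rewrite /scalB ?scale1r ?rmorph1 // -rmorphM.
by rewrite pathalg_scaleAl pathalg_scaleAr mulr1 scalerA.
Qed.
HB.instance Definition _ :=
  GRing.isMonoidMorphism.Build F algB scalB scalB_is_monoid_morphism.

Lemma scalB_central c (b : algB) : GRing.comm (scalB c) b.
Proof.
rewrite -[b]qpi_repr /GRing.comm /scalB -!rmorphM.
by rewrite pathalg_scaleAl pathalg_scaleAr mul1r mulr1.
Qed.

Definition tB : algB := toB (\sum_(i : 'Z_n) xarr i * yarr i).

Lemma parrow_pidem (Q : quiver) (a : arrow Q) v :
  parrow F a * pidem F v = if v == asrc a then parrow F a else 0.
Proof.
rewrite [LHS]pathalg_mul_bb; have [->|va] := eqVneq v (asrc a).
  have [r -> vr] := @pcompP Q (apath a) (vpath (asrc a)) erefl.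
  by congr fbasis; apply: val_inj.
by rewrite /pcomp (negPf va).
Qed.

Lemma pidem_parrow (Q : quiver) (a : arrow Q) v :
  pidem F v * parrow F a = if v == atgt a then parrow F a else 0.
Proof.
rewrite [LHS]pathalg_mul_bb; have [->|va] := eqVneq v (atgt a).
  have [r -> vr] := @pcompP Q (vpath (atgt a)) (apath a) erefl.
  by congr fbasis; apply: val_inj.
by rewrite /pcomp eq_sym (negPf va).
Qed.

Lemma pidem_pidem (Q : quiver) (v w : vertex Q) :
  pidem F v * pidem F w = if v == w then pidem F v else 0.
Proof.
rewrite [LHS]pathalg_mul_bb; have [->|vw] := eqVneq v w.
  have [r -> vr] := @pcompP Q (vpath w) (vpath w) erefl.
  by congr fbasis; apply: val_inj.
by rewrite /pcomp eq_sym (negPf vw).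
Qed.

Lemma path_cons (Q : quiver) (a : arrow Q) (w : seq (arrow Q))
    (H : walk (asrc a) (a :: w)) (H' : walk (atgt a) w) :
  fbasis F (@QPath Q (asrc a, a :: w) H) =
  (fbasis F (@QPath Q (atgt a, w) H') : pathalg F Q) * parrow F a.
Proof.
rewrite [RHS]pathalg_mul_bb.
have [r -> vr] := @pcompP Q (@QPath Q (atgt a, w) H') (apath a) erefl.
by congr fbasis; apply: val_inj.
Qed.

Lemma tB_idem (i : 'Z_n) : tB * toB (idem i) = toB (xarr i * yarr i).
Proof.
rewrite -rmorphM mulr_suml (bigD1 i) //= big1 => [|j ji].
  by rewrite addr0 -mulrA parrow_pidem eqxx.
by rewrite -mulrA parrow_pidem eq_sym (negPf ji) mulr0.
Qed.

Lemma idem_tB (i : 'Z_n) : toB (idem i) * tB = toB (xarr i * yarr i).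
Proof.
rewrite -rmorphM mulr_sumr (bigD1 i) //= big1 => [|j ji].
  by rewrite addr0 mulrA pidem_parrow eqxx.
by rewrite mulrA pidem_parrow eq_sym (negPf ji) mul0r.
Qed.

Lemma relB_comm (i : 'Z_n) : toB (xarr i * yarr i) = toB (yarr (i + 1) * xarr (i + 1)).
Proof.
apply/qpi_eq; set r := _ - _; rewrite -[r]mulr1 -[r]mul1r -[_ * _]addr0.
by apply: ideal_genD; [exists i; left|apply: ideal_gen0].
Qed.

Lemma idem_comm_tB (i : 'Z_n) : GRing.comm tB (toB (idem i)).
Proof. by rewrite /GRing.comm tB_idem idem_tB. Qed.

Lemma xarr_comm_tB (i : 'Z_n) : GRing.comm tB (toB (xarr i)).
Proof.
have xl : toB (xarr i) = toB (idem i) * toB (xarr i).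
  by rewrite -rmorphM pidem_parrow eqxx.
have xr : toB (xarr i) = toB (xarr i) * toB (idem (i - 1)).
  by rewrite -rmorphM parrow_pidem eqxx.
rewrite /GRing.comm {1}xl mulrA tB_idem xr -(mulrA (toB (xarr i))) idem_tB -xr.
by rewrite (relB_comm (i - 1)) subrK rmorphM rmorphM mulrA.
Qed.

Lemma yarr_comm_tB (i : 'Z_n) : GRing.comm tB (toB (yarr i)).
Proof.
have yl : toB (yarr i) = toB (idem (i - 1)) * toB (yarr i).
  by rewrite -rmorphM pidem_parrow eqxx.
have yr : toB (yarr i) = toB (yarr i) * toB (idem i).
  by rewrite -rmorphM parrow_pidem eqxx.
rewrite /GRing.comm {1}yl mulrA tB_idem yr -(mulrA (toB (yarr i))) idem_tB -yr.
by rewrite (relB_comm (i - 1)) subrK rmorphM rmorphM mulrA.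
Qed.

Lemma path_comm_tB w v (H : walk v w) :
  GRing.comm tB (toB (fbasis F (@QPath (circle n) (v, w) H))).
Proof.
elim: w v H => [|a w IHw] v H.
  by rewrite (_ : fbasis F _ = idem v); [exact: idem_comm_tB|congr fbasis; apply: val_inj].
have [/eqP va H'] := andP H; subst v.
rewrite (path_cons H H') rmorphM; apply: commrM; first exact: IHw.
by case: a {H H'} => i; [exact: xarr_comm_tB|exact: yarr_comm_tB].
Qed.

Lemma tB_central (b : algB) : GRing.comm tB b.
Proof.
rewrite -[b]qpi_repr; elim/freemod_ind: (repr b) => [|c [[v w] H] f IHf].
  by rewrite /GRing.comm rmorph0 mul0r mulr0.
rewrite rmorphD; apply: commrD => //.
pose e : FQ := fbasis F (@QPath (circle n) (v, w) H).
rewrite (_ : c *: _ = c *: (1 : FQ) * e); last by rewrite pathalg_scaleAl mul1r.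
rewrite rmorphM.
by apply: commrM; [exact/commr_sym/scalB_central|exact: path_comm_tB].
Qed.

(** [F[t] -> B], ['X |-> t]; [poly_eval] is used since [horner_morph] requires a
    non-trivial ring, and [B] is trivial for some values of [n] and [k]. *)
Definition polyB : {poly F} -> algB := poly_eval (scalB_central ^~ tB).
HB.instance Definition _ := GRing.RMorphism.on polyB.

Lemma polyB_central p b : GRing.comm (polyB p) b.
Proof.
apply: poly_eval_central; [move=> c; exact: scalB_central|exact: tB_central].
Qed.

End AlgebraB.

Section GenMap.
Variables (A : pzRingType) (T : finType) (W : submodule (T -> A^o)).
Variables (X : {set T}) (c : T -> T -> A^o).

Definition gen_map (g : submod W) : T -> A^o := \sum_(v in X) (subval g v : A) *: c v.

Lemma gen_map_is_linear : linear gen_map.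
Proof.
move=> a g h; rewrite /gen_map scaler_sumr -big_split /=; apply: eq_bigr => v _.
change ((a * (subval g v : A) + subval h v : A) *: c v =
  a *: ((subval g v : A) *: c v) + (subval h v : A) *: c v).
by rewrite scalerDl scalerA.
Qed.
HB.instance Definition _ :=
  GRing.isLinear.Build A (submod W) (T -> A^o) *:%R gen_map gen_map_is_linear.
End GenMap.

Section RankOne.
Variables (F : fieldType) (n k : nat).
Hypothesis hn : (1 < n)%N.

Definition rank1_wt (I : {set 'Z_n}) (a : arrow (circle n)) : {poly F} :=
  match a with
  | inl i => if i \in I then 1 else 'X
  | inr i => if i \in I then 'X else 1
  end.

Lemma rep_act_xpath I i a (g : 'Z_n -> {poly F}) :
  rep_act (rank1_wt I) (xpath F i a) g = fun w => if w == i + a%:R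
    then 'X^(\sum_(0 <= j < a) ((i + j.+1%:R)%R \notin I)) * g i else 0.
Proof.
elim: a => [|a IHa].
  by rewrite addr0 rep_act_idem; apply/funext => w; rewrite big_nil mul1r.
rewrite -rep_actA IHa rep_act_arrow; apply/funext => w /=.
rewrite -natr1 addrA addrK eqxx; case: eqP => // _.
rewrite big_nat_recr //= addnC exprD -addrA natr1 mulrA; congr (_ * _ * _).
by case: (_ \in I).
Qed.

Lemma rep_act_ypath I i a (g : 'Z_n -> {poly F}) :
  rep_act (rank1_wt I) (ypath F i a) g = fun w => if w == i - a%:R
    then 'X^(\sum_(0 <= j < a) ((i - j%:R)%R \in I)) * g i else 0.
Proof.
elim: a => [|a IHa].
  by rewrite subr0 rep_act_idem; apply/funext => w; rewrite big_nil mul1r.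
rewrite -rep_actA IHa rep_act_arrow; apply/funext => w /=.
rewrite eqxx -natr1 opprD addrA; case: eqP => // _.
rewrite big_nat_recr //= addnC exprD mulrA; congr (_ * _ * _).
by case: (_ \in I).
Qed.

Lemma natr_Zn0 : (n%:R : 'Z_n) = 0.
Proof. by case: n hn => [|[|m]] // _; rewrite pchar_Zp. Qed.

Lemma sum_Zn (I : {set 'Z_n}) (i : 'Z_n) : (\sum_(0 <= j < n) ((i + j.+1%:R)%R \in I))%N = #|I|.
Proof.
move: I i; case: n hn => [|[|m]] // _ I i.
rewrite big_mkord -sum1_card [RHS]big_mkcond /=.
rewrite [RHS](reindex_inj (addrI (i + 1))) /=; apply: eq_bigr => j _.
by rewrite -natr1 natr_Zp [(_ + 1)%R in LHS]addrC addrA; case: (_ \in I).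
Qed.

Lemma leq_cardZn (I : {set 'Z_n}) : (#|I| <= n)%N.
Proof.
by rewrite (leq_trans (max_card _)) // card_ord; case: n hn => [|[|m]].
Qed.

Lemma rim_count (I : {set 'Z_n}) (i : 'Z_n) : #|I| = k ->
  (\sum_(0 <= j < k) ((i + j.+1%:R)%R \notin I) = \sum_(0 <= j < n - k) ((i - j%:R)%R \in I))%N.
Proof.
move=> hI; have kn : (k <= n)%N.
  by rewrite -hI leq_cardZn.
have := sum_Zn I i; rewrite hI (@big_cat_nat _ _ _ k) //=.
have -> : (\sum_(k <= j < n) ((i + j.+1%:R)%R \in I) =
           \sum_(0 <= j < n - k) ((i - j%:R)%R \in I))%N.
  rewrite -{1}[k]add0n big_addn big_nat_rev /=; apply: eq_big_nat => j /andP[_ jn].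
  rewrite add0n; congr (nat_of_bool ((i + _)%R \in I)); apply/eqP; rewrite -addr_eq0 -natrD.
  rewrite (_ : (_ + _)%N = n) ?natr_Zn0 //.
  by lia.
have : (\sum_(0 <= j < k) ((i + j.+1%:R)%R \in I) + \sum_(0 <= j < k) ((i + j.+1%:R)%R \notin I) = k)%N.
  rewrite -big_split /= (eq_bigr (fun _ => 1%N)); last by move=> j _; case: (_ \in I).
  by rewrite sum_nat_const_nat subn0 muln1.
by move=> h1 h2; apply: (addnI (etrans h1 (esym h2))).
Qed.

Lemma rank1_killed (I : {set 'Z_n}) : #|I| = k -> killed (@relB F n k) (wrep (rank1_wt I)).
Proof.
move=> hI r g [i ri]; change (rep_act (rank1_wt I) r g = 0).
case: ri => ->; rewrite rep_actB; apply/eqP; rewrite subr_eq0; apply/eqP.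
  rewrite -!rep_actA !rep_act_arrow; apply/funext => w /=.
  rewrite addrK !eqxx; case: eqP => // _.
  by case: (i \in I); case: (i + 1 \in I); rewrite ?mul1r.
rewrite rep_act_xpath rep_act_ypath (rim_count i hI); apply/funext => w.
congr (if w == _ then _ else _); apply/eqP; rewrite eq_sym subr_eq -addrA -natrD.
by rewrite subnKC ?natr_Zn0 ?addr0 // -hI leq_cardZn.
Qed.

(** [L_I]. *)
Definition rank1 (I : {set 'Z_n}) (hI : #|I| = k) : lmodType (algB F n k) :=
  descent (rank1_killed hI).

Local Notation B := (algB F n k).
Local Notation toB := (qpi (@relB F n k)).

(** The sets [U] and [V] of the presentation of [L_I]. *)
Definition peaks (I : {set 'Z_n}) : {set 'Z_n} := [set u | (u \notin I) && (u + 1 \in I)].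
Definition valleys (I : {set 'Z_n}) : {set 'Z_n} := [set v | (v \in I) && (v + 1 \notin I)].

Definition projB (j : 'Z_n) : submodule B^o.
Proof.
apply: (@Submodule B B^o (fun b => exists c : B, b = c * toB (idem F j))).
  by exists 0; rewrite mul0r.
move=> a _ _ [c ->] [d ->]; exists (a * c + d).
by rewrite mulrDl -mulrA.
Defined.

(** The direct sum of the [P_j], [j \in X], inside the free module [B ^ 'Z_n]. *)
Definition proj_sum (X : {set 'Z_n}) : submodule ('Z_n -> B^o).
Proof.
apply: (@Submodule B _ (fun g : 'Z_n -> B^o =>
  forall j, if j \in X then projB j (g j) else g j = 0)).
  by move=> j; case: ifP => // _; exact: smem0.
move=> a g h Pg Ph j; have := Ph j; have := Pg j; rewrite addrfctE scalrfctE.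
case: ifP => _ gj hj; first exact: smemP.
by rewrite gj hj scaler0 addr0.
Defined.

(** [v - u_-] and [u_+ - v], for [v] not in [U]. *)
Definition dist_prev (U : {set 'Z_n}) (v : 'Z_n) : nat :=
  find (fun a => v - a%:R \in U) (iota 0 n).
Definition dist_next (U : {set 'Z_n}) (v : 'Z_n) : nat :=
  find (fun a => v + a%:R \in U) (iota 0 n).

(** [D e_v]; both terms may lie in the same summand. *)
Definition pres_gen (I : {set 'Z_n}) (v : 'Z_n) : 'Z_n -> B^o :=
  let a := dist_prev (peaks I) v in
  let b := dist_next (peaks I) v in
  fun u => (if u == v - a%:R then toB (xpath F u a) else 0)
         - (if u == v + b%:R then toB (ypath F u b) else 0).

(** [D] takes its values in [proj_sum (peaks I)]; for its kernel the ambient free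
    module may serve as codomain. *)
Definition pres_map (I : {set 'Z_n}) :
    {linear submod (proj_sum (valleys I)) -> ('Z_n -> B^o)} :=
  gen_map (W := proj_sum (valleys I)) (valleys I) (pres_gen I).

(** The rim of a module isomorphic to a [rank1], and [set0] for other modules. *)
Definition rim (M : lmodType B) : {set 'Z_n} :=
  odflt (finset.set0 : {set 'Z_n}) [pick I : {set 'Z_n} | `[< exists hI : #|I| = k, lmod_iso M (rank1 hI) >]].

(** The kernel of [D] in the presentation of the [rank1] isomorphic to [M]. *)
Definition Omega2 (M : lmodType B) : lmodType B :=
  submod (ker_submodule (pres_map (rim M))).

Definition Omega_even (M : lmodType B) (m : nat) : lmodType B := iter m Omega2 M.

End RankOne.

(** [true] stands for the letter L and [false] for R. *)
Definition LR_word (n : nat) (I J : {set 'Z_n}) : seq bool :=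
  [seq i \in J | i <- enum 'Z_n & (i \in I) != (i \in J)].

(** Keeps the first letter of each maximal cyclic run. A constant word is sent to the
    empty one; for sets of equal size only the empty word is constant. *)
Definition cyclic_collapse (w : seq bool) : seq bool :=
  [seq p.1 | p <- zip w (rotr 1 w) & p.1 != p.2].

Definition LR_boxes (n : nat) (I J : {set 'Z_n}) : nat :=
  (size (cyclic_collapse (LR_word I J)))./2.

Definition principal (R : pzRingType) (a : R) : submodule R^o.
Proof.
apply: (@Submodule R R^o (fun x => exists y : R, x = y * a)).
  by exists 0; rewrite mul0r.
by move=> r _ _ [y ->] [z ->]; exists (r * y + z); rewrite mulrDl -mulrA.
Defined.

Definition cyclic_mod (F : fieldType) (h : nat) : lmodType {poly F} :=
  quotmod (principal ('X^h : {poly F})).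

Fixpoint cyclic_prod (F : fieldType) (h : seq nat) : lmodType {poly F} :=
  if h is a :: h' then (cyclic_mod F a * cyclic_prod F h')%type else 'rV[{poly F}]_0.

(* Main.v *)
From HB Require Import structures.
Require Import Defs.
From mathcomp Require Import all_boot all_order all_fingroup all_algebra generic_quotient.
From mathcomp Require Import boolp functions.
From mathcomp Require Import zify ring.

Set Implicit Arguments.
Unset Strict Implicit.
Unset Printing Implicit Defensive.

Import GRing.Theory.
Local Open Scope ring_scope.
Local Open Scope quotient_scope.

(** Dimension shifting reduces the statement to [Ext^1]. Two modules are called stably
    equivalent ([stab]) when there are maps both ways whose composites are the identity
    up to maps through projectives. Comparing projective presentations shows that
    [Ext^1] can be computed from a presentation of any stably equivalent module
    ([Ext1_transport]), and that second syzygies of stably equivalent modules are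
    stably equivalent ([stab_ker]). Hence [Ext^(2m+1)(L_I, L_J)] is
    [Ext^1(L_R, L_J)], where [R] is the rim of the [2m]-th syzygy
    ([Omega_even_stab]).

    [Ext^1(L_I, L_J)] is computed from a presentation of [L_I] with one generator
    [e_i] at every vertex and, for every [i], one relator: [x_i e_(i-1) - e_i] if [i]
    lies in [I] and [e_(i-1) - y_i e_i] otherwise. To see that it is exact, note that
    [e_j B e_u] is free of rank 1 over [F[t]], generated by one of the two
    paths that use a single kind of arrow, so that [B e_u] embeds in [L_I], its image at
    the vertex [j] being [t^c F[t]] with [c = cost u j] ([projB_faithful],
    [projB_image]). In these coordinates the differential takes successive differences around the circle, and
    exactness holds at each vertex [j] because [cost _ j] rises monotonically from [j] to
    the antipodal point [j - k] along both arcs ([cyclic_primitive]). The kernel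
    consists of the constant families, and is [L_(I+k)] ([ker_pres_d]). The kernel of
    the presentation by peaks and valleys is identified with [L_(I+k)] in the same
    way ([ker_pres_map_iso]), which ties the syzygies to the rims in the statement.

    Applying [Hom(-, L_J)] gives the square matrix [cyc_mx] over [F[t]]: the entries
    between [i-1] and [i] are [1] and [-1], multiplied by [t] at a letter R or L
    respectively. [Ext^1] is the [t]-saturation of its image modulo its image, since
    a power of [t] factors through a projective as an endomorphism of [L_I]
    ([pres_split]). As [I] and [J] have equally many elements, the matrix is
    homogeneous for a grading of rows and columns, so all entries stay monomials during
    elimination, and pivoting on the smallest exponent diagonalises it with increasing
    exponents ([graded_smith]). The number of nonzero exponents is the rank of the
    matrix at [t = 1] minus its rank at [t = 0]. At [t = 1] the kernel is the line of
    constant vectors; at [t = 0] a kernel vector is constant between letters and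
    vanishes unless the stretch starts at an L and ends at an R, so the kernel has
    dimension [s] ([rank_cyc_mx0]). This gives [s - 1] factors; if there are no letters at all,
    the two matrices coincide and there are none. *)

(** * Linear maps, submodules and quotients *)

Section LinearMaps.
Variable A : pzRingType.
Implicit Types U V W : lmodType A.

Lemma subval_lin V (S : submodule V) (a : A) (u v : submod S) :
  subval (a *: u + v) = a *: subval u + subval v.
Proof. exact: erefl. Qed.

Lemma subval0 V (S : submodule V) : subval (0 : submod S) = 0.
Proof. exact: erefl. Qed.

Lemma single_linear V (T : choiceType) (t0 : T) :
  linear ((fun x t => if t == t0 then x else 0) : V -> (T -> V)).
Proof.
move=> a u v; apply/funext => t; rewrite addrfctE scalrfctE.
by case: eqP => // _; rewrite scaler0 addr0.
Qed.

Lemma bundle_linear U V (h : U -> V) : linear h -> exists g : {linear U -> V}, g =1 h.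
Proof.
move=> hl; pose m := GRing.isLinear.Build A U V *:%R h hl.
by pose g : {linear U -> V} := HB.pack_for {linear U -> V} h m; exists g.
Qed.

Lemma lift_mono U V W (i : {linear V -> W}) (g : {linear U -> W}) :
  injective i -> (forall x, exists y, i y = g x) ->
  exists h : {linear U -> V}, forall x, i (h x) = g x.
Proof.
move=> ii /choice[h hE]; have hl : linear h.
  by move=> a u v; apply: ii; rewrite linearP !hE linearP.
by have [h' h'E] := bundle_linear hl; exists h' => x; rewrite h'E.
Qed.

Lemma bij_lmod_iso U V (f : {linear U -> V}) :
  injective f -> (forall y, exists x, f x = y) -> lmod_iso U V.
Proof.
move=> fi /choice[g gE]; exists f; exists g => // x.
by apply: fi; rewrite gE.
Qed.

Lemma lmod_iso_inverse U V : lmod_iso U V ->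
  exists (f : {linear U -> V}) (g : {linear V -> U}), cancel f g /\ cancel g f.
Proof.
case=> f [g fK gK].
have gl : linear g by move=> a u v; apply: (can_inj fK); rewrite linearP !gK.
have [g' g'E] := bundle_linear gl.
by exists f, g'; split=> x; rewrite g'E ?fK ?gK.
Qed.

Lemma lmod_iso_sym U V : lmod_iso U V -> lmod_iso V U.
Proof. by move=> /lmod_iso_inverse[f [g [fK gK]]]; exists g; exists f. Qed.

Lemma lmod_iso_trans U V W : lmod_iso U V -> lmod_iso V W -> lmod_iso U W.
Proof.
case=> f fb [g gb]; exists (g \o f : {linear U -> W}).
exact: bij_comp gb fb.
Qed.

(** Both modules are isomorphic to the common image. *)
Lemma lmod_iso_same_image U V W (f : {linear U -> W}) (g : {linear V -> W}) :
  injective f -> injective g ->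
  (forall w, (exists u, f u = w) <-> (exists v, g v = w)) -> lmod_iso U V.
Proof.
move=> fi gi fg.
have [h hE] := lift_mono gi (fun x => (fg (f x)).1 (ex_intro _ x erefl)).
apply: (@bij_lmod_iso _ _ h) => [x y hxy|y]; first by apply: fi; rewrite -!hE hxy.
have [x xE] := (fg (g y)).2 (ex_intro _ y erefl).
by exists x; apply: gi; rewrite hE.
Qed.

Lemma quot_lmod_iso V W (S T : submodule V) (f : {linear submod S -> W}) :
  (forall x, f x = 0 <-> T (val x)) -> (forall y, exists x, f x = y) ->
  lmod_iso (quotmod (relative S T)) W.
Proof.
move=> f0 fs.
pose q (x : submod S) : quotmod (relative S T) := \pi_(quotmod (relative S T)) x.
have qD a u v : q (a *: u + v) = a *: q u + q v.
  by rewrite /q !piE.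
have q0 x y : q x = q y <-> f x = f y.
  split=> [/eqP|fxy]; last first.
    by apply/eqP; rewrite /q -Quotient.idealrBE; apply/asboolP/f0; rewrite linearB fxy subrr.
  rewrite /q -Quotient.idealrBE => /asboolP /f0 /eqP.
  by rewrite linearB subr_eq0 => /eqP.
pose g (x : quotmod (relative S T)) := f (repr x).
have gq x : g (q x) = f x by apply/q0; rewrite /q reprK.
have gl : linear g.
  move=> a u v; rewrite -[u]reprK -[v]reprK -/(q (repr u)) -/(q (repr v)) -qD !gq.
  by rewrite linearP.
have [h hE] := bundle_linear gl.
apply: (@bij_lmod_iso _ _ h) => [x y|y].
  by rewrite !hE -[x]reprK -[y]reprK -/(q (repr x)) -/(q (repr y)) !gq => /q0.
by have [x <-] := fs y; exists (q x); rewrite hE gq.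
Qed.

End LinearMaps.

(** * Presentations and stable equivalence *)

Section Stable.
Variable A : pzRingType.
Implicit Types M N P K : lmodType A.

(** Lifting along any [e] whose image contains that of [f] saves factoring [e] through
    its image each time the property is used. *)
Definition projective P := forall (Y Z : lmodType A) (e : {linear Y -> Z}) (f : {linear P -> Z}),
  (forall x, exists y, e y = f x) -> exists g : {linear P -> Y}, forall x, e (g x) = f x.

Lemma freemod_projective (S : choiceType) : projective (freemod A S).
Proof.
move=> Y Z e f ef; have [h hE] := choice (fun s => ef (fbasis A s)).
exists (lext h); elim/freemod_ind => [|a s g IHg]; first by rewrite !linear0.
rewrite (linearP (lext h)) !linearP IHg -hE; congr (_ *: e _ + _).
exact: lext_basis.
Qed.

Definition kernel_of (K P Q : lmodType A) (i : {linear K -> P}) (d : {linear P -> Q}) :=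
  injective i /\ forall x, d x = 0 <-> exists y, i y = x.

Lemma ker_submodule_kernel (P Q : lmodType A) (d : {linear P -> Q}) :
  exists i : {linear submod (ker_submodule d) -> P}, kernel_of i d.
Proof.
have [i iE] := @bundle_linear A (submod (ker_submodule d)) P
  (@subval _ _ _) (fun a u v => erefl).
exists i; split=> [x y|x]; first by rewrite !iE => /val_inj.
split=> [dx|[y <-]]; last by rewrite iE; have /asboolP := subvalP y.
by exists (Submod (introT (asboolP (ker_submodule d x)) dx)); rewrite iE.
Qed.

Definition presents (P1 P0 M : lmodType A) (d : {linear P1 -> P0}) (p : {linear P0 -> M}) :=
  [/\ projective P1, projective P0, forall x, exists y, p y = x
    & forall x, p x = 0 <-> exists y, d y = x].

Definition id_mod_proj M (e : M -> M) := exists (P : lmodType A) (a : {linear M -> P}) (b : {linear P -> M}),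
  projective P /\ forall x, e x = x + b (a x).

Definition stab M N := exists (f : {linear M -> N}) (g : {linear N -> M}),
  id_mod_proj (g \o f) /\ id_mod_proj (f \o g).

Lemma stab_refl M : stab M M.
Proof.
have idp : id_mod_proj (idfun \o idfun : M -> M).
  exists (freemod A M), \0%R, \0%R; split=> [|x]; first exact: freemod_projective.
  by rewrite /= addr0.
by exists idfun, idfun.
Qed.

Lemma stab_iso_trans M N N' : stab M N -> lmod_iso N N' -> stab M N'.
Proof.
move=> [f [g [gf [P [a [b [jP fgE]]]]]]] /lmod_iso_inverse[u [v [uK vK]]].
exists (u \o f), (g \o v); split.
  by case: gf => Q [a' [b' [jQ gfE]]]; exists Q, a', b'; split=> // x; rewrite /= uK; exact: gfE.
exists P, (a \o v), (u \o b); split=> // x /=.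
by have /= -> := fgE (v x); rewrite linearD vK.
Qed.

Section Chain.
Variables (P1 P0 M : lmodType A) (d : {linear P1 -> P0}) (p : {linear P0 -> M}).
Variables (P1' P0' M' : lmodType A) (d' : {linear P1' -> P0'}) (p' : {linear P0' -> M'}).
Hypotheses (pr : presents d p) (pr' : presents d' p').

Lemma presents_comp x : p (d x) = 0.
Proof. by case: pr => _ _ _ ex; apply/ex; exists x. Qed.

Lemma chain_lift (f : {linear M -> M'}) :
  exists (F0 : {linear P0 -> P0'}) (F1 : {linear P1 -> P1'}),
    (forall x, p' (F0 x) = f (p x)) /\ (forall x, d' (F1 x) = F0 (d x)).
Proof.
case: pr => j1 j0 _ _; case: pr' => _ _ sp' ex'.
have [F0 F0E] := j0 _ _ p' (f \o p : {linear P0 -> M'}) (fun x => sp' _).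
have [|F1 F1E] := j1 _ _ d' (F0 \o d : {linear P1 -> P0'}).
  by move=> x; apply/ex'; rewrite /= F0E /= presents_comp linear0.
by exists F0, F1.
Qed.

(** [e] is the identity plus a map [b a] through a projective; [b] lifts to [P0], and after
    subtracting that lift [E0] minus the identity maps to [ker p], hence lifts to [s]. *)
Lemma chain_homotopy (e : M -> M) (E0 : {linear P0 -> P0}) (E1 : {linear P1 -> P1}) :
  id_mod_proj e -> (forall x, p (E0 x) = e (p x)) -> (forall x, d (E1 x) = E0 (d x)) ->
  exists s : {linear P0 -> P1}, forall x, d (E1 x - x - s (d x)) = 0.
Proof.
move=> [P [a [b [jP eE]]]] pE dE; case: pr => j1 j0 sp ex.
have [b' b'E] := jP _ _ p b (fun x => sp _).
have [|s sE] := j0 _ _ d (E0 \- idfun \- (b' \o a \o p) : {linear P0 -> P0}).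
  by move=> x; apply/ex => /=; rewrite !linearB /= pE b'E eE addrAC addrK subrr.
exists s => x; rewrite !linearB /= sE /= dE presents_comp.
by rewrite (linear0 a) (linear0 b') subr0 subrr.
Qed.
End Chain.

(** The stable equivalence lifts to maps of presentations. By [chain_homotopy] their
    composites on [P1] differ from the identity by [s d], which vanishes on the kernel,
    and by a map [P1 -> ker d], whose restriction to [K] factors through [P1]. *)
Lemma stab_ker (P1 P0 M : lmodType A) (d : {linear P1 -> P0}) (p : {linear P0 -> M})
    (P1' P0' M' : lmodType A) (d' : {linear P1' -> P0'}) (p' : {linear P0' -> M'})
    (K K' : lmodType A) (i : {linear K -> P1}) (i' : {linear K' -> P1'}) :
  presents d p -> presents d' p' -> kernel_of i d -> kernel_of i' d' ->
  stab M M' -> stab K K'.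
Proof.
move=> pr pr' [ii ki] [ii' ki'] [f [g [gf fg]]].
have [F0 [F1 [pF dF]]] := chain_lift pr pr' f.
have [G0 [G1 [pG dG]]] := chain_lift pr' pr g.
have di x : d (i x) = 0 by apply/ki; exists x.
have di' x : d' (i' x) = 0 by apply/ki'; exists x.
have [|F FE] := @lift_mono _ _ _ _ i' (F1 \o i : {linear K -> P1'}) ii'.
  by move=> x; apply/ki'; rewrite /= dF di linear0.
have [|G GE] := @lift_mono _ _ _ _ i (G1 \o i' : {linear K' -> P1}) ii.
  by move=> x; apply/ki; rewrite /= dG di' linear0.
have [||s sE] := @chain_homotopy _ _ _ _ _ pr _ (G0 \o F0) (G1 \o F1) gf.
- by move=> x; rewrite /= pG pF.
- by move=> x; rewrite /= dG dF.
have [||s' sE'] := @chain_homotopy _ _ _ _ _ pr' _ (F0 \o G0) (F1 \o G1) fg.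
- by move=> x; rewrite /= pF pG.
- by move=> x; rewrite /= dF dG.
exists F, G; split.
  have [|b bE] := @lift_mono _ _ _ _ i ((G1 \o F1) \- idfun \- (s \o d) : {linear P1 -> P1}) ii.
    by move=> x; apply/ki/sE.
  exists P1, i, b; split=> [|x]; first by case: pr.
  apply: ii; rewrite /= GE /= FE /= linearD bE /= di (linear0 s) subr0.
  by rewrite addrC subrK.
have [|b bE] := @lift_mono _ _ _ _ i' ((F1 \o G1) \- idfun \- (s' \o d') : {linear P1' -> P1'}) ii'.
  by move=> x; apply/ki'/sE'.
exists P1', i', b; split=> [|x]; first by case: pr'.
apply: ii'; rewrite /= FE /= GE /= linearD bE /= di' (linear0 s') subr0.
by rewrite addrC subrK.
Qed.

End Stable.

(** * [Ext] from a presentation *)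

Section StandardResolution.
Variables (A : pzRingType) (M : lmodType A) (i : nat).

Lemma free_coverE (L : lmodType A) (x : L) : free_cover L (fbasis A x) = x.
Proof. exact: lext_basis. Qed.

Lemma res_presents : exists d : {linear res_proj M i.+1 -> res_proj M i},
  [/\ d =1 @res_diff A M i, presents d (free_cover (syzygy M i))
    & exists j : {linear syzygy M i.+2 -> res_proj M i.+1}, kernel_of j d].
Proof.
have dl : linear (@res_diff A M i).
  by move=> a u v; rewrite /res_diff linearP.
have [d dE] := bundle_linear dl; exists d; split=> //.
  split; try exact: freemod_projective.
    by move=> x; exists (fbasis A x); rewrite free_coverE.
  move=> x; split=> [cx|[y <-]]; last first.
    by rewrite dE /res_diff; have /asboolP := subvalP (free_cover (syzygy M i.+1) y).
  pose y : syzygy M i.+1 := Submod (introT (asboolP (ker_submodule (free_cover (syzygy M i)) x)) cx).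
  by exists (fbasis A y); rewrite dE /res_diff free_coverE.
have [j [jj kj]] := ker_submodule_kernel (free_cover (syzygy M i.+1)).
exists j; split=> // x; rewrite -kj dE /res_diff; split=> [e0|->] //.
by apply: val_inj; rewrite e0.
Qed.

End StandardResolution.

Section ExtOne.
Variables (R A : pzRingType) (phi : {rmorphism R -> A}).
Hypothesis phi_central : forall r a, GRing.comm (phi r) a.

Variables (M N : lmodType A) (i : nat).
Variables (P1 P0 M' : lmodType A) (d : {linear P1 -> P0}) (p : {linear P0 -> M'}).
Hypotheses (pr : presents d p) (st : stab (syzygy M i) M').

(** [T] is part of a comparison between the presentation and the standard resolution of
    [M] from degree [i] on, and pulling cocycles back along [T] is an isomorphism
    modulo coboundaries. A linear map on [P1] represents an extension when it kills
    [ker d], and a trivial one when it extends along [d]. *)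
Lemma Ext1_transport : exists T : {linear P1 -> res_proj M i.+1},
  [/\ forall f : res_proj M i.+1 -> Defs.restrict phi N, is_cocycle f ->
        forall x, d x = 0 -> f (T x) = 0,
      forall f : res_proj M i.+1 -> Defs.restrict phi N, is_cocycle f ->
        (is_coboundary f <-> exists g : {linear P0 -> N}, forall x, f (T x) = g (d x))
    & forall h : {linear P1 -> N}, (forall x, d x = 0 -> h x = 0) ->
        exists2 f : res_proj M i.+1 -> Defs.restrict phi N, is_cocycle f &
        exists g : {linear P0 -> N}, forall x, f (T x) = h x + g (d x)].
Proof.
have [d' [d'E pr' [j [jj kj]]]] := res_presents M i.
have [f [g [gf fg]]] := st.
have [F0 [F1 [pF dF]]] := chain_lift pr' pr f.
have [G0 [G1 [pG dG]]] := chain_lift pr pr' g.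
have [||s sE] := @chain_homotopy _ _ _ _ _ _ pr' _ (G0 \o F0) (G1 \o F1) gf.
- by move=> x; rewrite /= pG pF.
- by move=> x; rewrite /= dG dF.
have [||s' sE'] := @chain_homotopy _ _ _ _ _ _ pr _ (F0 \o G0) (F1 \o G1) fg.
- by move=> x; rewrite /= pF pG.
- by move=> x; rewrite /= dF dG.
have coc (h : res_proj M i.+1 -> Defs.restrict phi N) : is_cocycle h ->
    exists2 h' : {linear res_proj M i.+1 -> N}, h' =1 h & forall x, d' x = 0 -> h' x = 0.
  case=> hl h0; have [h' h'E] := bundle_linear hl; exists h' => // x; rewrite d'E.
  move=> dx; have {}dx : free_cover (syzygy M i.+1) x = 0 by apply: val_inj.
  pose y : syzygy M i.+2 :=
    Submod (introT (asboolP (ker_submodule (free_cover (syzygy M i.+1)) x)) dx).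
  by have := h0 (fbasis A y); rewrite /res_diff free_coverE h'E.
exists G1; split=> [h /coc[h' h'E h0] x dx|h ch|h h0].
- by rewrite -h'E; apply: h0; rewrite dG dx linear0.
- have [h' h'E h'0] := coc h ch; split.
    case=> u ul hu; have [u' u'E] := bundle_linear ul.
    exists (u' \o G0 : {linear P0 -> N}) => x /=.
    by rewrite hu -d'E dG u'E.
  case=> u uE; exists ((u \o F0) \- (h' \o s) : {linear _ -> N}).
    by move=> a x y; rewrite linearP.
  apply/funext => x /=; rewrite -d'E -dF -uE -!h'E.
  have /eqP := h'0 _ (sE x); rewrite !linearB /= subr_eq0 => /eqP <-.
  by rewrite opprB addrC subrK.
pose h1 : res_proj M i.+1 -> N := h \o F1.
exists h1.
  split=> [a x y|x]; first by rewrite /h1 linearP.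
  rewrite /h1 /=; apply: h0; rewrite dF.
  rewrite (_ : d' _ = 0) ?linear0 // d'E /res_diff.
  by have /asboolP /= -> := subvalP (free_cover (syzygy M i.+2) x).
exists (h \o s' : {linear P0 -> N}) => x /=.
have /eqP := h0 _ (sE' x); rewrite !linearB /= /h1 /= -addrA -opprD subr_eq0 => /eqP ->.
by [].
Qed.
End ExtOne.

(** * Walking around the circle *)

Section Circle.
Variable n : nat.
Hypothesis hn : (1 < n)%N.

Lemma ltn_Zn (i : 'Z_n) : (i < n)%N.
Proof. by move: i; case: n hn => [|[|m]] // _ i; exact: ltn_ord. Qed.

Lemma sum_circle (V : nmodType) (z : 'Z_n -> V) (i : 'Z_n) :
  \sum_(0 <= l < n) z (i + l.+1%:R) = \sum_j z j.
Proof.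
move: z i; case: n hn => [|[|m]] // _ z i.
rewrite big_mkord [RHS](reindex_inj (addrI (i + 1))) /=; apply: eq_bigr => l _.
by rewrite -addrA -{2}[l]natr_Zp -natr1 [1 + _]addrC.
Qed.

Lemma val_natZ a : (a < n)%N -> (a%:R : 'Z_n) = a :> nat.
Proof. by move=> an; rewrite val_Zp_nat // modn_small. Qed.

Lemma natr_subn a : (a <= n)%N -> ((n - a)%:R : 'Z_n) = - a%:R.
Proof. by move=> an; rewrite natrB // natr_Zn0 // sub0r. Qed.

(** For a quantity updated at the vertices [0, 1, ...] in turn and returning to its
    initial value, the value before the step [i] is the value after the step [i - 1],
    also when [i = 0]. *)
Lemma cyclic_pred (T : Type) (st : nat -> T) : st n = st 0%N ->
  forall i : 'Z_n, st (i - 1 : 'Z_n)%R.+1 = st i.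
Proof.
move=> stn i; have [->|i0] := eqVneq i 0.
  have -> : (0 - 1 : 'Z_n) = (n.-1)%:R.
    by apply/eqP; rewrite subr_eq natr1 prednK ?natr_Zn0 //; lia.
  by rewrite val_natZ ?prednK //; lia.
have i0' : (0 < i)%N by rewrite lt0n; apply: contra_neq i0 => i0; apply: val_inj.
have -> : i - 1 = i.-1%:R by apply/eqP; rewrite subr_eq natr1 prednK // natr_Zp.
by rewrite val_natZ prednK // ltnW // ltn_Zn.
Qed.

Lemma circle_ind (P : 'Z_n -> Prop) i0 :
  P i0 -> (forall i, P i -> P (i + 1)) -> forall i, P i.
Proof.
move=> P0 PS i; rewrite -[i](subrK i0) addrC -[i - i0]natr_Zp.
elim: (nat_of_ord _) => [|a IHa]; first by rewrite addr0.
by rewrite -natr1 addrA; apply: PS.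
Qed.

Lemma circle_ind_down (P : 'Z_n -> Prop) i0 :
  P i0 -> (forall i, P i -> P (i - 1)) -> forall i, P i.
Proof.
move=> P0 PS i; rewrite -[i]opprK; apply: (@circle_ind (fun j => P (- j)) (- i0)) => [|j].
  by rewrite opprK.
by rewrite opprD; apply: PS.
Qed.

Lemma stepS (i d : 'Z_n) a : i + d * a.+1%:R = i + d + d * a%:R.
Proof. by rewrite -natr1; ring. Qed.

Definition unit_step (d : 'Z_n) := d = 1 \/ d = -1.

Lemma step_reach d (i j : 'Z_n) : unit_step d -> exists2 a, (a < n)%N & j = i + d * a%:R.
Proof.
case=> ->; first by exists (j - i); rewrite ?ltn_Zn // mul1r natr_Zp addrC subrK.
by exists (i - j); rewrite ?ltn_Zn // mulN1r natr_Zp opprB addrC subrK.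
Qed.

Definition dist d (X : {set 'Z_n}) (i : 'Z_n) := find (fun a => i + d * a%:R \in X) (iota 0 n).

Definition reach d X i : 'Z_n := i + d * (dist d X i)%:R.

Variables (d : 'Z_n) (X : {set 'Z_n}) (x0 : 'Z_n).
Hypotheses (d1 : unit_step d) (Xx0 : x0 \in X).

Lemma dist_spec i : [/\ (dist d X i < n)%N, reach d X i \in X
  & forall a, (a < dist d X i)%N -> i + d * a%:R \notin X].
Proof.
have hs : has (fun a => i + d * a%:R \in X) (iota 0 n).
  have [a an x0E] := step_reach i x0 d1.
  by apply/hasP; exists a; rewrite ?mem_iota // -x0E.
have lt := hs; rewrite has_find size_iota -/(dist d X i) in lt.
split=> // [|a ad].
  by have := nth_find 0%N hs; rewrite nth_iota.
by rewrite -[a in a%:R]add0n -(nth_iota 0 0 (ltn_trans ad lt)) (before_find 0%N ad).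
Qed.

Lemma reach_mem i : reach d X i \in X.
Proof. by case: (dist_spec i). Qed.

(** Induction along the walk from [i] to the first point of [X]. *)
Lemma reach_ind (P : 'Z_n -> Prop) i :
  P i -> (forall j, P j -> j \notin X -> P (j + d)) -> P (reach d X i).
Proof.
move=> Pi PS; have [_ _ nX] := dist_spec i; rewrite /reach.
have : (dist d X i <= dist d X i)%N by [].
elim: {1 3}(dist d X i) => [|a IHa] ad; first by rewrite mulr0 addr0.
rewrite -natr1 mulrDr mulr1 addrA; apply: PS (nX _ ad).
exact/IHa/ltnW.
Qed.

Lemma reach_id i : i \in X -> reach d X i = i.
Proof.
move=> iX; have [_ _ nX] := dist_spec i; rewrite /reach.
case: (dist d X i) nX => [|a] nX; first by rewrite mulr0 addr0.
by have := nX 0%N isT; rewrite mulr0 addr0 iX.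
Qed.

Lemma reach_step i : i \notin X -> reach d X i = reach d X (i + d).
Proof.
move=> iX; have [lt rX nX] := dist_spec i; have [lt' rX' nX'] := dist_spec (i + d).
rewrite /reach; case E: (dist d X i) lt rX nX => [|a] lt rX nX.
  by move: rX; rewrite /reach E mulr0 addr0 (negPf iX).
move: rX; rewrite /reach E stepS => rX.
case: (ltngtP a (dist d X (i + d))) => [/nX'|lt''|-> //]; first by rewrite rX.
have := nX (dist d X (i + d)).+1; rewrite ltnS => /(_ lt'').
by rewrite stepS; move: rX'; rewrite /reach => ->.
Qed.

End Circle.

(** [X] and [Y] are the entrances to and the exits from [C] for the direction [d]. Walking
    from an entrance to the next exit one stays in [C], so no other entrance is met, and
    walking back leads to the starting point. *)
Lemma reach_back n (hn : (1 < n)%N) (d : 'Z_n) (C X Y : {set 'Z_n}) (x0 y0 : 'Z_n) :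
  unit_step d -> x0 \in X -> y0 \in Y ->
  (forall i, (i \in X) = (i \notin C) && (i + d \in C)) ->
  (forall i, (i \in Y) = (i \in C) && (i + d \notin C)) ->
  forall x, x \in X -> reach (- d) X (reach d Y x) = x.
Proof.
move=> d1 Xx0 Yy0 XE YE x xX.
have d1' : unit_step (- d) by case: d1 => ->; [right|left; rewrite opprK].
suff [] : reach (- d) X (reach d Y x) = x /\ (reach d Y x \in C \/ reach d Y x = x) by [].
apply: (@reach_ind _ hn d Y y0 d1 Yy0 (fun j => reach (- d) X j = x /\ (j \in C \/ j = x))).
  by rewrite (reach_id hn d1' Xx0 xX); auto.
move=> j [rj jC]; rewrite YE negb_and negbK => jY.
have jdC : j + d \in C.
  case: jC jY => [-> //|->]; case/orP=> //.
  by move: xX; rewrite XE => /andP[].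
split; last by left.
by rewrite (reach_step hn d1' Xx0) ?addrK // XE jdC.
Qed.

(** * Monomial matrices over [F[t]] *)

Section GradedSmith.
Variable F : fieldType.
Local Notation Z := {poly F}.

Definition t_saturation m n (A : 'M[Z]_(m, n)) (v : 'rV[Z]_n) :=
  exists N f, 'X^N *: v = f *m A.

(** The quotient of the [t]-saturation of the row space by the row space is the given
    product of cyclic modules. The isomorphism is given by a map defined on all row
    vectors, which makes it easy to transport. *)
Definition torsion_quotient m n (A : 'M[Z]_(m, n)) (h : seq nat) :=
  exists phi : {linear 'rV[Z]_n -> cyclic_prod F h},
    (forall y, exists2 v, t_saturation A v & phi v = y) /\
    (forall v, t_saturation A v -> (phi v = 0 <-> exists f, v = f *m A)).

Lemma t_saturation_equiv m n (L : 'M[Z]_m) (A : 'M[Z]_(m, n)) (R : 'M[Z]_n) v :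
  L \in unitmx -> R \in unitmx -> t_saturation A v <-> t_saturation (L *m A *m R) (v *m R).
Proof.
move=> uL uR; split=> -[N [f vE]]; exists N.
  by exists (f *m invmx L); rewrite -!mulmxA mulKmx // scalemxAl vE mulmxA.
exists (f *m L); apply: (can_inj (mulmxK uR)).
by rewrite -scalemxAl vE !mulmxA.
Qed.

Lemma torsion_quotient_equiv m n (L : 'M[Z]_m) (A : 'M[Z]_(m, n)) (R : 'M[Z]_n) h :
  L \in unitmx -> R \in unitmx -> torsion_quotient A h -> torsion_quotient (L *m A *m R) h.
Proof.
move=> uL uR [phi [phis phi0]]; exists (phi \o mulmxr (invmx R)); split=> [y|v sv].
  have [v sv <-] := phis y; exists (v *m R); first exact: (proj1 (t_saturation_equiv A v uL uR)).
  by rewrite /= mulmxK.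
have {}sv : t_saturation A (v *m invmx R) by apply/(t_saturation_equiv _ _ uL uR); rewrite mulmxKV.
rewrite /= (phi0 _ sv); split=> -[f fE].
  exists (f *m invmx L); rewrite !mulmxA mulmxKV // -fE mulmxKV //.
by exists (f *m L); rewrite fE !mulmxA mulmxK.
Qed.

Lemma torsion_quotient0 m n : torsion_quotient (0 : 'M[Z]_(m, n)) [::].
Proof.
exists \0%R; split=> [y|v [N [f]]].
  exists 0; first by exists 0%N, 0; rewrite scaler0 mulmx0.
  by rewrite /= [RHS](thinmx0 (y : 'rV_0)).
rewrite mulmx0 => /matrixP v0; have -> : v = 0.
  apply/matrixP => i j; have /eqP := v0 i j; rewrite !mxE mulf_eq0.
  by rewrite expf_eq0 polyX_eq0 andbF => /eqP.
by split=> // _; exists 0; rewrite mulmx0.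
Qed.

Lemma mul_row_diag_block m n (a : Z) (S : 'M[Z]_(m, n)) (f : 'rV[Z]_(1 + m)) :
  f *m block_mx a%:M 0 0 S = row_mx (a *: lsubmx f) (rsubmx f *m S).
Proof.
by rewrite -{1}[f]hsubmxK mul_row_block !mulmx0 addr0 add0r mul_mx_scalar.
Qed.

Lemma t_saturation_block m n (c : F) e (S : 'M[Z]_(m, n)) (v : 'rV[Z]_(1 + n)) : c != 0 ->
  t_saturation (block_mx (c *: 'X^e)%:M 0 0 S) v <-> t_saturation S (rsubmx v).
Proof.
move=> c0; split=> -[N [f]].
  rewrite mul_row_diag_block -{1}[v]hsubmxK scale_row_mx => /eq_row_mx[_ vE].
  by exists N, (rsubmx f).
move=> vE; exists (e + N)%N, (row_mx ((c^-1 *: 'X^N) *: lsubmx v) ('X^e *: f)).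
rewrite mul_row_diag_block row_mxKl row_mxKr -{1}[v]hsubmxK scale_row_mx scalerA.
rewrite -scalemxAl -vE scalerA exprD; congr (row_mx (_ *: _) _).
by rewrite -scalerAl -scalerAr scalerA divff // scale1r.
Qed.

Lemma torsion_quotient_block m n (c : F) e (S : 'M[Z]_(m, n)) h : c != 0 -> torsion_quotient S h ->
  torsion_quotient (block_mx (c *: 'X^e)%:M 0 0 S : 'M_(1 + m, 1 + n)) (if e == 0%N then h else e :: h).
Proof.
move=> c0 [phi [phis phi0]]; case: eqP => [-> | _].
  exists (phi \o @rsubmx _ 1 1 n); split=> [y|v /(t_saturation_block _ _ _ c0) sv].
    have [v sv <-] := phis y; exists (row_mx 0 v) => /=; last by rewrite row_mxKr.
    by apply/(t_saturation_block _ _ _ c0); rewrite row_mxKr.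
  rewrite /= (phi0 _ sv); split=> -[f fE].
    exists (row_mx (c^-1%:P *: lsubmx v) f).
    rewrite mul_row_diag_block row_mxKl row_mxKr -fE scalerA expr0 alg_polyC.
    by rewrite -polyCM divff // scale1r hsubmxK.
  by exists (rsubmx f); rewrite fE mul_row_diag_block row_mxKr.
pose q (x : Z) : cyclic_mod F e := \pi_(cyclic_mod F e) (x : Z^o).
pose psi (v : 'rV[Z]_(1 + n)) : cyclic_prod F (e :: h) := (q (lsubmx v 0 0), phi (rsubmx v)).
have psil : linear psi.
  move=> a u v; rewrite /psi !linearP !mxE; congr (_, _).
  by rewrite /q !piE.
have [psi' psiE] : exists g : {linear 'rV[Z]_(1 + n) -> cyclic_prod F (e :: h)}, g =1 psi.
  pose m' := GRing.isLinear.Build Z _ _ *:%R psi psil.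
  by pose g : {linear _ -> _} := HB.pack_for {linear 'rV[Z]_(1 + n) -> cyclic_prod F (e :: h)} psi m'; exists g.
exists psi'; split=> [[y1 y2]|v /(t_saturation_block _ _ _ c0) sv].
  have [v sv <-] := phis y2; exists (row_mx (repr y1)%:M v).
    by apply/(t_saturation_block _ _ _ c0); rewrite row_mxKr.
  by rewrite psiE /psi row_mxKl row_mxKr mxE eqxx mulr1n /q reprK.
have q0 x : q x = 0 <-> exists y, x = y * 'X^e.
  have -> : q x = 0 <-> q x = q 0 by rewrite /q !piE.
  split=> [/eqP|].
    by rewrite /q -Quotient.idealrBE subr0 => /asboolP.
  by move=> h0; apply/eqP; rewrite /q -Quotient.idealrBE subr0; apply/asboolP.
rewrite psiE; split=> [[/q0[y yE]] /(phi0 _ sv)[f fE]|[f fE]].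
  exists (row_mx (c^-1 *: y)%:M f); rewrite mul_row_diag_block row_mxKl row_mxKr -fE.
  rewrite -[LHS]hsubmxK; congr row_mx; apply/matrixP => i j; rewrite !ord1 yE [RHS]mxE [X in _ = _ * X]mxE eqxx mulr1n.
  by rewrite -scalerAl -scalerAr scalerA divff // scale1r mulrC.
have rE : phi (rsubmx v) = 0.
  by apply/(phi0 _ sv); exists (rsubmx f); rewrite fE mul_row_diag_block row_mxKr.
congr (_, _) => //; apply/q0; exists (c *: lsubmx f 0 0).
rewrite fE mul_row_diag_block row_mxKl mxE -!scalerAl; congr (_ *: _); exact: mulrC.
Qed.

(** [A] is homogeneous when row [i] has degree [P i] and column [j] has degree [Q j]; the
    equation is stable under the row and column operations of the elimination. *)
Definition graded m n (P : 'I_m -> nat) (Q : 'I_n -> nat) (A : 'M[Z]_(m, n)) :=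
  forall i j, exists c, A i j * 'X^(P i) = c *: 'X^(Q j).

Lemma graded_entry m n P Q (A : 'M[Z]_(m, n)) i j : graded P Q A -> A i j != 0 ->
  exists2 c, c != 0 & A i j = c *: 'X^((size (A i j)).-1).
Proof.
move=> gA a0; have [c cE] := gA i j.
have c0 : c != 0.
  by apply: contra_neq a0 => c0; apply/eqP; move/eqP: cE;
    rewrite c0 scale0r mulf_eq0 expf_eq0 polyX_eq0 andbF orbF.
have sE : (Q j = P i + (size (A i j)).-1)%N.
  have := congr1 (fun p : Z => size p) cE.
  rewrite size_mulXn // size_scale // size_polyXn -(prednK (n := size (A i j))) ?size_poly_gt0 //.
  by rewrite addnS => -[<-].
exists c => //; apply: (@mulIf _ 'X^(P i)); first by rewrite expf_eq0 polyX_eq0 andbF.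
by rewrite cE sE exprD -scalerAl mulrC.
Qed.

Lemma rank_map_equiv (K : fieldType) (f : {rmorphism Z -> K}) m n
    (L : 'M[Z]_m) (A : 'M[Z]_(m, n)) (R : 'M[Z]_n) : L \in unitmx -> R \in unitmx ->
  \rank (map_mx f (L *m A *m R)) = \rank (map_mx f A).
Proof.
have uf k (U : 'M[Z]_k) : U \in unitmx -> map_mx f U \in unitmx.
  by move=> uU; apply: (proj1 (mulmx1_unit (B := map_mx f (invmx U)) _)); rewrite -map_mxM mulmxV // map_mx1.
move=> uL uR; rewrite !map_mxM /= mxrankMfree ?row_free_unit ?uf //.
by rewrite eqmxMfull // row_full_unit uf.
Qed.

(** Gaussian elimination. The nonzero entries are monomials, so one of the smallest degree
    divides all the others and clears its row and column; the Schur complement is again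
    homogeneous and divisible by this pivot, which makes the exponents increase.
    Pivots of exponent 0 contribute to the rank at 0 and no factor, all pivots
    contribute to the rank at 1. *)
Lemma graded_smith m n P Q (A : 'M[Z]_(m, n)) e0 : graded P Q A ->
  (forall i j, 'X^e0 %| A i j) ->
  exists h, [/\ torsion_quotient A h, sorted leq h, all (leq e0) h, all (leq 1) h
    & (size h + \rank (map_mx (horner_eval 0) A) = \rank (map_mx (horner_eval 1) A))%N].
Proof.
elim: m n P Q A e0 => [|m IHm] n P Q A e0 gA dA.
  exists [::]; split=> //; first by rewrite [A]flatmx0; exact: torsion_quotient0.
  by rewrite add0n [A]flatmx0 !map_mx0 !mxrank0.
have [[i0 j0] /= nz|no] := pickP (fun ij : 'I_m.+1 * 'I_n => A ij.1 ij.2 != 0); last first.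
  have -> : A = 0 by apply/matrixP => i j; rewrite mxE; apply/eqP/negbFE/(no (i, j)).
  exists [::]; split=> //; first exact: torsion_quotient0.
  by rewrite add0n !map_mx0 !mxrank0.
pose nzp (ij : 'I_m.+1 * 'I_n) := A ij.1 ij.2 != 0.
have [[i1 j1] /= nz1 min1] := @arg_minnP _ (i0, j0) nzp (fun ij => size (A ij.1 ij.2)) nz.
case: n => [|n] in Q A gA dA i0 j0 nz nzp i1 j1 nz1 min1 *; first by case: j1 {nz1 min1}.
rewrite {}/nzp in nz1 min1.
have [c c0 aE] := graded_entry gA nz1.
set e := (size _).-1 in aE.
have dvde i j : 'X^e %| A i j.
  have [->|nzij] := eqVneq (A i j) 0; first exact: dvdp0.
  have [c' c'0 ->] := graded_entry gA nzij.
  rewrite dvdpZr // dvdp_exp2l // /e -!subn1 leq_sub2r //; exact: (min1 (i, j) nzij).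
have e0e : (e0 <= e)%N.
  have := dA i1 j1; rewrite aE dvdpZr // => /dvdp_leq.
  by rewrite !size_polyXn ltnS; apply; rewrite expf_eq0 polyX_eq0 andbF.
clearbody e.
(* The pivot is moved to the upper left corner. *)
pose s : {perm 'I_(1 + m)} := tperm i1 0; pose t : {perm 'I_(1 + n)} := tperm j1 0.
pose B : 'M[Z]_(1 + m, 1 + n) := row_perm s (col_perm t A).
have BE i j : B i j = A (s i) (t j) by rewrite !mxE.
have AB : A = perm_mx s^-1 *m B *m perm_mx t.
  by rewrite /B row_permE col_permE !mulmxA -perm_mxM -mulmxA -perm_mxM !mulVg !perm_mx1 mul1mx mulmx1.
clearbody B.
pose a := A i1 j1.
have B00 : B 0 0 = a by rewrite BE !tpermR.
pose G : 'M[Z]_(1 + m, 1 + n) := \matrix_(i, j) (B i j %/ a).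
have da i j : a %| B i j by rewrite /a aE dvdpZl // BE dvde.
have GE i j : B i j = a * G i j by rewrite [G i j]mxE mulrC divpK.
clearbody G.
(* The Schur complement of the pivot. *)
pose S := drsubmx B - a *: (dlsubmx G *m ursubmx G).
pose L : 'M[Z]_(1 + m) := block_mx 1%:M 0 (dlsubmx G) 1%:M.
pose R : 'M[Z]_(1 + n) := block_mx 1%:M (ursubmx G) 0 1%:M.
have B_LSR : B = L *m block_mx a%:M 0 0 S *m R.
  rewrite !mulmx_block !mulmx0 !mul0mx !mulmx1 !mul1mx !addr0 !add0r.
  rewrite mul_scalar_mx mul_mx_scalar -scalemxAl addrC subrK -[LHS]submxK.
  congr block_mx; apply/matrixP => i j.
  - by rewrite !ord1 [RHS]mxE eqxx mulr1n -B00 !mxE; congr (B _ _); apply: val_inj.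
  - by rewrite [RHS]mxE [LHS]mxE [LHS]mxE GE; rewrite [in RHS]mxE [in RHS]mxE.
  - by rewrite [RHS]mxE [LHS]mxE [LHS]mxE GE; rewrite [in RHS]mxE [in RHS]mxE.
have uL : L \in unitmx by rewrite unitmxE det_lblock !det1 mulr1 unitr1.
have uR : R \in unitmx by rewrite unitmxE det_ublock !det1 mulr1 unitr1.
have us (k : nat) (u : {perm 'I_k}) : (perm_mx u : 'M[Z]_k) \in unitmx by exact: unitmx_perm.
have a0 : a != 0 by [].
have polyXn_neq0 k : 'X^k != 0 :> Z by rewrite expf_eq0 polyX_eq0 andbF.
pose P' i := P (s (rshift 1 i)); pose Q' j := Q (t (rshift 1 j)).
have SE i j : S i j = B (rshift 1 i) (rshift 1 j) - a * G (rshift 1 i) 0 * G 0 (rshift 1 j).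
  rewrite !mxE big_ord1 !mxE -mulrA; congr (_ - _ * (G _ _ * G _ _)); exact: val_inj.
have gB i j : exists c', B i j * 'X^(P (s i)) = c'%:P * 'X^(Q (t j)).
  by have [c' c'E] := gA (s i) (t j); exists c'; rewrite BE mul_polyC.
have gS : graded (fun i => P (s (rshift 1 i))) (fun j => Q (t (rshift 1 j))) S.
  move=> i j; have [c1 c1E] := gB (rshift 1 i) 0; have [c2 c2E] := gB 0 (rshift 1 j).
  have [c3 c3E] := gB (rshift 1 i) (rshift 1 j); have [c4 c4E] := gB 0 0.
  have c40 : c4 != 0.
    apply: contra_neq a0 => c40; apply: (mulIf (polyXn_neq0 (P (s 0)))).
    by rewrite -B00 c4E c40 !mul0r.
  exists (c3 - c1 * c2 / c4); rewrite -mul_polyC.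
  have c4P : c4%:P != 0 by rewrite polyC_eq0.
  apply: (mulfI c4P); apply: (mulIf (polyXn_neq0 (Q (t 0)))).
  rewrite (mulrA _ _ 'X^(Q _)); have -> : c4%:P * (c3 - c1 * c2 / c4)%:P = c4%:P * c3%:P - c1%:P * c2%:P.
    by rewrite -!polyCM -polyCB mulrBr mulrCA divff // mulr1.
  move: c1E c2E c3E c4E; rewrite SE B00 [B _ 0]GE [B 0 _]GE.
  move: (G (rshift 1 i) 0) (G 0 (rshift 1 j)) (B _ _) => g g' b c1E c2E c3E c4E.
  transitivity ((a * 'X^(P (s 0))) * (b * 'X^(P (s (rshift 1 i))))
      - (a * g * 'X^(P (s (rshift 1 i)))) * (a * g' * 'X^(P (s 0)))).
    transitivity ((c4%:P * 'X^(Q (t 0))) * ((b - a * g * g') * 'X^(P (s (rshift 1 i))))).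
      by ring.
    by rewrite -c4E; ring.
  by rewrite c1E c2E c3E c4E; ring.
have dS i j : 'X^e %| S i j.
  by rewrite SE BE dvdp_sub ?dvde // -mulrA dvdp_mulr // -B00 BE dvde.
have [h [hq hs he h1 hr]] := IHm n _ _ S e gS dS.
have LSR : A = (perm_mx s^-1 *m L) *m block_mx a%:M 0 0 S *m (R *m perm_mx t).
  by rewrite {1}AB B_LSR !mulmxA.
exists (if e == 0%N then h else e :: h); split.
- rewrite LSR; apply: torsion_quotient_equiv; rewrite ?unitmx_mul ?uL ?uR ?us //.
  by rewrite /a aE; apply: torsion_quotient_block.
- by case: eqP => // _ /=; rewrite path_sortedE ?he //; exact: leq_trans.
- have he0 : all (leq e0) h by apply: sub_all he => x; apply: leq_trans.
  by case: eqP => //= _; rewrite e0e.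
- by case: eqP => //= /eqP; rewrite -lt0n => ->.
have rk x : \rank (map_mx (horner_eval x) A) =
    ((c * x ^+ e != 0)%R + \rank (map_mx (horner_eval x) S))%N.
  rewrite LSR rank_map_equiv ?unitmx_mul ?uL ?uR ?us // (@map_block_mx _ _ _ 1 m 1 n) !map_mx0.
  rewrite (@rank_diag_block_mx _ 1 1 m n) map_scalar_mx /= /horner_eval {1}/a aE hornerZ hornerXn.
  by rewrite rank_rV -scalemx1 scaler_eq0 (negPf (matrix_nonzero1 F 0)) orbF.
rewrite !rk expr1n mulr1 c0 -hr expr0n mulf_eq0 (negPf c0) /=.
case: eqP => _ /=; first by rewrite oner_eq0 addnCA.
by rewrite eqxx.
Qed.
End GradedSmith.

(** * The matrix of the presentation and the number of LR boxes *)

Section CycMx.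
Variables (n : nat) (I J : {set 'Z_n}).
Local Notation n' := (Zp_trunc n).+2.

(** [i] in [I :\: J] is a letter R and [i] in [J :\: I] a letter L. *)
Definition cyc_mx (R : comPzRingType) (x : R) : 'M[R]_n' :=
  \matrix_(l, i) ((l == i - 1 :> 'Z_n)%:R * x ^+ (i \in I :\: J) - (l == i)%:R * x ^+ (i \in J :\: I)).

Lemma mul_cyc_mx (R : comPzRingType) (x : R) (f : 'rV[R]_n') (i : 'Z_n) :
  (f *m cyc_mx x) 0 i = x ^+ (i \in I :\: J) * f 0 (i - 1) - x ^+ (i \in J :\: I) * f 0 i.
Proof.
rewrite mxE (eq_bigr (fun l => f 0 l * ((l == i - 1)%:R * x ^+ (i \in I :\: J))
    - f 0 l * ((l == i)%:R * x ^+ (i \in J :\: I)))) => [|l _]; last by rewrite mxE mulrBr.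
rewrite sumrB; congr (_ - _).
  rewrite (bigD1 (i - 1)) //= eqxx mul1r mulrC big1 ?addr0 // => l /negPf->.
  by rewrite mul0r mulr0.
by rewrite (bigD1 i) //= eqxx mul1r mulrC big1 ?addr0 // => l /negPf->; rewrite mul0r mulr0.
Qed.

Lemma map_cyc_mx (R S : comPzRingType) (f : {rmorphism R -> S}) x :
  map_mx f (cyc_mx x) = cyc_mx (f x).
Proof.
by apply/matrixP => l i; rewrite !mxE rmorphB !rmorphM !rmorphXn !rmorph_nat.
Qed.

Definition letter (i : 'Z_n) := (i \in I) != (i \in J).

(** Meant for the function [state] with [state i] true when the last letter at or before
    [i] is L: these are the letters R preceded by an L. *)
Definition LR_ends (state : 'Z_n -> bool) : {set 'Z_n} :=
  [set i | [&& letter i, i \notin J & state (i - 1)]].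

Variable F : fieldType.
Hypothesis hn : (1 < n)%N.

Lemma rank_cyc_mx1 : \rank (cyc_mx (1 : F)) = n'.-1.
Proof.
have rk : \rank (kermx (cyc_mx (1 : F))) = 1%N.
  have c1 : (const_mx 1 : 'rV[F]_n') != 0.
    by apply/eqP => /rowP/(_ 0); rewrite !mxE => /eqP; rewrite oner_eq0.
  transitivity (\rank (const_mx 1 : 'rV[F]_n')); last by rewrite rank_rV c1.
    apply/eqP; rewrite eqn_leq !mxrankS //.
      by apply/sub_kermxP/rowP => i; rewrite mul_cyc_mx !mxE !expr1n !mul1r subrr.
    apply/row_subP => j; set v := row _ _.
    have /rowP v0 : v *m cyc_mx 1 = 0 by apply/sub_kermxP; exact: row_sub.
    clearbody v; apply/sub_rVP; exists (v 0 0); apply/rowP => i; rewrite !mxE mulr1.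
    apply: (@circle_ind n (fun i : 'Z_n => v 0 i = v 0 0) 0) => // {}i vi.
    have /eqP := v0 (i + 1); rewrite mul_cyc_mx mxE !expr1n !mul1r addrK subr_eq0 => /eqP <-.
    exact: vi.
by have := mxrank_ker (cyc_mx (1 : F)); rewrite rk; have := rank_leq_row (cyc_mx (1:F)); lia.
Qed.

(** Vectors of the kernel are constant between consecutive letters; they vanish after an R
    and before an L. So the stretches between an L and an R that follows it give a
    basis, made of the rows of [B]; they are indexed by their right ends. *)
Lemma rank_cyc_mx0 (state : 'Z_n -> bool) (i0 : 'Z_n) : letter i0 ->
  (forall i, state i = if letter i then i \in J else state (i - 1)) ->
  (\rank (cyc_mx (0 : F)) + #|LR_ends state| = n')%N.
Proof.
move=> li0 stE; set T := LR_ends state; set A := cyc_mx 0.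
pose LS : {set 'Z_n} := [set i | letter i].
have LSi0 : i0 \in LS by rewrite inE.
have up : unit_step (1 : 'Z_n) by left.
(* [nxt i] is the first letter strictly after [i]. *)
pose nxt i : 'Z_n := reach 1 LS (i + 1).
have nxtE i : nxt (i - 1) = if letter i then i else nxt i.
  rewrite /nxt subrK; case: ifP => li; first by rewrite (reach_id hn up LSi0) ?inE.
  by rewrite (reach_step hn up LSi0) ?inE ?li.
have letter_nxt i : letter (nxt i) by have := reach_mem hn up LSi0 (i + 1); rewrite inE.
have down (P : 'Z_n -> Prop) : (forall i, letter i -> P (i - 1)) ->
    (forall i, ~~ letter i -> P i -> P (i - 1)) -> forall i, P i.
  move=> Pl Pn; apply: (@circle_ind_down n _ (i0 - 1)) => [|i Pi]; first exact: Pl.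
  by have [/Pl|/Pn] := boolP (letter i); last apply.
have state_nxt i : state (nxt i - 1) = state i.
  apply: (down (fun i => state (nxt i - 1) = state i)) => {}i li; rewrite nxtE ?li // (negPf li) => ->.
  by rewrite stE (negPf li).
have kerP (v : 'rV[F]_n') : v *m A = 0 <-> (forall i : 'Z_n,
    if letter i then (if i \in J then v 0 (i - 1) = 0 else v 0 i = 0) else v 0 (i - 1) = v 0 i).
  split=> [/rowP v0 i|v0].
    have := v0 i; rewrite mul_cyc_mx mxE /letter !inE.
    case: (i \in I); case: (i \in J) => /=; rewrite !(expr0, expr1, mul1r, mul0r, subr0, sub0r).
    - by move/eqP; rewrite subr_eq0 => /eqP.
    - by move/eqP; rewrite oppr_eq0 => /eqP.
    - by [].
    - by move/eqP; rewrite subr_eq0 => /eqP.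
  apply/rowP => i; have := v0 i; rewrite mul_cyc_mx mxE /letter !inE.
  case: (i \in I); case: (i \in J) => /= ->;
    by rewrite !(expr0, expr1, mul1r, mul0r, subr0, sub0r, subrr, oppr0).
pose B : 'M[F]_(#|T|, n') := \matrix_(t, m) (nxt m == enum_val t)%:R.
have rB : \rank B = #|T|.
  apply/eqP/row_freeP; exists (\matrix_(m, t) (m == enum_val t - 1 :> 'Z_n)%:R).
  apply/matrixP => t t'; rewrite !mxE (bigD1 (enum_val t' - 1)) //= big1 => [|m mt].
    have := enum_valP t'; rewrite inE => /and3P[lt' _ _].
    by rewrite !mxE eqxx mulr1 addr0 nxtE lt' (inj_eq enum_val_inj) eq_sym.
  by rewrite !mxE (negPf mt) mulr0.
have kB : (kermx A :=: B)%MS.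
  apply/eqmxP/andP; split.
    apply/row_subP => j; set v := row _ _.
    have /kerP vE : v *m A = 0 by apply/sub_kermxP; exact: row_sub.
    clearbody v; have v_nxt i : v 0 (nxt i - 1) = v 0 i.
      apply: (down (fun i => v 0 (nxt i - 1) = v 0 i)) => {}i li; rewrite nxtE ?li // (negPf li) => ->.
      by have := vE i; rewrite (negPf li).
    have v_state i : ~~ state i -> v 0 i = 0.
      apply: (@circle_ind n (fun i => ~~ state i -> v 0 i = 0) i0) i => [|i vi].
        by rewrite stE li0 => iJ; have := vE i0; rewrite li0 (negPf iJ).
      rewrite stE addrK; have := vE (i + 1); rewrite addrK; case: ifP => // _.
        by case: ifP.
      by move=> <-.
    suff -> : v = (\row_t v 0 (enum_val t - 1)) *m B by exact: submxMl.
    apply/rowP => m; rewrite mxE.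
    have [mT|mT] := boolP (nxt m \in T).
      rewrite (bigD1 (enum_rank_in mT (nxt m))) //= big1 => [|t tm].
        by rewrite !mxE enum_rankK_in // eqxx mulr1 addr0 v_nxt.
      rewrite !mxE; case: eqP => [mE|]; last by rewrite mulr0.
      by case/eqP: tm; apply: enum_val_inj; rewrite enum_rankK_in // -mE.
    rewrite big1 => [|t _]; last first.
      rewrite !mxE; case: eqP => [mE|]; last by rewrite mulr0.
      by have := enum_valP t; rewrite -mE (negPf mT).
    rewrite -v_nxt; move: mT; rewrite inE letter_nxt /= negb_and negbK.
    case/orP => [mJ|/v_state //]; have := vE (nxt m); by rewrite letter_nxt mJ.
  apply/row_subP => t; apply/sub_kermxP/kerP => i; rewrite !mxE.
  have := enum_valP t; rewrite inE => /and3P[lt tJ tst].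
  rewrite nxtE; case: (boolP (letter i)) => // li.
  case: ifP => iJ; first by case: eqP => // iE; move: tJ; rewrite -iE iJ.
  by case: eqP => // iE; move: tst; rewrite -iE state_nxt stE li iJ.
have := mxrank_ker A; rewrite kB rB => ->.
by rewrite subnKC // rank_leq_row.
Qed.

(** [true] is the letter L, and [x] the letter before [w]. *)
Fixpoint LR_changes (x : bool) (w : seq bool) : nat :=
  if w is a :: w' then ((x && ~~ a) + LR_changes a w')%N else 0%N.

Lemma LR_changes_rcons x w a :
  LR_changes x (rcons w a) = (LR_changes x w + (last x w && ~~ a))%N.
Proof. by elim: w x => [|b w IHw] x /=; rewrite ?addn0 // IHw addnA. Qed.

(** The changes from L to R and from R to L alternate, so their numbers differ by the
    difference of the end letters. *)
Lemma size_changes (x : bool) (w : seq bool) :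
  (size [seq p.1 | p <- zip w (belast x w) & p.1 != p.2] + x =
   (LR_changes x w).*2 + last x w)%N.
Proof.
elim: w x => [|a w IHw] x //=; have := IHw a.
by case: a; case: x => /=; lia.
Qed.

(** Read from its last letter on, a cyclic word has as many changes of either kind. *)
Lemma size_cyclic_collapse (w : seq bool) :
  (size (cyclic_collapse w))./2 = LR_changes (last true w) w.
Proof.
case/lastP: w => [|w a] //; rewrite /cyclic_collapse last_rcons.
rewrite (_ : rotr 1 _ = belast a (rcons w a)); last by rewrite rotr1_rcons belast_rcons.
have := size_changes a (rcons w a); rewrite last_rcons => /addIn ->.
by rewrite doubleK.
Qed.

Lemma LR_boxesE : exists state : 'Z_n -> bool,
  (forall i, state i = if letter i then i \in J else state (i - 1)) /\
  LR_boxes I J = #|LR_ends state|.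
Proof.
pose word m := [seq i \in J | i <- take m (enum 'Z_n) & letter i].
pose x0 := last true (LR_word I J).
pose st m := last x0 (word m).
have en : size (enum 'Z_n) = n' by rewrite size_enum_ord.
have wordn : word n' = LR_word I J by rewrite /word take_oversize ?en.
have stn : st n' = st 0%N.
  by rewrite /st wordn /word take0 /= /x0; case: (LR_word I J).
have wordS (i : 'Z_n) : word i.+1 = if letter i then rcons (word i) (i \in J) else word i.
  rewrite /word (take_nth i) ?en // nth_ord_enum filter_rcons.
  by case: ifP => // _; rewrite map_rcons.
have stP (i : 'Z_n) : st (i - 1 : 'Z_n)%R.+1 = st i by apply: (cyclic_pred hn); rewrite -[in LHS](Zp_cast hn).
exists (fun i => st i.+1); split=> [i|].
  by rewrite stP /st wordS; case: ifP => // _; rewrite last_rcons.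
rewrite /LR_boxes size_cyclic_collapse -/x0 -wordn -sum1_card.
(* [inZp j] is the vertex [j]; [g] counts an LR change when its R is read. *)
pose g j := [&& letter (inZp j), inZp j \notin J & st j].
have cE m : (m <= n')%N -> LR_changes x0 (word m) = (\sum_(0 <= j < m) g j)%N.
  elim: m => [|m IHm] mn; first by rewrite /word take0 big_nil.
  rewrite big_nat_recr //= -(IHm (ltnW mn)).
  have -> : m = Ordinal mn :> nat by [].
  rewrite wordS /g valZpK; case: ifP => _; last by rewrite addn0.
  rewrite LR_changes_rcons -/(st _); congr (_ + _)%N.
  by rewrite [RHS]/= andbC.
rewrite cE // big_mkord [RHS]big_mkcond; apply: eq_bigr => i _.
by rewrite inE stP /g valZpK; case: ifP.
Qed.

End CycMx.

Section Grading.
Variables (n k : nat).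
Hypothesis hn : (1 < n)%N.
Variables (I J : {set 'Z_n}) (hI : #|I| = k) (hJ : #|J| = k).

Lemma sum_vertices (X : {set 'Z_n}) : (\sum_(0 <= l < n) (l%:R \in X))%N = #|X|.
Proof.
rewrite -(sum_Zn hn X (-1)); apply: eq_bigr => l _.
by rewrite -natr1 addrCA addNr addr0.
Qed.

(** [H] counts the letters R minus the letters L read so far, offset by [n] to stay
    nonnegative; it closes up around the circle because [I] and [J] have the same size. *)
Lemma height_exists : exists H : 'Z_n -> nat, forall i,
  ((i \in J :\: I) + H i = (i \in I :\: J) + H (i - 1)%R)%N.
Proof.
pose S (X : {set 'Z_n}) m := (\sum_(0 <= l < m) (l%:R \in X))%N.
have SS X m : S X m.+1 = (S X m + (m%:R \in X))%N by rewrite /S big_nat_recr.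
have Sn X m : (S X m <= m)%N.
  by elim: m => [|m IHm]; [rewrite /S big_geq|rewrite SS -[m.+1]addn1 leq_add ?leq_b1].
have SIJ : S (I :\: J) n = S (J :\: I) n.
  rewrite /S !sum_vertices; have := cardsID J I; have := cardsID I J.
  by rewrite setIC hI hJ; lia.
pose G m := (n + S (I :\: J) m - S (J :\: I) m)%N.
have G0 : G 0%N = n by rewrite /G /S !big_geq // addn0 subn0.
have Gn : G n = n by rewrite /G SIJ addnK.
exists (fun i => G i.+1) => i.
rewrite (cyclic_pred hn (st := G)) ?Gn ?G0 //.
rewrite /G !SS natr_Zp; have := Sn (J :\: I) i; have := ltn_Zn hn i.
rewrite !inE; case: (i \in I); case: (i \in J) => /=; lia.
Qed.

Variable F : fieldType.

(** The height of the vertex [i] serves as the degree of row [i]; the height equation says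
    that both entries of a column give it the same degree. *)
Lemma graded_cyc_mx : exists P Q, graded P Q (cyc_mx I J ('X : {poly F})).
Proof.
have [H HP] := height_exists.
exists H, (fun i => ((i \in J :\: I) + H i)%N) => l i.
exists ((l == i - 1 :> 'Z_n)%:R - (l == i)%:R); rewrite mxE mulrBl scalerBl -!mulrA.
congr (_ - _).
  case: eqP => [->|_]; last by rewrite mul0r scale0r.
  by rewrite mul1r scale1r -exprD HP.
case: eqP => [->|_]; last by rewrite mul0r scale0r.
by rewrite mul1r scale1r -exprD.
Qed.

Lemma torsion_quotient_cyc_mx : exists h : seq nat,
  [/\ torsion_quotient (cyc_mx I J ('X : {poly F})) h, sorted leq h, all (leq 1) h
    & size h = (LR_boxes I J - 1)%N].
Proof.
have [P [Q gA]] := graded_cyc_mx.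
have [|h [hq hs _ h1 hr]] := graded_smith (e0 := 0) gA; first by move=> l i; rewrite dvd1p.
exists h; split=> //; move: hr.
rewrite !map_cyc_mx /= /horner_eval !hornerX rank_cyc_mx1 //.
have [st [stE ->]] := LR_boxesE I J hn.
case: (pickP (letter I J)) => [i0 li0|nol].
  have := rank_cyc_mx0 F hn li0 stE; move: #|_| => s.
  move: (\rank (cyc_mx I J (0 : F))) => r rE hr; have : (size h + r = (r + s).-1)%N by rewrite rE.
  by lia.
have -> : cyc_mx I J (0 : F) = cyc_mx I J 1.
  apply/matrixP => l i; rewrite !mxE; have := nol i; rewrite /letter !inE.
  by case: (i \in I); case: (i \in J) => //= _; rewrite !expr1n.
rewrite rank_cyc_mx1 // (_ : #|LR_ends I J st| = 0%N); first by lia.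
by apply/eqP; rewrite cards_eq0 -subset0; apply/subsetP => i; rewrite inE nol.
Qed.

End Grading.

(** * Paths in [B] *)

Section AlgebraElements.
Variables (F : fieldType) (n k : nat).
Hypotheses (hn : (1 < n)%N) (hk : (1 <= k <= n - 1)%N).
Local Notation B := (algB F n k).
Local Notation toB := (qpi (@relB F n k)).
Local Notation Z := {poly F}.
Local Notation pB := (@polyB F n k).

Definition eB (i : 'Z_n) : B := toB (idem F i).
Definition xB (i : 'Z_n) : B := toB (xarr F i).
Definition yB (i : 'Z_n) : B := toB (yarr F i).

(** Both the path of [a] arrows x and that of [n - a] arrows y lead from [u] to [u + a];
    this is the one of which the other is a multiple by a power of [t]. *)
Definition basicpath (u : 'Z_n) (a : nat) : B :=
  toB (if (a <= k)%N then xpath F u a else ypath F u (n - a)).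

Lemma eB_eB i j : eB i * eB j = if i == j then eB i else 0.
Proof. by rewrite -rmorphM pidem_pidem; case: eqP; rewrite ?rmorph0. Qed.

Lemma xB_eB i j : xB i * eB j = if j == i - 1 then xB i else 0.
Proof. by rewrite -rmorphM parrow_pidem; case: eqP; rewrite ?rmorph0. Qed.

Lemma yB_eB i j : yB i * eB j = if j == i then yB i else 0.
Proof. by rewrite -rmorphM parrow_pidem; case: eqP; rewrite ?rmorph0. Qed.

Lemma polyBX : pB 'X = tB F n k.
Proof. by rewrite -['X]mul1r [LHS]poly_evalMX rmorph1 mul1r. Qed.

Lemma xB_yB i : xB i * yB i = pB 'X * eB i.
Proof. by rewrite polyBX tB_idem rmorphM. Qed.

Lemma yB_xB i : yB (i + 1) * xB (i + 1) = pB 'X * eB i.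
Proof. by rewrite polyBX tB_idem relB_comm [RHS]rmorphM. Qed.

Lemma eB_xpath u a : eB (u + a%:R) * toB (xpath F u a) = toB (xpath F u a).
Proof.
case: a => [|a]; first by rewrite addr0 [LHS]eB_eB eqxx.
by rewrite -rmorphM /= mulrA pidem_parrow eqxx.
Qed.

Lemma eB_ypath u a : eB (u - a%:R) * toB (ypath F u a) = toB (ypath F u a).
Proof.
case: a => [|a]; first by rewrite subr0 [LHS]eB_eB eqxx.
by rewrite -rmorphM /= mulrA pidem_parrow /= -natr1 opprD addrA eqxx.
Qed.

Lemma xpath_eB u a : toB (xpath F u a) * eB u = toB (xpath F u a).
Proof.
elim: a => [|a IHa]; first by rewrite [LHS]eB_eB eqxx.
by rewrite /= rmorphM -mulrA IHa.
Qed.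

Lemma ypath_eB u a : toB (ypath F u a) * eB u = toB (ypath F u a).
Proof.
elim: a => [|a IHa]; first by rewrite [LHS]eB_eB eqxx.
by rewrite /= rmorphM -mulrA IHa.
Qed.

Lemma rel_xy u : toB (xpath F u k) = toB (ypath F u (n - k)).
Proof.
apply/qpi_eq; set r := _ - _; rewrite -[r]mulr1 -[r]mul1r -[_ * _]addr0.
by apply: ideal_genD; [exists u; right|apply: ideal_gen0].
Qed.

Lemma basicpath_x u a : (a <= k)%N -> basicpath u a = toB (xpath F u a).
Proof. by rewrite /basicpath => ->. Qed.

Lemma basicpath_y u a : (k <= a)%N -> basicpath u a = toB (ypath F u (n - a)).
Proof.
rewrite leq_eqVlt => /orP[/eqP <-|ka]; first by rewrite basicpath_x // rel_xy.
by rewrite /basicpath leqNgt ka.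
Qed.

Lemma basicpath_eB u a : basicpath u a * eB u = basicpath u a.
Proof. by rewrite /basicpath; case: ifP => _; [exact: xpath_eB|exact: ypath_eB]. Qed.

Lemma eB_basicpath u a : (a <= n)%N -> eB (u + a%:R) * basicpath u a = basicpath u a.
Proof.
move=> an; rewrite /basicpath; case: ifP => _; first exact: eB_xpath.
have -> : u + a%:R = u - (n - a)%:R by rewrite (natr_subn hn) ?opprK.
exact: eB_ypath.
Qed.

Lemma basicpath0 u : basicpath u 0 = eB u.
Proof. by rewrite basicpath_x. Qed.

Lemma basicpathn u : basicpath u n = eB u.
Proof. by rewrite basicpath_y ?subnn //; lia. Qed.

(** Multiplying by an arrow prolongs the path or, when it is of the other kind, cancels its
    last arrow at the cost of a factor [t]. At [a = k] both kinds are available. *)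
Lemma xB_basicpath u a : (a < n)%N ->
  xB (u + a.+1%:R) * basicpath u a = pB ('X ^+ (k <= a)%N) * basicpath u a.+1.
Proof.
move=> an; have [ka|ak] := leqP k a; last first.
  by rewrite rmorph1 mul1r !basicpath_x ?(ltnW ak) // -rmorphM.
rewrite expr1 !basicpath_y ?leqW //.
have -> : (n - a = (n - a.+1).+1)%N by lia.
rewrite /= rmorphM mulrA -/(yB _).
have -> : u - (n - a.+1)%:R = u + a.+1%:R by rewrite (natr_subn hn) ?opprK.
rewrite xB_yB -mulrA; congr (_ * _).
have -> : u + a.+1%:R = u - (n - a.+1)%:R by rewrite (natr_subn hn) ?opprK.
exact: eB_ypath.
Qed.

Lemma yB_basicpath u a : (0 < a <= n)%N ->
  yB (u + a%:R) * basicpath u a = pB ('X ^+ (a <= k)%N) * basicpath u a.-1.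
Proof.
case: a => // a /andP[_ an]; have [ak|ka] := leqP a.+1 k; last first.
  rewrite rmorph1 mul1r !basicpath_y //=; last by lia.
  have -> : (n - a = (n - a.+1).+1)%N by lia.
  rewrite /= rmorphM -/(yB _); congr (yB _ * _).
  by rewrite (natr_subn hn) ?opprK.
rewrite expr1 !basicpath_x ?(ltnW ak) //= rmorphM mulrA -/(xB _) -natr1 addrA yB_xB -mulrA.
by rewrite eB_xpath.
Qed.

Definition minpath (u j : 'Z_n) : B := basicpath u (j - u : 'Z_n)%R.

Lemma basicpath_minpath u a : (a <= n)%N -> basicpath u a = minpath u (u + a%:R).
Proof.
rewrite /minpath (addrC u) addrK leq_eqVlt => /orP[/eqP->|an].
  by rewrite natr_Zn0 // basicpathn basicpath0.
by rewrite val_Zp_nat // modn_small.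
Qed.

Lemma minpathK (u j : 'Z_n) : j = u + (j - u : 'Z_n)%R%:R.
Proof. by rewrite natr_Zp addrC subrK. Qed.

(** The span over the centre of the minimal paths that start at [u]. *)
Definition pspan u (b : B) := exists p : 'Z_n -> Z, b = \sum_j pB (p j) * minpath u j.

Lemma pspanD u b c : pspan u b -> pspan u c -> pspan u (b + c).
Proof.
move=> [p ->] [q ->]; exists (fun j => p j + q j); rewrite -big_split /=.
by apply: eq_bigr => j _; rewrite rmorphD mulrDl.
Qed.

Lemma pspan0 u : pspan u 0.
Proof. by exists (fun _ => 0); rewrite big1 // => j _; rewrite rmorph0 mul0r. Qed.

Lemma pspan_sum u (f : 'Z_n -> B) : (forall j, pspan u (f j)) -> pspan u (\sum_j f j).
Proof. by move=> fs; elim/big_ind: _ => // *; [exact: pspan0|exact: pspanD]. Qed.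

Lemma pspanZ u p b : pspan u b -> pspan u (pB p * b).
Proof.
move=> [q ->]; exists (fun j => p * q j); rewrite mulr_sumr.
by apply: eq_bigr => j _; rewrite rmorphM mulrA.
Qed.

Lemma pspan_minpath u j : pspan u (minpath u j).
Proof.
exists (fun i => (i == j)%:R); rewrite (bigD1 j) //= eqxx rmorph1 mul1r big1 ?addr0 //.
by move=> i /negPf->; rewrite rmorph0 mul0r.
Qed.

Lemma pspan_lmul u c b : (forall j, pspan u (c * minpath u j)) -> pspan u b -> pspan u (c * b).
Proof.
move=> cm [p ->]; rewrite mulr_sumr; apply: pspan_sum => j.
by rewrite mulrA -(polyB_central (p j)) -mulrA; apply: pspanZ.
Qed.

Lemma pspan_eB u v b : pspan u b -> pspan u (eB v * b).
Proof.
apply: pspan_lmul => j; rewrite /minpath -eB_basicpath -?minpathK ?(ltnW (ltn_Zn hn _)) //.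
rewrite mulrA eB_eB; case: eqP => [->|_]; last by rewrite mul0r; exact: pspan0.
rewrite {1}(minpathK u j) eB_basicpath ?(ltnW (ltn_Zn hn _)) //.
exact: pspan_minpath.
Qed.

Lemma pspan_xB u v b : pspan u b -> pspan u (xB v * b).
Proof.
apply: pspan_lmul => j; have [jv|jv] := eqVneq j (v - 1); last first.
  rewrite /minpath -eB_basicpath -?minpathK ?(ltnW (ltn_Zn hn _)) //.
  by rewrite mulrA xB_eB (negPf jv) mul0r; exact: pspan0.
have -> : v = u + (j - u : 'Z_n)%R.+1%:R by rewrite -natr1 addrA -minpathK jv subrK.
rewrite /minpath xB_basicpath ?ltn_Zn // basicpath_minpath ?ltn_Zn //.
exact/pspanZ/pspan_minpath.
Qed.

Lemma pspan_yB u v b : pspan u b -> pspan u (yB v * b).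
Proof.
apply: pspan_lmul => j; have [->|jv] := eqVneq j v; last first.
  rewrite /minpath -eB_basicpath -?minpathK ?(ltnW (ltn_Zn hn _)) //.
  by rewrite mulrA yB_eB (negPf jv) mul0r; exact: pspan0.
suff [a an [-> vE]] : exists2 a, (0 < a <= n)%N & minpath u v = basicpath u a /\ v = u + a%:R.
  rewrite vE yB_basicpath // basicpath_minpath; first exact/pspanZ/pspan_minpath.
  by lia.
have [->|vu] := eqVneq v u.
  exists n; first by lia.
  by rewrite /minpath subrr basicpath0 basicpathn natr_Zn0 // addr0.
exists (v - u : 'Z_n)%R; last by rewrite -minpathK.
rewrite (ltnW (ltn_Zn hn _)) andbT lt0n; apply: contra_neq vu => vu.
by apply/eqP; rewrite -subr_eq0; apply/eqP/val_inj.
Qed.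

(** The span of the minimal paths is stable under the arrows and contains [e_u], so it is
    the whole of [B e_u]. *)
Lemma projB_pspan u b : @projB F n k u b -> pspan u b.
Proof.
case=> c ->; rewrite -[c]qpi_repr -/(eB u).
have : pspan u (eB u) by rewrite -basicpath0 basicpath_minpath //; exact: pspan_minpath.
move: (eB u) => e; elim/freemod_ind: (repr c) e => [|a [[v w] H] f IHf] e pe.
  by rewrite rmorph0 mul0r; exact: pspan0.
rewrite rmorphD mulrDl; apply: pspanD; last exact: IHf.
pose g : pathalg F (circle n) := fbasis F (@QPath (circle n) (v, w) H).
rewrite [X in X * e](_ : _ = pB a%:P * toB g); last first.
  change (toB (a *: g) = pB a%:P * toB g).
  have -> : pB a%:P = toB (a *: (1 : pathalg F (circle n))) by exact: poly_evalC.
  by rewrite -rmorphM pathalg_scaleAl mul1r.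
rewrite -mulrA {}/g.
apply: pspanZ; elim: w v H e pe => [|x w IHw] v H e pe.
  rewrite (_ : fbasis F _ = idem F v); first exact: pspan_eB.
  by congr fbasis; apply: val_inj.
have [/eqP/= va H'] := andP H; subst v.
rewrite (path_cons _ H H') rmorphM -mulrA; apply: IHw.
by case: x {H H'} => i; [exact: pspan_xB|exact: pspan_yB].
Qed.

End AlgebraElements.

(** * The action on the rank 1 modules *)

Section RankOneAction.
Variables (F : fieldType) (n k : nat).
Hypotheses (hn : (1 < n)%N) (hk : (1 <= k <= n - 1)%N).
Local Notation B := (algB F n k).
Local Notation toB := (qpi (@relB F n k)).
Local Notation Z := {poly F}.
Local Notation pB := (@polyB F n k).
Variables (I : {set 'Z_n}) (hI : #|I| = k).
Local Notation L := (rank1 F hn hI).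

Definition rfun (g : L) : 'Z_n -> Z := g.

Lemma rfun_ext (g h : L) : rfun g =1 rfun h -> g = h.
Proof. by move=> gh; apply/funext. Qed.

Lemma rfunD (g h : L) i : rfun (g + h) i = rfun g i + rfun h i.
Proof. by []. Qed.

Lemma rfun0 i : rfun 0 i = 0.
Proof. by []. Qed.

Lemma rfunB (g h : L) i : rfun (g - h) i = rfun g i - rfun h i.
Proof. by []. Qed.

Lemma rfun_sum (T : finType) (P : pred T) (g : T -> L) i :
  rfun (\sum_(t | P t) g t) i = \sum_(t | P t) rfun (g t) i.
Proof. by elim/big_rec2: _ => [//|t x y _ <-]. Qed.

Lemma rfun_toB a (g : L) : rfun (toB a *: g) = rep_act (rank1_wt F I) a g.
Proof. exact: (descent_scaleE (rank1_killed hn hI)). Qed.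

Lemma rfun_eB i (g : L) j : rfun (eB F k i *: g) j = if j == i then rfun g i else 0.
Proof. by rewrite rfun_toB rep_act_idem. Qed.

Lemma rfun_xB i (g : L) j : rfun (xB F k i *: g) j =
  if j == i then 'X ^+ (i \notin I) * rfun g (i - 1) else 0.
Proof. by rewrite rfun_toB rep_act_arrow /=; case: (i \in I). Qed.

Lemma rfun_yB i (g : L) j : rfun (yB F k i *: g) j =
  if j == i - 1 then 'X ^+ (i \in I) * rfun g i else 0.
Proof. by rewrite rfun_toB rep_act_arrow /=; case: (i \in I). Qed.

Lemma rfun_polyX (g : L) j : rfun (pB 'X *: g) j = 'X * rfun g j.
Proof.
have E : pB 'X = pB 'X * (\sum_i eB F k i).
  by rewrite -[LHS]mulr1; congr (_ * _); rewrite -rmorph_sum -(rmorph1 toB).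
rewrite E mulr_sumr scaler_suml rfun_sum (bigD1 j) //= big1 ?addr0 => [|i ij].
  rewrite -xB_yB -scalerA rfun_xB eqxx rfun_yB eqxx mulrA -exprD.
  by case: (j \in I).
rewrite -xB_yB -scalerA rfun_xB eq_sym (negPf ij).
by [].
Qed.

Lemma rfun_polyC c (g : L) j : rfun (pB c%:P *: g) j = c%:P * rfun g j.
Proof.
have -> : pB c%:P = toB (c *: (1 : pathalg F (circle n))) by exact: poly_evalC.
rewrite rfun_toB -[c *: _]addr0 rep_act_lin rep_act0 addr0 rep_act1 mul_polyC.
by [].
Qed.

Lemma rfun_poly p (g : L) j : rfun (pB p *: g) j = p * rfun g j.
Proof.
elim/poly_ind: p g j => [|p c IHp] g j; first by rewrite rmorph0 scale0r mul0r.
rewrite rmorphD rmorphM scalerDl -scalerA rfunD IHp rfun_polyX rfun_polyC.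
by rewrite mulrDl mulrA.
Qed.

(** The element 1 at the vertex [i]. *)
Definition one_at (i : 'Z_n) : L := (fun j => (j == i)%:R : Z).

Lemma one_atE i j : rfun (one_at i) j = (j == i)%:R.
Proof. by []. Qed.

Lemma eB_one i j : eB F k i *: one_at j = if i == j then one_at j else 0.
Proof.
apply: rfun_ext => l; rewrite rfun_eB; case: eqVneq => [->|li]; case: eqVneq => ij.
- by [].
- by rewrite one_atE (negPf ij).
- by rewrite one_atE -ij (negPf li).
- by [].
Qed.

(** The exponent by which the minimal path from [u] to [j] acts on [L_I]. *)
Definition cost (u j : 'Z_n) : nat :=
  let a := (j - u : 'Z_n)%R : nat in
  if (a <= k)%N then (\sum_(0 <= l < a) ((u + l.+1%:R)%R \notin I))%N
  else (\sum_(0 <= l < n - a) ((u - l%:R)%R \in I))%N.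

Lemma rfun_minpath u j (g : L) l :
  rfun (minpath F k u j *: g) l = if l == j then 'X^(cost u j) * rfun g u else 0.
Proof.
rewrite /minpath /cost /basicpath; case: ifP => _; rewrite rfun_toB.
  by rewrite rep_act_xpath -minpathK.
rewrite rep_act_ypath; congr (if l == _ then _ else _).
by rewrite (natr_subn hn) ?opprK -?minpathK // ltnW ?ltn_Zn.
Qed.

Lemma rfun_pspan u (p : 'Z_n -> Z) (g : L) j :
  rfun ((\sum_i pB (p i) * minpath F k u i) *: g) j = p j * 'X^(cost u j) * rfun g u.
Proof.
rewrite scaler_suml rfun_sum (bigD1 j) //= big1 ?addr0 => [|i ij].
  by rewrite -scalerA rfun_poly rfun_minpath eqxx mulrA.
by rewrite -scalerA rfun_poly rfun_minpath eq_sym (negPf ij) mulr0.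
Qed.

Lemma polyXn_neq0 e : ('X^e : Z) != 0.
Proof. by rewrite expf_eq0 polyX_eq0 andbF. Qed.

(** Minimal paths to different vertices have images supported at different vertices, and
    each acts by a power of [t]. *)
Lemma projB_faithful u b : @projB F n k u b -> b *: one_at u = 0 -> b = 0.
Proof.
move=> /(projB_pspan hn hk)[p ->] p0; rewrite big1 // => j _.
have /eqP := congr1 (fun g : L => rfun g j) p0.
rewrite rfun_pspan one_atE eqxx mulr1 rfun0 mulf_eq0 (negPf (polyXn_neq0 _)) orbF => /eqP->.
by rewrite rmorph0 mul0r.
Qed.

Lemma projB_image u (g : L) :
  (exists2 b, @projB F n k u b & b *: one_at u = g) <->
  (forall j, exists p, rfun g j = p * 'X^(cost u j)).
Proof.
split=> [[b /(projB_pspan hn hk)[p ->] <-] j|/choice[p pE]].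
  by exists (p j); rewrite rfun_pspan one_atE eqxx mulr1.
exists (\sum_i pB (p i) * minpath F k u i).
  exists (\sum_i pB (p i) * minpath F k u i); rewrite mulr_suml.
  by apply: eq_bigr => i _; rewrite -mulrA basicpath_eB.
by apply: rfun_ext => j; rewrite rfun_pspan one_atE eqxx mulr1 pE.
Qed.

End RankOneAction.

(** * The cost of minimal paths *)

Section Cost.
Variables (n k : nat).
Hypotheses (hn : (1 < n)%N) (hk : (1 <= k <= n - 1)%N).
Variables (I : {set 'Z_n}) (hI : #|I| = k).
Local Notation cost := (cost k I).

(** The costs of the arrows x leading to [j] from [j - a] and of the arrows y from [j + b]. *)
Definition xcost (j : 'Z_n) a := (\sum_(0 <= b < a) ((j - b%:R)%R \notin I))%N.
Definition ycost (j : 'Z_n) b := (\sum_(0 <= l < b) ((j + l.+1%:R)%R \in I))%N.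

Lemma xcost_le j a b : (a <= b)%N -> (xcost j a <= xcost j b)%N.
Proof. by move=> ab; rewrite /xcost (big_cat_nat (leq0n a) ab) //= leq_addr. Qed.

Lemma ycost_le j a b : (a <= b)%N -> (ycost j a <= ycost j b)%N.
Proof. by move=> ab; rewrite /ycost (big_cat_nat (leq0n a) ab) //= leq_addr. Qed.

Lemma cost_x j a : (a <= k)%N -> cost (j - a%:R) j = xcost j a.
Proof.
move=> ak; rewrite /cost opprB addrC subrK (val_natZ hn) ?ak; last by lia.
rewrite /xcost big_nat_rev /=; apply: eq_big_nat => l /andP[_ la].
rewrite add0n -subSn // subSS natrB ?(ltnW la) //.
by rewrite addrA subrK.
Qed.

Lemma ycost_rev j b : ycost j b = (\sum_(0 <= l < b) ((j + b%:R - l%:R)%R \in I))%N.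
Proof.
rewrite /ycost big_nat_rev /=; apply: eq_big_nat => l /andP[_ lb].
by rewrite add0n -subSn // subSS natrB ?(ltnW lb) // addrA.
Qed.

(** Both paths from the antipodal point [j - k] to [j] are minimal. *)
Lemma xcost_ycost j : xcost j k = ycost j (n - k).
Proof.
rewrite ycost_rev -cost_x // /cost opprB addrC subrK (val_natZ hn) ?leqnn; last by lia.
rewrite (rim_count hn (j - k%:R) hI); apply: eq_bigr => l _.
by rewrite (natr_subn hn) //; lia.
Qed.

Lemma cost_y j b : (b <= n - k)%N -> cost (j + b%:R) j = ycost j b.
Proof.
rewrite leq_eqVlt => /orP[/eqP->|bnk].
  by rewrite (natr_subn hn) ?cost_x ?xcost_ycost //; lia.
case: b bnk => [|b] bnk.
  by rewrite addr0 /cost /ycost subrr /= !big_geq.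
rewrite /cost opprD addrA subrr add0r -(natr_subn hn); last by lia.
rewrite (val_natZ hn); last by lia.
rewrite leqNgt (_ : (k < n - b.+1)%N = true) /=; last by lia.
by rewrite subKn -?ycost_rev //; lia.
Qed.

Lemma cost_far_x j m : (m <= k)%N -> cost (j - k%:R + m%:R) j = xcost j (k - m).
Proof. by move=> mk; rewrite -cost_x ?leq_subr // natrB // opprB addrCA addrC. Qed.

Lemma cost_far_y j m : (k <= m <= n)%N -> cost (j - k%:R + m%:R) j = ycost j (m - k).
Proof.
move=> /andP[km mn]; rewrite -cost_y; last by lia.
by rewrite natrB // addrAC addrA.
Qed.

Lemma cost_le i j : (cost i j <= xcost j k)%N.
Proof.
have -> : i = j - k%:R + (i - (j - k%:R))%R%:R by rewrite natr_Zp addrC subrK.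
move: (i - _)%R => m; have mn := ltn_Zn hn m.
have [mk|km] := leqP m k; first by rewrite cost_far_x // xcost_le // leq_subr.
rewrite cost_far_y; last by lia.
by rewrite xcost_ycost ycost_le; lia.
Qed.

Lemma cost_refl i : cost i i = 0%N.
Proof. by rewrite /cost subrr big_geq. Qed.

Variable F : fieldType.
Local Notation Z := {poly F}.

(** For values [z] with zero sum, the partial sums [W] that start at the antipodal point
    [j - k] solve the difference equation. On the arc of the x's the costs decrease on the
    way to [j], so that [W] is a sum of terms of higher order than required; on the other
    arc the same holds for the complementary sum, which is the opposite of [W]. *)
Lemma cyclic_primitive (j : 'Z_n) (z : 'Z_n -> Z) :
  (forall i, 'X^(cost i j) %| z i) -> \sum_i z i = 0 ->
  exists W : 'Z_n -> Z, forall i, [/\ W i - W (i - 1) = z i,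
    'X^(cost i j) %| W (i - 1) & 'X^(cost (i - 1) j) %| W (i - 1)].
Proof.
move=> dz sz; pose far := j - k%:R.
pose S m := \sum_(0 <= l < m) z (far + l.+1%:R).
pose W i := S (i - far : 'Z_n)%R.
have Sn : S n = 0 by rewrite /S (sum_circle hn).
have WE m : (m <= n)%N -> W (far + m%:R) = S m.
  rewrite /W (addrC far) addrK leq_eqVlt => /orP[/eqP->|mn]; last by rewrite (val_natZ hn).
  by rewrite natr_Zn0 // Sn /S big_geq.
exists W => i; have [m mn iE] : exists2 m, (m < n)%N & i = far + m.+1%:R.
  exists (i - 1 - far : 'Z_n)%R; first exact: ltn_Zn.
  by rewrite -natr1 natr_Zp; ring.
have i1E : i - 1 = far + m%:R by rewrite iE -natr1; ring.
rewrite i1E !WE ?(ltnW mn) // {1}iE WE //.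
have SE : S m.+1 = S m + z i by rewrite iE /S big_nat_recr.
suff [D SD [Di Di1]] : exists2 D, 'X^D %| S m &
    (cost i j <= D)%N /\ (cost (far + m%:R)%R j <= D)%N.
  by rewrite SE addrC addKr; split=> //; apply: dvdp_trans SD; apply: dvdp_exp2l.
have sumD D a b : (forall l, (a <= l < b)%N -> (D <= cost (far + l.+1%:R)%R j)%N) ->
    'X^D %| \sum_(a <= l < b) z (far + l.+1%:R).
  move=> Dl; rewrite big_seq; elim/big_ind: _ => [|x y|l]; first exact: dvdp0.
    exact: dvdp_add.
  by rewrite mem_index_iota => /Dl Dz; apply: dvdp_trans (dz _); apply: dvdp_exp2l.
have [mk|km] := ltnP m k.
  exists (xcost j (k - m)).
    by apply: sumD => l /andP[_ lm]; rewrite cost_far_x ?xcost_le; lia.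
  by rewrite iE !cost_far_x ?xcost_le //; lia.
exists (ycost j (m.+1 - k)).
  have -> : S m = - \sum_(m <= l < n) z (far + l.+1%:R).
    by apply/eqP; rewrite -addr_eq0 -(big_cat_nat (leq0n m) (ltnW mn)) /= -/(S n) Sn.
  rewrite dvdpNr; apply: sumD => l /andP[ml ln].
  by rewrite cost_far_y ?ycost_le; lia.
by rewrite iE !cost_far_y ?ycost_le //; lia.
Qed.
End Cost.

(** * A presentation with one generator per vertex *)

Section ProjFam.
Variables (F : fieldType) (n k : nat).
Local Notation B := (algB F n k).

(** The direct sum of the [P_(tau i)] over all [i]; unlike a sum indexed by a set of
    vertices it allows repetitions, needed for the relators. *)
Definition proj_fam (tau : 'Z_n -> 'Z_n) : submodule ('Z_n -> B^o).
Proof.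
apply: (@Submodule B _ (fun g : 'Z_n -> B^o => forall i, @projB F n k (tau i) (g i))).
  by move=> i; exact: smem0.
by move=> a g h Pg Ph i; apply: smemP.
Defined.

Variable tau : 'Z_n -> 'Z_n.
Local Notation P := (submod (proj_fam tau)).

Definition coord (w : P) (i : 'Z_n) : B := subval w i.
Arguments coord : simpl never.

Lemma coordP w i : @projB F n k (tau i) (coord w i).
Proof. by have /asboolP := subvalP w; apply. Qed.

Lemma coord_lin a u v i : coord (a *: u + v) i = a * coord u i + coord v i.
Proof. by rewrite /coord subval_lin addrfctE scalrfctE. Qed.

Lemma coord0 i : coord 0 i = 0.
Proof. by rewrite /coord subval0. Qed.

Lemma coordZ a u i : coord (a *: u) i = a * coord u i.
Proof. by rewrite -[a *: u]addr0 coord_lin coord0 addr0. Qed.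

Lemma coordD u v i : coord (u + v) i = coord u i + coord v i.
Proof. by rewrite -[u]scale1r coord_lin mul1r scale1r. Qed.

Lemma coordB u v i : coord (u - v) i = coord u i - coord v i.
Proof. by rewrite coordD -scaleN1r coordZ mulN1r. Qed.

Lemma coord_sum (T : finType) (f : T -> P) i : coord (\sum_t f t) i = \sum_t coord (f t) i.
Proof.
by elim/big_rec2: _ => [|t x y _ <-]; [exact: coord0|exact: coordD].
Qed.

Lemma coord_inj u v : coord u =1 coord v -> u = v.
Proof. by move=> uv; apply: val_inj; apply/funext. Qed.

Lemma make_fam (b : 'Z_n -> B) : (forall i, @projB F n k (tau i) (b i)) ->
  exists w : P, coord w =1 b.
Proof.
move=> Pb; have Pb' : smemb (proj_fam tau) (b : 'Z_n -> B^o) by apply/asboolP.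
by exists (Submod Pb').
Qed.

Lemma fam_gen_subproof i :
  smemb (proj_fam tau) (fun j => if j == i then eB F k (tau i) : B^o else 0).
Proof.
apply/asboolP => j; case: eqP => [->|_]; last exact: smem0.
by exists 1; rewrite mul1r.
Qed.

Definition fam_gen i : P := Submod (fam_gen_subproof i).

Lemma coord_gen i j : coord (fam_gen i) j = if j == i then eB F k (tau i) else 0.
Proof. by []. Qed.

Lemma projB_eB u b : @projB F n k u b -> b * eB F k u = b.
Proof. by case=> c ->; rewrite -mulrA eB_eB eqxx. Qed.

Lemma fam_decomp w : w = \sum_i coord w i *: fam_gen i.
Proof.
apply: coord_inj => j; rewrite coord_sum (bigD1 j) //= big1 => [|i ij].
  by rewrite coordZ coord_gen eqxx addr0 projB_eB //; exact: coordP.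
by rewrite coordZ coord_gen eq_sym (negPf ij) mulr0.
Qed.

Lemma eB_gen i : eB F k (tau i) *: fam_gen i = fam_gen i.
Proof.
apply: coord_inj => j; rewrite coordZ coord_gen; case: eqP => _; rewrite ?mulr0 //.
by rewrite eB_eB eqxx.
Qed.

Variable N : lmodType B.

Definition comb (y : 'Z_n -> N) (w : P) : N := \sum_i coord w i *: y i.

Lemma comb_is_linear y : linear (comb y).
Proof.
move=> a u v; rewrite /comb scaler_sumr -big_split /=; apply: eq_bigr => i _.
by rewrite coord_lin scalerDl scalerA.
Qed.
HB.instance Definition _ y := GRing.isLinear.Build B P N *:%R (comb y) (comb_is_linear y).

Lemma linear_comb (f : {linear P -> N}) w : f w = comb (fun i => f (fam_gen i)) w.
Proof.
by rewrite {1}[w]fam_decomp linear_sum; apply: eq_bigr => i _; rewrite linearZ.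
Qed.

Lemma comb_gen y i : comb y (fam_gen i) = eB F k (tau i) *: y i.
Proof.
rewrite /comb (bigD1 i) //= big1 ?addr0 => [|j ji]; first by rewrite coord_gen eqxx.
by rewrite coord_gen (negPf ji) scale0r.
Qed.

End ProjFam.

Lemma proj_fam_projective (F : fieldType) (n k : nat) (tau : 'Z_n -> 'Z_n) :
  projective (submod (@proj_fam F n k tau)).
Proof.
move=> Y W e f ef; have [y yE] := choice (fun i => ef (fam_gen F k tau i)).
exists (comb y) => w; rewrite [RHS]linear_comb [LHS]linear_sum; apply: eq_bigr => i _.
by rewrite linearZ /= yE.
Qed.

Section Presentation.
Variables (F : fieldType) (n k : nat).
Hypotheses (hn : (1 < n)%N) (hk : (1 <= k <= n - 1)%N).
Local Notation B := (algB F n k).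
Local Notation Z := {poly F}.
Local Notation pB := (@polyB F n k).
Variables (I : {set 'Z_n}) (hI : #|I| = k).
Local Notation L := (rank1 F hn hI).
Local Notation one := (one_at F hn hI).

Section Theta.
Variable tau : 'Z_n -> 'Z_n.
Local Notation P := (submod (@proj_fam F n k tau)).

(** Embeds the sum of projectives in a power of [L_I], by evaluation at 1. *)
Definition theta (w : P) (i : 'Z_n) : L := coord w i *: one (tau i).

Lemma theta_is_linear : linear (theta : P -> ('Z_n -> L)).
Proof.
by move=> a u v; apply/funext => i; rewrite /theta coord_lin scalerDl -scalerA.
Qed.
HB.instance Definition _ := GRing.isLinear.Build B P ('Z_n -> L) *:%R theta theta_is_linear.

Lemma thetaB u v i : theta (u - v) i = theta u i - theta v i.
Proof. by rewrite linearB. Qed.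

Lemma thetaZ a u i : theta (a *: u) i = a *: theta u i.
Proof. by rewrite linearZ. Qed.

Lemma theta_sum (T : finType) (f : T -> P) i : theta (\sum_t f t) i = \sum_t theta (f t) i.
Proof. by rewrite /theta coord_sum scaler_suml. Qed.

Lemma theta_inj : injective theta.
Proof.
move=> u v uv; apply: coord_inj => i; apply/eqP; rewrite -subr_eq0 -coordB; apply/eqP.
apply: (@projB_faithful F n k hn hk I hI (tau i)); first exact: coordP.
by rewrite -[LHS]/(theta (u - v) i) thetaB uv subrr.
Qed.

Lemma theta_image (z : 'Z_n -> L) :
  (exists w, theta w = z) <-> (forall i j, 'X^(cost k I (tau i) j) %| rfun (z i) j).
Proof.
split=> [[w <-] i j|dz].
  apply/Pdiv.Field.dvdpP;  apply: (projB_image hk (tau i) (theta w i)).1.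
  by exists (coord w i) => //; exact: coordP.
have zb i : exists b, @projB F n k (tau i) b /\ b *: one (tau i) = z i.
  have [|b bP bE] := (projB_image hk (tau i) (z i)).2; last by exists b.
  by move=> j; apply/Pdiv.Field.dvdpP.
have [b bP] := choice zb; have [w wE] := @make_fam F n k tau b (fun i => (bP i).1).
by exists w; apply/funext => i; rewrite /theta wE; case: (bP i).
Qed.

Lemma theta_gen i j : theta (fam_gen F k tau i) j = if j == i then one (tau i) else 0.
Proof.
rewrite /theta coord_gen; case: eqP => [->|_]; last by rewrite scale0r.
by rewrite eB_one eqxx.
Qed.

End Theta.

(** The vertex at which the [i]-th relator lives. *)
Definition rel_vertex (i : 'Z_n) := if i \in I then i else i - 1.

Local Notation P0 := (submod (@proj_fam F n k id)).
Local Notation P1 := (submod (@proj_fam F n k rel_vertex)).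
Local Notation gen := (fam_gen F k id).

Definition relator (i : 'Z_n) : P0 :=
  if i \in I then xB F k i *: gen (i - 1) - gen i else gen (i - 1) - yB F k i *: gen i.

Definition pres_d : {linear P1 -> P0} := comb relator.
Definition pres_pi : {linear P0 -> L} := comb one.

Lemma xB_one i : i \in I -> xB F k i *: one (i - 1) = one i.
Proof.
move=> iI; apply: rfun_ext => j; rewrite rfun_xB iI !one_atE eqxx mulr1.
by case: eqP.
Qed.

Lemma yB_one i : i \notin I -> yB F k i *: one i = one (i - 1).
Proof.
move=> iI; apply: rfun_ext => j; rewrite rfun_yB (negPf iI) !one_atE eqxx mulr1.
by case: eqP.
Qed.

Lemma theta_relator i j : theta (relator i) j =
  (if j == i - 1 then one (rel_vertex i) else 0) - (if j == i then one (rel_vertex i) else 0).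
Proof.
rewrite /relator /rel_vertex; case: ifPn => iI; rewrite thetaB thetaZ !theta_gen;
  congr (_ - _); case: eqP; rewrite ?scaler0 //.
  by rewrite xB_one.
by rewrite yB_one.
Qed.

(** Both terms of a relator act on the respective elements 1 of [L_I] as the same element
    1, so in the coordinates [theta] the differential takes successive differences. *)
Lemma theta_pres_d w i : theta (pres_d w) i = theta w (i + 1) - theta w i.
Proof.
rewrite /pres_d /= /comb theta_sum.
under eq_bigr => l _ do rewrite thetaZ theta_relator scalerBr.
rewrite sumrB; congr (_ - _).
  rewrite (bigD1 (i + 1)) //= addrK eqxx big1 ?addr0 // => l li.
  by rewrite -subr_eq eq_sym in li; rewrite (negPf li) scaler0.
rewrite (bigD1 i) //= eqxx big1 ?addr0 // => l li.
by rewrite eq_sym (negPf li) scaler0.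
Qed.

Lemma pres_piE w : pres_pi w = \sum_i theta w i.
Proof. by []. Qed.

Lemma pres_d_ker w : pres_d w = 0 <-> forall i, theta w i = theta w 0.
Proof.
split=> [dw i|wE].
  apply: (@circle_ind n (fun i => theta w i = theta w 0) 0) => // {}i <-.
  apply/eqP; rewrite -subr_eq0 -theta_pres_d dw; apply/eqP.
  by rewrite linear0.
apply: theta_inj; rewrite linear0; apply/funext => i.
by rewrite theta_pres_d !wE subrr.
Qed.

Lemma pres_exact : presents pres_d pres_pi.
Proof.
split; try exact: proj_fam_projective.
  move=> x; have [|w wE] := (@theta_image id (fun i => eB F k i *: x)).2.
    move=> i j; rewrite rfun_eB; case: eqP => [->|_]; last exact: dvdp0.
    by rewrite cost_refl dvd1p.
  exists w; rewrite pres_piE wE; apply: rfun_ext => j.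
  rewrite rfun_sum (bigD1 j) //= rfun_eB eqxx big1 ?addr0 // => i ij.
  by rewrite rfun_eB eq_sym (negPf ij).
move=> w; split=> [|[v <-]]; last first.
  rewrite pres_piE; under eq_bigr => i _ do rewrite theta_pres_d.
  rewrite sumrB (reindex_inj (addIr (- 1))) /=.
  by under eq_bigr => i _ do rewrite subrK; rewrite subrr.
rewrite pres_piE => w0.
have dw i j : 'X^(cost k I i j) %| rfun (theta w i) j.
  by move: i j; apply/(@theta_image id); exists w.
have prim j := cyclic_primitive hn hk hI (fun i => dw i j).
have {prim} /choice[W WP] : forall j, exists W : 'Z_n -> Z, forall i,
    [/\ W i - W (i - 1) = rfun (theta w i) j,
    'X^(cost k I i j) %| W (i - 1) & 'X^(cost k I (i - 1) j) %| W (i - 1)].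
  by move=> j; apply: prim; rewrite -rfun_sum w0.
have [|v vE] := (@theta_image rel_vertex (fun i => (fun j => W j (i - 1)) : L)).2.
  by move=> i j; rewrite /rel_vertex; case: ifP => _; case: (WP j i).
exists v; apply: theta_inj; apply/funext => i; rewrite theta_pres_d vE.
apply: rfun_ext => j; rewrite rfunB /rfun addrK.
by case: (WP j i).
Qed.

(** [t^n] is divisible by every [t^(cost 0 j)], so [t^n L_I] is contained in the image of
    the projective at the vertex 0. *)
Lemma pres_split : exists N (h : {linear L -> P0}), forall x, pres_pi (h x) = pB 'X^N *: x.
Proof.
exists n.
have [s sE] := bundle_linear (@single_linear B L 'Z_n 0).
have [z zE] : exists z : {linear L -> L}, forall x, z x = pB 'X^n *: x.
  apply: bundle_linear => a u v.
  by rewrite scalerDr !scalerA (polyB_central 'X^n a).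
pose g' : {linear L -> ('Z_n -> L)} := s \o z.
have gE x i : g' x i = if i == 0 then pB 'X^n *: x else 0 by rewrite /g' /= sE zE.
have costn i j : (cost k I i j <= n)%N.
  have sumn1 m (P : nat -> bool) : (\sum_(0 <= l < m) P l <= m)%N.
    rewrite -[X in (_ <= X)%N]subn0 -[X in (_ <= X)%N]muln1 -sum_nat_const_nat.
    by apply: leq_sum => l _; case: (P l).
  have jn := ltn_Zn hn (j - i); rewrite /cost; case: ifP => _; apply: leq_trans (sumn1 _ _) _; lia.
have [|h hE] := @lift_mono _ _ _ _ (@theta id : {linear P0 -> ('Z_n -> L)}) g' (@theta_inj id).
  move=> x; apply/theta_image => i j; rewrite gE; case: eqP => _.
    by rewrite rfun_poly dvdp_mulr // dvdp_exp2l.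
  by rewrite rfun0 dvdp0.
exists h => x; rewrite pres_piE; under eq_bigr => i _ do rewrite hE gE.
by rewrite (bigD1 0) //= big1 ?addr0 // => i /negPf->.
Qed.

End Presentation.

(** * Shifting the rim *)

Section Twist.
Variables (F : fieldType) (n k : nat).
Hypotheses (hn : (1 < n)%N).
Variables (I1 I2 : {set 'Z_n}) (h1 : #|I1| = k) (h2 : #|I2| = k) (e : 'Z_n -> nat).
Hypothesis eP : forall i, (e i + (i \notin I1) = (i \notin I2) + e (i - 1)%R)%N.

(** The equation [eP] says that rescaling by [t^(e j)] at each vertex intertwines the two
    actions of [x_i]; it implies the same for [y_i]. *)
Definition twist (g : rank1 F hn h1) : rank1 F hn h2 := fun j => 'X^(e j) * rfun g j.

Lemma twistE g j : rfun (twist g) j = 'X^(e j) * rfun g j.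
Proof. by []. Qed.

Lemma twist_linear : linear twist.
Proof.
have wtE (a : arrow (circle n)) :
    'X^(e (atgt a)) * rank1_wt F I1 a = rank1_wt F I2 a * 'X^(e (asrc a)).
  case: a => i /=; have := eP i; case: (i \in I1); case: (i \in I2) => /= ei;
    rewrite ?mul1r ?mulr1 -?exprS -?exprSr; congr ('X^_); lia.
have pathE (p : qpath (circle n)) : 'X^(e (ptgt p)) * (\prod_(a <- parr p) rank1_wt F I1 a)
    = (\prod_(a <- parr p) rank1_wt F I2 a) * 'X^(e (psrc p)).
  case: p => [[v w] H]; rewrite /ptgt /psrc /parr /=.
  elim: w v {H} (H : walk v w) => [|a w IHw] v H; first by rewrite !big_nil mul1r mulr1.
  have [/eqP <- H'] := andP H; rewrite !big_cons /=.
  by rewrite mulrCA (IHw _ H') mulrCA (mulrC (rank1_wt _ _ _)) wtE; ring.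
have actE (a : pathalg F (circle n)) (g : 'Z_n -> {poly F}) :
    (fun j => 'X^(e j) * rep_act (rank1_wt F I1) a g j) =
    rep_act (rank1_wt F I2) a (fun j => 'X^(e j) * g j).
  apply/funext => j; elim/freemod_ind: a => [|c p a IHa]; first by rewrite !rep_act0 mulr0.
  rewrite !rep_act_lin !addrfctE mulrDr IHa; congr (_ + _).
  rewrite !scalrfctE -scalerAr !rep_act_basis /path_act; congr (_ *: _).
  by case: eqP => [->|_]; rewrite ?mulr0 // !mulrA pathE.
move=> a u v; apply: rfun_ext => j.
rewrite -[a]qpi_repr [RHS]rfunD !twistE rfunD mulrDr !rfun_toB; congr (_ + _).
exact: (congr1 (fun f => f j) (actE _ _)).
Qed.

Lemma twist_inj : injective twist.
Proof.
move=> u v uv; apply: rfun_ext => j; have := congr1 (fun g => rfun g j) uv.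
by apply: mulfI; apply: polyXn_neq0.
Qed.

Lemma twist_image g : (exists x, twist x = g) <-> (forall j, 'X^(e j) %| rfun g j).
Proof.
split=> [[x <-] j|dg]; first exact: dvdp_mulIl.
have /choice[x xE] : forall j, exists x, rfun g j = x * 'X^(e j).
  by move=> j; apply/Pdiv.Field.dvdpP.
by exists x; apply: rfun_ext => j; rewrite xE mulrC.
Qed.

End Twist.

Section Shift.
Variables (F : fieldType) (n k : nat).
Hypotheses (hn : (1 < n)%N) (hk : (1 <= k <= n - 1)%N).
Variables (I : {set 'Z_n}) (hI : #|I| = k).
Local Notation B := (algB F n k).
Local Notation L := (rank1 F hn hI).

Definition shift_set : {set 'Z_n} := [set i | i - k%:R \in I].

Lemma card_shift_set : #|shift_set| = k.
Proof.
rewrite -hI -(card_imset _ (addIr (- k%:R : 'Z_n))); apply: eq_card => i.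
apply/imsetP/idP => [[j]|iI]; first by rewrite inE => jI ->.
by exists (i + k%:R); rewrite ?inE addrK.
Qed.

(** The windows of length [k] ending at [i] and at [i - 1] differ in their end points. *)
Lemma xcost_shift i :
  (xcost I i k + (i \notin shift_set) = (i \notin I) + xcost I (i - 1)%R k)%N.
Proof.
rewrite inE /xcost -big_nat_recr //= big_nat_recl //= subr0; congr (_ + _)%N.
by apply: eq_bigr => b _; rewrite -natr1 opprD addrA addrAC.
Qed.

(** Twisting by the cost from the antipodal point embeds [L_(I+k)] in [L_I]. *)
Lemma iso_shift (K : lmodType B) (f : {linear K -> L}) : injective f ->
  (forall g, (exists x, f x = g) <-> (forall j, 'X^(xcost I j k) %| rfun g j)) ->
  lmod_iso K (rank1 F hn card_shift_set).
Proof.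
move=> fi fP.
have [t tE] := bundle_linear (@twist_linear F n k hn _ _ card_shift_set hI _ xcost_shift).
apply: (lmod_iso_same_image fi (g := t)) => [x y|g].
  by rewrite !tE; apply: twist_inj.
rewrite fP -twist_image; split=> -[x xE]; exists x; first by rewrite tE.
by rewrite -tE.
Qed.

(** By [pres_d_ker] kernel elements are constant families, so one value in [L_I]
    determines them. This value must be divisible by [t^(cost u j)] for all the vertices
    [u] of relators, the largest cost being that of the antipodal point. *)
Lemma ker_pres_d (K : lmodType B) (i : {linear K -> _}) : kernel_of i (pres_d F k I) ->
  lmod_iso K (rank1 F hn card_shift_set).
Proof.
case=> ii ki.
have [f fE] : exists f : {linear K -> L}, forall x, f x = theta hn hI (i x) 0.
  apply: bundle_linear => a u v; rewrite linearP.
  by rewrite /theta coord_lin scalerDl -scalerA.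
have thi x l : theta hn hI (i x) l = f x.
  by rewrite fE; apply: (pres_d_ker hn hk hI (i x)).1; apply/ki; exists x.
apply: (iso_shift (f := f)) => [x y xy|g].
  by apply: ii; apply: (theta_inj hk (hI := hI)); apply/funext => l; rewrite !thi.
split=> [[x <-] j|dg].
  have [dv _] := theta_image hk (rel_vertex I) (theta hn hI (i x)).
  have {dv} dv l : 'X^(cost k I (rel_vertex I l) j) %| rfun (f x) j.
    by rewrite -(thi x l); apply: dv; exists (i x).
  have := dv (j - k%:R); rewrite /rel_vertex; case: ifPn => farI; first by rewrite cost_x.
  have -> : j - k%:R - 1 = j + (n - k).-1%:R.
    rewrite -[(n - k).-1]subn1 natrB ?(natr_subn hn) ?addrA //; lia.
  rewrite cost_y ?leq_pred // => dv'.
  rewrite xcost_ycost // -(prednK (n := n - k)); last by lia.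
  rewrite /ycost big_nat_recr //= prednK; last by lia.
  by rewrite (natr_subn hn) ?(negPf farI) ?addn0 //; lia.
have [|w wE] := (theta_image hk (rel_vertex I) (fun _ => g)).2.
  by move=> l j; apply: dvdp_trans (dg j); rewrite dvdp_exp2l // cost_le.
have /ki[x xE] : pres_d F k I w = 0 by apply: (pres_d_ker hn hk hI w).2 => l; rewrite wE.
by exists x; rewrite fE xE wE.
Qed.

End Shift.

(** * The kernel of the presentation by peaks and valleys *)

Section PeaksValleys.
Variables (n k : nat).
Hypotheses (hn : (1 < n)%N) (hk : (1 <= k <= n - 1)%N).
Variables (I : {set 'Z_n}) (hI : #|I| = k).
Local Notation U := (peaks I).
Local Notation V := (valleys I).

Lemma in_out_I : (exists i, i \in I) /\ (exists i, i \notin I).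
Proof.
have cZ : #|{: 'Z_n}| = n by rewrite card_ord Zp_cast.
split; first by apply/card_gt0P; rewrite hI; case/andP: hk.
have /card_gt0P[i] : (0 < #|~: I|)%N by have := cardsC I; rewrite cZ hI; lia.
by rewrite inE => iI; exists i.
Qed.

Lemma exists_valley : exists v, v \in V.
Proof.
have [[i iI] [j jI]] := in_out_I.
case: (pickP (mem V)) => [v vV|noV]; first by exists v.
case/negP: jI; apply: (@circle_ind n (fun i => i \in I) i) => // {}i {}iI.
by have := noV i; rewrite !inE iI /= => /negbFE.
Qed.

Lemma exists_peak : exists u, u \in U.
Proof.
have [[i iI] [j jI]] := in_out_I.
case: (pickP (mem U)) => [u uU|noU]; first by exists u.
case/negP: (jI); apply/negPn; apply: contraTT iI => _.
apply: (@circle_ind n (fun i => i \notin I) j) => // {}i {}iI.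
by have := noU i; rewrite !inE iI /= => /negbT.
Qed.

Lemma step1 : unit_step (1 : 'Z_n). Proof. by left. Qed.
Lemma stepN1 : unit_step (-1 : 'Z_n). Proof. by right. Qed.

(** Peaks and valleys alternate around the circle. The next four lemmas are [reach_back]
    for the two directions and the two kinds of stretches, inside and outside of [I]. *)
Lemma valley_of_peakK u : u \in U -> reach (-1) U (reach 1 V u) = u.
Proof.
have [u0 u0U] := exists_peak; have [v0 v0V] := exists_valley.
by apply: (reach_back hn (C := I) step1 u0U v0V) => i; rewrite inE.
Qed.

Lemma peak_of_valleyK v : v \in V -> reach 1 V (reach (-1) U v) = v.
Proof.
have [u0 u0U] := exists_peak; have [v0 v0V] := exists_valley.
rewrite -{1}[1]opprK; apply: (reach_back hn (C := [set i | i + 1 \in I]) stepN1 v0V u0U) => i;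
  by rewrite !inE subrK andbC.
Qed.

Lemma next_peakK v : v \in V -> reach (-1) V (reach 1 U v) = v.
Proof.
have [u0 u0U] := exists_peak; have [v0 v0V] := exists_valley.
apply: (reach_back hn (C := ~: I) step1 v0V u0U) => i; rewrite !inE ?negbK //.
Qed.

Lemma prev_valleyK u : u \in U -> reach 1 U (reach (-1) V u) = u.
Proof.
have [u0 u0U] := exists_peak; have [v0 v0V] := exists_valley.
rewrite -{1}[1]opprK.
apply: (reach_back hn (C := [set i | i + 1 \notin I]) stepN1 u0U v0V) => i;
  by rewrite !inE subrK ?negbK andbC.
Qed.

(** Extend [f] to all vertices by its value at the next valley: this is locally constant
    away from valleys, and at a valley the hypothesis for the next peak applies. *)
Lemma valley_const (T : Type) (f : 'Z_n -> T) :
  (forall u, u \in U -> f (reach 1 V u) = f (reach (-1) V u)) ->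
  forall v v', v \in V -> v' \in V -> f v = f v'.
Proof.
have [u0 u0U] := exists_peak; have [v0 v0V] := exists_valley.
move=> fU.
pose g i := f (reach 1 V i).
have gS i : g (i + 1) = g i.
  have [iV|iV] := boolP (i \in V); last by rewrite /g [in RHS](reach_step hn step1 v0V).
  have iI : i \in I /\ i + 1 \notin I by move: iV; rewrite inE => /andP.
  have uU := reach_mem hn step1 u0U i.
  have : g (reach 1 U i) = g (i + 1).
    rewrite (reach_step hn step1 u0U) ?inE ?iI.1 //.
    suff [] : reach 1 U (i + 1) \notin I /\ g (reach 1 U (i + 1)) = g (i + 1) by [].
    apply: (reach_ind hn step1 u0U (P := fun j => j \notin I /\ g j = g (i + 1))).
      by case: iI.
    move=> j [jI <-]; rewrite inE jI /= => jI'; split=> //.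
    by rewrite /g [in RHS](reach_step hn step1 v0V) // inE (negPf jI).
  move=> <-; rewrite /g fU // next_peakK // (reach_id hn step1 v0V) //.
have gc i : g i = g 0.
  by apply: (@circle_ind n (fun i => g i = g 0) 0) => // {}i <-.
move=> v v' vV v'V.
by rewrite -(reach_id hn step1 v0V vV) -(reach_id hn step1 v0V v'V) -/(g _) -/(g _) !gc.
Qed.

Lemma dist_prevE (X : {set 'Z_n}) (v : 'Z_n) : v - (dist_prev X v)%:R = reach (-1) X v.
Proof.
rewrite /reach mulN1r; congr (_ - _%:R); apply: eq_find => a.
by rewrite mulN1r.
Qed.

Lemma dist_nextE (X : {set 'Z_n}) (v : 'Z_n) : v + (dist_next X v)%:R = reach 1 X v.
Proof.
rewrite /reach mul1r; congr (_ + _%:R); apply: eq_find => a.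
by rewrite mul1r.
Qed.

(** Between a peak and the next valley there are only elements of [I]. *)
Lemma run_before v l : v \in V -> (l < dist_prev U v)%N -> v - l%:R \in I.
Proof.
have [u0 u0U] := exists_peak; move=> vV.
have [_ _ nU] := dist_spec hn stepN1 u0U v.
have -> : dist_prev U v = dist (-1) U v by apply: eq_find => a; rewrite mulN1r.
elim: l => [|l IHl] ld; first by rewrite subr0; move: vV; rewrite inE => /andP[].
have := nU _ ld; rewrite mulN1r inE -natr1 opprD addrA subrK IHl ?(ltnW ld) //.
by rewrite andbT negbK.
Qed.

Lemma gap_after v l : v \in V -> (l < dist_next U v)%N -> v + l.+1%:R \notin I.
Proof.
have [u0 u0U] := exists_peak; move=> vV.
have [_ _ nU] := dist_spec hn step1 u0U v.
have -> : dist_next U v = dist 1 U v by apply: eq_find => a; rewrite mul1r.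
elim: l => [|l IHl] ld; first by move: vV; rewrite inE => /andP[].
have := nU _ ld; rewrite mul1r inE IHl ?(ltnW ld) //=.
by rewrite -addrA natr1.
Qed.

(** Moving towards [j] through elements of [I] the cost does not change, until a valley
    or [j] itself, of cost 0, is met. *)
Lemma valley_max_x j a : (a <= k)%N -> j - a%:R \in I ->
  xcost I j a = 0%N \/ exists2 v, v \in V & cost k I v j = xcost I j a.
Proof.
elim: a => [|a IHa] ak jaI; first by left; rewrite /xcost big_geq.
have [jI|jI] := boolP (j - a%:R \in I).
  have -> : xcost I j a.+1 = xcost I j a by rewrite /xcost big_nat_recr //= jI addn0.
  exact/IHa/jI/ltnW.
right; exists (j - a.+1%:R); last by rewrite cost_x.
by rewrite inE jaI -natr1 opprD addrA subrK.
Qed.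

Lemma valley_max_y j b : (b <= n - k)%N -> j + b.+1%:R \notin I ->
  ycost I j b = 0%N \/ exists2 v, v \in V & cost k I v j = ycost I j b.
Proof.
elim: b => [|b IHb] bk jbI; first by left; rewrite /ycost big_geq.
have [jI|jI] := boolP (j + b.+1%:R \in I); last first.
  have -> : ycost I j b.+1 = ycost I j b by rewrite /ycost big_nat_recr //= (negPf jI) addn0.
  exact/IHb/jI/ltnW.
right; exists (j + b.+1%:R); last by rewrite cost_y.
by rewrite inE jI -addrA natr1.
Qed.

(** The maximal cost is that of the antipodal point, and it is attained at a valley: going
    from there towards [j] on the appropriate arc, the cost stays constant up to a valley. *)
Lemma valley_max j :
  xcost I j k = 0%N \/ exists2 v, v \in V & cost k I v j = xcost I j k.
Proof.
have [farI|farI] := boolP (j - k%:R \in I); first exact: valley_max_x.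
have kE : k = k.-1.+1 by rewrite prednK //; case/andP: hk.
have far1 : j - k.-1%:R = j - k%:R + 1 by rewrite {2}kE -natr1 opprD addrA subrK.
have [far1I|far1I] := boolP (j - k.-1%:R \in I).
  have -> : xcost I j k = xcost I j k.-1.
    by rewrite [in LHS]kE /xcost big_nat_recr //= far1I addn0.
  by apply: valley_max_x => //; rewrite leq_pred.
rewrite xcost_ycost //; apply: valley_max_y => //.
rewrite -natr1 (natr_subn hn) ?addrA -?far1 //; lia.
Qed.

End PeaksValleys.

Section KerPresMap.
Variables (F : fieldType) (n k : nat).
Hypotheses (hn : (1 < n)%N) (hk : (1 <= k <= n - 1)%N).
Variables (I : {set 'Z_n}) (hI : #|I| = k).
Local Notation U := (peaks I).
Local Notation V := (valleys I).
Local Notation B := (algB F n k).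
Local Notation L := (rank1 F hn hI).
Local Notation one := (one_at F hn hI).

Lemma xpath_one u a : (forall l, (l < a)%N -> u + l.+1%:R \in I) ->
  qpi (@relB F n k) (xpath F u a) *: one u = one (u + a%:R).
Proof.
move=> uI; apply: rfun_ext => j; rewrite rfun_toB rep_act_xpath one_atE /one_at eqxx mulr1.
rewrite big_nat big1 => [|l /andP[_ /uI ->]] //.
by case: eqP.
Qed.

Lemma ypath_one u a : (forall l, (l < a)%N -> u - l%:R \notin I) ->
  qpi (@relB F n k) (ypath F u a) *: one u = one (u - a%:R).
Proof.
move=> uI; apply: rfun_ext => j; rewrite rfun_toB rep_act_ypath one_atE /one_at eqxx mulr1.
rewrite big_nat big1 => [|l /andP[_ /uI /negPf->]] //.
by case: eqP.
Qed.

Lemma pres_gen_one v u : v \in V ->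
  (pres_gen F k I v u : B) *: one u =
  (if u == reach (-1) U v then one v else 0) - (if u == reach 1 U v then one v else 0).
Proof.
move=> vV; rewrite /pres_gen scalerBl -dist_prevE -dist_nextE; congr (_ - _).
  case: eqP => [->|_]; last by rewrite scale0r.
  rewrite xpath_one ?subrK // => l la.
  have := run_before hn hk hI vV (l := dist_prev U v - l.+1); rewrite natrB // opprB addrA.
  rewrite addrAC; apply; lia.
case: eqP => [->|_]; last by rewrite scale0r.
rewrite ypath_one ?addrK // => l la.
have := gap_after hn hk hI vV (l := dist_next U v - l.+1).
rewrite subnSK // natrB ?(ltnW la) // addrA; apply; lia.
Qed.

Lemma pres_gen_eB v u : (pres_gen F k I v u : B) * eB F k u = pres_gen F k I v u.
Proof.
rewrite /pres_gen mulrBl; congr (_ - _); case: eqP => _; rewrite ?mul0r //.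
  exact: xpath_eB.
exact: ypath_eB.
Qed.

Local Notation PV := (submod (proj_sum F k V)).

Definition vcoord (w : PV) (v : 'Z_n) : B := subval w v.
Arguments vcoord : simpl never.

Definition vtheta (w : PV) (v : 'Z_n) : L := vcoord w v *: one v.

Lemma vcoordP w v : v \in V -> @projB F n k v (vcoord w v).
Proof. by move=> vV; have /asboolP/(_ v) := subvalP w; rewrite vV. Qed.

Lemma vcoord_out w v : v \notin V -> vcoord w v = 0.
Proof. by move=> /negPf vV; have /asboolP/(_ v) := subvalP w; rewrite vV. Qed.

Lemma vtheta_lin a u v i : vtheta (a *: u + v) i = a *: vtheta u i + vtheta v i.
Proof.
rewrite /vtheta /vcoord subval_lin addrfctE scalrfctE scalerDl -scalerA.
by [].
Qed.

Lemma pres_mapE w u : pres_map F k I w u = \sum_(v in V) vcoord w v * (pres_gen F k I v u : B).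
Proof. by rewrite /pres_map /= /gen_map fct_sumE. Qed.

(** Each peak has one valley on either side. *)
Lemma sum_fiber_valley (f : 'Z_n -> L) d u :
  unit_step d ->
  \sum_(v in V) (if u == reach (- d) U v then f v else 0) = (if u \in U then f (reach d V u) else 0).
Proof.
have [u0 u0U] := exists_peak hn hk hI; have [v0 v0V] := exists_valley hn hk hI.
move=> sd.
have sd' : unit_step (- d) by case: sd => ->; rewrite ?opprK; [exact: stepN1|exact: step1].
have K1 : forall u, u \in U -> reach (- d) U (reach d V u) = u.
  case: sd => -> {}u uU; first exact: (valley_of_peakK hn hk hI).
  by rewrite opprK; apply: (prev_valleyK hn hk hI).
have K2 : forall v, v \in V -> reach d V (reach (- d) U v) = v.
  case: sd => -> v vV; first exact: (peak_of_valleyK hn hk hI).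
  by rewrite opprK; apply: (next_peakK hn hk hI).
case: ifPn => uU; last first.
  rewrite big1 // => v _; case: eqP => // uE.
  by case/negP: uU; rewrite uE; exact: (reach_mem hn sd' u0U).
rewrite (bigD1 (reach d V u)) /=; last exact: (reach_mem hn sd v0V).
rewrite K1 // eqxx big1 ?addr0 // => v /andP[vV vu]; case: eqP => // uE.
by case/eqP: vu; rewrite uE K2.
Qed.

Lemma pres_map_ker w : pres_map F k I w = 0 <->
  (forall v v', v \in V -> v' \in V -> vtheta w v = vtheta w v').
Proof.
have actE u : (pres_map F k I w u : B) *: one u =
    (if u \in U then vtheta w (reach 1 V u) else 0) - (if u \in U then vtheta w (reach (-1) V u) else 0).
  rewrite pres_mapE scaler_suml -!sum_fiber_valley; try by [left|right].
  rewrite opprK -sumrB; apply: eq_bigr => v vV.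
  rewrite -scalerA pres_gen_one // scalerBr /vtheta.
  by congr (_ - _); case: eqP; rewrite ?scaler0.
have proj u : @projB F n k u (pres_map F k I w u : B).
  exists (pres_map F k I w u : B); rewrite pres_mapE mulr_suml.
  by apply: eq_bigr => v _; rewrite -mulrA [_ * qpi _ _]pres_gen_eB.
split=> [w0|wc].
  apply: (valley_const hn hk hI) => u uU.
  have := actE u; rewrite uU w0 scale0r => /esym/eqP.
  by rewrite subr_eq0 => /eqP.
apply/funext => u; apply: (projB_faithful hk (hI := hI) (proj u)).
have [u0 u0U] := exists_peak hn hk hI; have [v0 v0V] := exists_valley hn hk hI.
rewrite actE; case: ifP => _; last by rewrite subrr.
apply/eqP; rewrite subr_eq0; apply/eqP; apply: wc; apply: (reach_mem hn _ v0V).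
  exact: step1.
exact: stepN1.
Qed.

(** As for [ker_pres_d]: the kernel consists of the constant families on the valleys, and
    by [valley_max] the divisibility conditions at the valleys are the same. *)
Lemma ker_pres_map_iso :
  lmod_iso (submod (ker_submodule (pres_map F k I))) (rank1 F hn (card_shift_set hI)).
Proof.
set K := submod _; have [v0 v0V] := exists_valley hn hk hI.
have [i [ii ki]] := ker_submodule_kernel (pres_map F k I).
have [f fE] : exists f : {linear K -> L}, forall x, f x = vtheta (i x) v0.
  by apply: bundle_linear => a u v; rewrite linearP vtheta_lin.
have thi x v : v \in V -> vtheta (i x) v = f x.
  move=> vV; rewrite fE; have /pres_map_ker : pres_map F k I (i x) = 0 by apply/ki; exists x.
  exact.
have vtheta_inj w w' : vtheta w =1 vtheta w' -> w = w'.
  move=> ww'; apply: val_inj; apply/funext => v; change (vcoord w v = vcoord w' v).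
  have [vV|vV] := boolP (v \in V); last by rewrite !vcoord_out.
  apply/eqP; rewrite -subr_eq0; apply/eqP.
  apply: (projB_faithful hk (hI := hI) (u := v)).
    by have := smemP (-1) (vcoordP w' vV) (vcoordP w vV); rewrite scaleN1r addrC.
  by rewrite scalerBl; apply/eqP; rewrite subr_eq0; apply/eqP/ww'.
apply: (iso_shift (f := f)) => [x y xy|g].
  apply: ii; apply: vtheta_inj => v; have [vV|vV] := boolP (v \in V); first by rewrite !thi.
  by rewrite /vtheta !vcoord_out.
split=> [[x <-] j|dg].
  have dv v : v \in V -> 'X^(cost k I v j) %| rfun (f x) j.
    move=> vV; rewrite -(thi x v vV); apply/Pdiv.Field.dvdpP.
    apply: (projB_image hk v (vtheta (i x) v)).1.
    by exists (vcoord (i x) v) => //; exact: vcoordP.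
  by have [->|[v vV <-]] := valley_max hn hk hI j; [rewrite dvd1p|exact: dv].
have /choice[b bP] : forall v, exists b : B, (if v \in V then @projB F n k v b else b = 0)
    /\ (v \in V -> b *: one v = g).
  move=> v; have [vV|vV] := boolP (v \in V); last by exists 0.
  have [|b bP bE] := (projB_image hk v g).2; last by exists b.
  move=> j; apply/Pdiv.Field.dvdpP; apply: dvdp_trans (dg j).
  by rewrite dvdp_exp2l // cost_le.
have bV : smemb (proj_sum F k V) (b : 'Z_n -> B^o).
  by apply/asboolP => v; have [] := bP v; case: ifP.
have bE v : v \in V -> vtheta (Submod bV) v = g by move=> vV; apply: (bP v).2.
have /ki[x xE] : pres_map F k I (Submod bV) = 0.
  by apply/pres_map_ker => v v' vV v'V; rewrite !bE.
by exists x; rewrite fE xE bE.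
Qed.

End KerPresMap.

(** * Extensions between rank 1 modules *)

Section ExtOneRank.
Variables (F : fieldType) (n k : nat).
Hypotheses (hn : (1 < n)%N) (hk : (1 <= k <= n - 1)%N).
Local Notation B := (algB F n k).
Local Notation Z := {poly F}.
Local Notation pB := (@polyB F n k).
Local Notation n' := (Zp_trunc n).+2.
Variables (I J : {set 'Z_n}) (hI : #|I| = k) (hJ : #|J| = k).
Local Notation L := (rank1 F hn hI).
Local Notation N := (rank1 F hn hJ).
Local Notation oneJ := (one_at F hn hJ).
Local Notation tau := (rel_vertex I).
Local Notation P0 := (submod (@proj_fam F n k id)).
Local Notation P1 := (submod (@proj_fam F n k tau)).
Local Notation d := (pres_d F k I).
Local Notation A := (cyc_mx I J ('X : Z)).

(** A map from [P_(t i)] to [L_J] is determined by the coordinate at [t i] of the image of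
    [e_(t i)], an arbitrary element of [F[t]]. *)
Definition hom_row (t : 'Z_n -> 'Z_n) (f : submod (@proj_fam F n k t) -> N) : 'rV[Z]_n' :=
  \row_i rfun (f (fam_gen F k t i)) (t i).

Lemma hom_row_inj t (f g : {linear submod (@proj_fam F n k t) -> N}) :
  hom_row f = hom_row g -> f =1 g.
Proof.
move=> fg w; rewrite (linear_comb f) (linear_comb g) /comb; apply: eq_bigr => i _; congr (_ *: _).
rewrite -eB_gen !linearZ; apply: rfun_ext => j; rewrite !rfun_eB; case: eqP => // _.
by have /rowP/(_ i) := fg; rewrite !mxE.
Qed.

Lemma hom_row_surj t (v : 'rV[Z]_n') :
  exists f : {linear submod (@proj_fam F n k t) -> N}, hom_row f = v.
Proof.
exists (comb (fun i : 'Z_n => pB (v 0 i) *: oneJ (t i))); apply/rowP => i; rewrite mxE /=.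
by rewrite comb_gen rfun_eB eqxx rfun_poly one_atE eqxx mulr1.
Qed.

Lemma hom_row_comp (g : {linear P0 -> N}) : hom_row (g \o d) = hom_row g *m A.
Proof.
apply/rowP => i; rewrite mul_cyc_mx !mxE /= comb_gen linearZ rfun_eB eqxx.
rewrite /relator /rel_vertex !inE; case: ifP => iI; rewrite linearB linearZ rfunB.
  by rewrite rfun_xB eqxx andbT /= expr0 mul1r.
by rewrite rfun_yB eqxx andbF /= expr0 mul1r.
Qed.

Lemma zscale (M : lmodType B) (p : Z) : exists z : {linear M -> M}, forall x, z x = pB p *: x.
Proof. by apply: bundle_linear => a u v; rewrite scalerDr !scalerA (polyB_central p a). Qed.

Lemma hom_rowZ t p (f : submod (@proj_fam F n k t) -> N) :
  hom_row (fun w => pB p *: f w) = p *: hom_row f.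
Proof. by apply/rowP => i; rewrite !mxE rfun_poly. Qed.

(** A map killing the kernel extends along [d] after multiplication by the power of [t]
    that factors through [P0]. Conversely [L_J] has no [t]-torsion. *)
Lemma hom_row_sat (f : {linear P1 -> N}) :
  (forall w, d w = 0 -> f w = 0) <-> t_saturation A (hom_row f).
Proof.
split=> [fd|[e [v vE]] w dw].
  have [e [h hE]] := pres_split F hn hk hI; have [z zE] := zscale P0 'X^e.
  have [_ j0 _ ex] := pres_exact F hn hk hI.
  have [|s sE] := j0 _ _ d (z \- (h \o pres_pi F hn hI) : {linear P0 -> P0}).
    move=> x; apply/ex; rewrite /= linearB zE hE linearZ.
    by rewrite subrr.
  exists e, (hom_row (f \o s)); rewrite -hom_row_comp -hom_rowZ; congr hom_row.
  apply/funext => w /=; apply/eqP; rewrite eq_sym -subr_eq0 -linearZ -linearB.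
  apply/eqP/fd; rewrite linearB sE /= zE.
  rewrite (_ : pres_pi F hn hI (d w) = 0); last by apply/ex; exists w.
  by rewrite linear0 subr0 linearZ subrr.
have [g gE] := hom_row_surj id v; have [z zE] := zscale N 'X^e.
have zf : z \o f =1 g \o d.
  apply: hom_row_inj; rewrite hom_row_comp gE -vE -hom_rowZ; congr hom_row.
  by apply/funext => x; rewrite /= zE.
have := zf w; rewrite /= dw linear0 zE => zfw; apply: rfun_ext => j.
have := congr1 (fun g => rfun g j) zfw; rewrite rfun_poly !rfun0 => /eqP.
by rewrite mulf_eq0 (negPf (polyXn_neq0 _ _)) => /eqP.
Qed.

Lemma Ext_rank1 (M : lmodType B) (i : nat) : stab (syzygy M i) L ->
  exists h : seq nat, [/\ sorted leq h, all (leq 1) h, size h = (LR_boxes I J - 1)%N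
    & lmod_iso (Ext (@polyB_central F n k) M N i.+1) (cyclic_prod F h)].
Proof.
move=> st; have [h [[phi [phis phi0]] hs h1 hsz]] := torsion_quotient_cyc_mx hn hI hJ F.
exists h; split=> //.
have [T [Tc Tb Ts]] := Ext1_transport (@polyB F n k : {rmorphism Z -> B}) N (pres_exact F hn hk hI) st.
set C := cocycle (@polyB_central F n k) M N i.+1.
pose row (x : submod C) : 'rV[Z]_n' := hom_row (fun w => subval x (T w) : N).
have rowl : linear row.
  move=> a u v; apply/rowP => l; rewrite !mxE subval_lin addrfctE scalrfctE.
  by rewrite -rfun_poly -rfunD.
have [row' row'E] := bundle_linear rowl.
have coc (x : submod C) : is_cocycle (subval x) by have /asboolP := subvalP x.
have lin (x : submod C) : exists f : {linear P1 -> N}, f =1 (fun w => subval x (T w)).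
  by apply: bundle_linear => a u v; rewrite linearP; case: (coc x) => xl _; rewrite xl.
have rowE (x : submod C) (f : {linear P1 -> N}) : f =1 (fun w => subval x (T w)) -> row x = hom_row f.
  by move=> fE; congr hom_row; apply/funext => w; rewrite fE.
apply: (@quot_lmod_iso Z _ _ C (coboundary (@polyB_central F n k) M N i.+1) (phi \o row')) => [x|y] /=; rewrite ?row'E.
  have [f fE] := lin x; rewrite (rowE x f fE).
  rewrite phi0; last first.
    by apply/hom_row_sat => w dw; rewrite fE; apply: Tc.
  change ((exists v, hom_row f = v *m A) <-> is_coboundary (subval x)).
  rewrite (Tb _ (coc x)); split=> [[v vE]|[g gE]].
    have [g gE] := hom_row_surj id v; exists g => w; rewrite -fE.
    by apply: (hom_row_inj (g := g \o d)); rewrite hom_row_comp gE.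
  exists (hom_row g); rewrite -hom_row_comp; congr hom_row; apply/funext => w.
  by rewrite fE gE.
have [v sv <-] := phis y; have [f fv] := hom_row_surj tau v.
have [|c cc [g cE]] := Ts f; first by apply/hom_row_sat; rewrite fv.
have cS : smemb C c by apply/asboolP.
exists (Submod cS); rewrite row'E.
have -> : row (Submod cS) = v + hom_row g *m A.
  rewrite -hom_row_comp -fv; apply/rowP => l; rewrite !mxE /= cE.
  by rewrite rfunD.
rewrite linearD (_ : phi (_ *m _) = 0) ?addr0 //; apply/phi0; last by exists (hom_row g).
by exists 0%N, (hom_row g); rewrite scale1r.
Qed.

(** The choice in [rim] returns an actual rim of any module that has one. *)
Lemma rim_spec (M : lmodType B) :
  (exists (I' : {set 'Z_n}) (hI' : #|I'| = k), lmod_iso M (rank1 F hn hI')) ->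
  exists hR : #|rim hn M| = k, lmod_iso M (rank1 F hn hR).
Proof.
move=> [I' hI']; rewrite /rim; case: pickP => [R /asboolP //|noR].
by have := noR I'; move/asboolP.
Qed.

End ExtOneRank.

(** Both the second syzygy of the presentation with one generator per vertex and the kernel
    defining [Omega2] are the rank 1 module with the shifted rim. *)
Lemma Omega_even_stab (F : fieldType) (n k : nat) (hn : (1 < n)%N)
    (hk : (1 <= k <= n - 1)%N) (I : {set 'Z_n}) (hI : #|I| = k) (m : nat) :
  let X := Omega_even hn (rank1 F hn hI) m in
  (exists hR : #|rim hn X| = k, lmod_iso X (rank1 F hn hR)) /\
  stab (syzygy (rank1 F hn hI) (2 * m)) X.
Proof.
elim: m => [|m [[hR iR] st]] X.
  split; last exact: stab_refl.
  apply: rim_spec; exists I, hI; exists idfun; exact: inv_bij.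
have iso := ker_pres_map_iso F hn hk hR.
split; first by apply: rim_spec; exists (shift_set k _), (card_shift_set hR).
have -> : (2 * m.+1 = (2 * m).+2)%N by lia.
have [d' [_ pr' [i' ki']]] := res_presents (rank1 F hn hI) (2 * m).
have [i ki] := ker_submodule_kernel (pres_d F k (rim hn (Omega_even hn (rank1 F hn hI) m))).
have stR := stab_iso_trans st iR.
have stK := stab_ker pr' (pres_exact F hn hk hR) ki' ki stR.
apply: stab_iso_trans stK _; apply: lmod_iso_trans (lmod_iso_sym iso).
exact: ker_pres_d ki.
Qed.

Theorem proposition3p7 (F : closedFieldType) (n k : nat)
    (hn : (2 <= n)%N) (hk : (1 <= k <= n - 1)%N)
    (I J : {set 'Z_n}) (hI : #|I| = k) (hJ : #|J| = k)
    (m : nat) (hm : (0 < m)%N) :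
  let s := LR_boxes (rim hn (Omega_even hn (rank1 F hn hI) m)) J in
  exists h : seq nat,
    [/\ size h = (s - 1)%N,
        forall i, (i < size h)%N -> (0 < nth 0%N h i)%N,
        forall i, (i.+1 < size h)%N -> (nth 0%N h i <= nth 0%N h i.+1)%N
      & lmod_iso
          (Ext (@polyB_central F n k) (rank1 F hn hI) (rank1 F hn hJ) (2 * m + 1))
          (cyclic_prod F h)].
Proof.
have [[hR iR] st] := Omega_even_stab F hn hk hI m; rewrite addn1.
have [h [hs h1 hsz iso]] := Ext_rank1 hk hJ (stab_iso_trans st iR).
exists h; split=> //; first by apply/all_nthP.
by apply/sortedP.
Qed.
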